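(* Let $(y_i,x_i)$, $i=1,\dots,n$, be i.i.d. with $y_i\in\mathbb R$ and $x_i\in\mathbb R^K$, and let $X$ be the $n\times K$ matrix with rows $x_i^{\mathrm T}$. Suppose $\mathbb E_{y|x}(y_i^4)<\infty$, $\mathbb E_{y|x}\|x_i\|^4<\infty$, and $\frac1n\sum_{i=1}^nx_ix_i^{\mathrm T}$ is positive definite. Let $\beta^{\mathrm f}$ be the solution $b$ of $\frac1n\sum_{i=1}^n\mathbb E(x_i(y_i-x_i^{\mathrm T}b)\mid x_i)=0$. Then, as $n\to\infty$, $$(V^{\mathrm f})^{-1/2}\sqrt n(\hat\beta-\beta^{\mathrm f})\mid X\overset{\mathrm d}{\to}\mathcal N(0,I)\quad\text{and}\quad n\hat V_{\mathrm{EHW}}=V^{\mathrm f}+B^{\mathrm f}+o(1;\mathbb P_{y|x}).$$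
   Context: $\hat\beta$ is the ordinary least squares estimator, solving $\frac1n\sum_{i=1}^nx_i(y_i-x_i^{\mathrm T}b)=0$; $\hat\varepsilon_i=y_i-x_i^{\mathrm T}\hat\beta$; the linear model is not assumed to be correctly specified. The Eicker–Huber–White variance estimator is $$\hat V_{\mathrm{EHW}}=\frac1n\Big(\frac1n\sum_ix_ix_i^{\mathrm T}\Big)^{-1}\Big(\frac1n\sum_i\hat\varepsilon_i^2x_ix_i^{\mathrm T}\Big)\Big(\frac1n\sum_ix_ix_i^{\mathrm T}\Big)^{-1}.$$ Fixed design: inference is conditional on $X$; $\mathbb E_{y|x},\mathbb P_{y|x}$ are expectation and probability under the conditional distribution of the $y$'s given the $x$'s. With $\sigma^2(x_i)=\operatorname{Var}(y_i\mid x_i)$ and $\varepsilon_i^{\mathrm f}=y_i-x_i^{\mathrm T}\beta^{\mathrm f}$, $$V^{\mathrm f}=\Big(\frac1n\sum_ix_ix_i^{\mathrm T}\Big)^{-1}\Big(\frac1n\sum_i\sigma^2(x_i)x_ix_i^{\mathrm T}\Big)\Big(\frac1n\sum_ix_ix_i^{\mathrm T}\Big)^{-1},$$ $$B^{\mathrm f}=\Big(\frac1n\sum_ix_ix_i^{\mathrm T}\Big)^{-1}\Big(\frac1n\sum_i\mathbb E[\varepsilon_i^{\mathrm f}\mid x_i]^2x_ix_i^{\mathrm T}\Big)\Big(\frac1n\sum_ix_ix_i^{\mathrm T}\Big)^{-1}.$$ $V^{-1/2}$ is the inverse of the symmetric square root of $V$ (its use presupposes $V$ positive definite). $W_n\mid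 X_n\overset{\mathrm d}{\to}W$ means $\limsup_n\sup_t|\mathbb P(W_n\le t\mid X_n)-\mathbb P(W\le t)|=0$ almost surely. $o(1;\mathbb P_\circ)$ denotes a sequence of random variables (matrices) converging to zero in $\mathbb P_\circ$-probability; almost-sure qualifiers with respect to the conditioning variables are omitted.
   Formalization: The moment conditions are taken as unconditional, E(y_i^4)<∞ and E‖x_i‖^4<∞, since finite conditional moments alone do not suffice (Cauchy x_i, random-sign y_i); the Gram matrix and V^f are assumed positive definite almost surely for all large n. *)

(* Defs.v *)
From HB Require Import structures.
From mathcomp Require Import all_boot all_order all_algebra.
From mathcomp Require Import all_classical all_reals all_analysis.
Set Implicit Arguments.
Unset Strict Implicit.
Unset Printing Implicit Defensive.
Import Order.TTheory GRing.Theory Num.Theory.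
Import numFieldNormedType.Exports.
Local Open Scope classical_set_scope.
Local Open Scope ring_scope.

Definition mutually_independent {R : realType} {d d' : measure_display}
    {T : measurableType d} {U : measurableType d'} (P : probability T R)
    {I : choiceType} (Z : I -> T -> U) : Prop :=
  forall (s : seq I) (B : I -> set U), uniq s ->
    (forall i, measurable (B i)) ->
    P [set w | forall i, i \in s -> B i (Z i w)] =
    (\big[*%E/1%E]_(i <- s) P (Z i @^-1` B i))%E.

Definition identically_distributed {R : realType} {d d' : measure_display}
    {T : measurableType d} {U : measurableType d'} (P : probability T R)
    {I : choiceType} (Z : I -> T -> U) : Prop :=
  forall (i j : I) (B : set U), measurable B ->
    P (Z i @^-1` B) = P (Z j @^-1` B).

(** [k u] is a regular conditional distribution of [Y] given [X = u]. *)
Definition cond_distribution {R : realType} {d d1 d2 : measure_display}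
    {T : measurableType d} {U : measurableType d1} {V : measurableType d2}
    (P : probability T R) (X : T -> U) (Y : T -> V) (k : R.-pker U ~> V) :
    Prop :=
  forall (A : set U) (B : set V), measurable A -> measurable B ->
    P (X @^-1` A `&` Y @^-1` B) = (\int[P]_(w in X @^-1` A) k (X w) B)%E.

(** The random vector [W] has law N(0, I_K). *)
Definition std_normal_vector {R : realType} {d : measure_display}
    {T : measurableType d} (P : probability T R) (K : nat)
    (W : 'I_K -> T -> R) : Prop :=
  mutually_independent P W /\
  forall (j : 'I_K) (B : set R), measurable B ->
    P (W j @^-1` B) = normal_prob 0 1 B.

Definition quadform {R : realType} {K : nat} (A : 'M[R]_K) (v : 'cV[R]_K) : R :=
  (v^T *m A *m v) 0 0.

Definition posdef {R : realType} {K : nat} (A : 'M[R]_K) : Prop :=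
  A^T = A /\ forall v : 'cV[R]_K, v != 0 -> 0 < quadform A v.

Definition possemidef {R : realType} {K : nat} (A : 'M[R]_K) : Prop :=
  A^T = A /\ forall v : 'cV[R]_K, 0 <= quadform A v.

Definition sym_sqrt {R : realType} {K : nat} (V : 'M[R]_K) : 'M[R]_K :=
  xget 0 [set S : 'M[R]_K | possemidef S /\ S *m S = V].

Definition inv_sqrt {R : realType} {K : nat} (V : 'M[R]_K) : 'M[R]_K :=
  invmx (sym_sqrt V).

(** The data of a sample of size [n] are the covariates
  [xs : n.-tuple (K.-tuple R)] and the outcomes [ys : n.-tuple R]; tuples carry
  the product sigma-algebra. *)

Definition vec {R : realType} {K : nat} (x : K.-tuple R) : 'cV[R]_K :=
  \col_j tnth x j.

Definition euclid_norm {R : realType} {K : nat} (x : K.-tuple R) : R :=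
  Num.sqrt (\sum_j tnth x j ^+ 2).

Definition lin {R : realType} {K : nat} (x : K.-tuple R) (b : 'cV[R]_K) : R :=
  ((vec x)^T *m b) 0 0.

Definition weighted_gram {R : realType} {K n : nat}
    (xs : n.-tuple (K.-tuple R)) (a : 'I_n -> R) : 'M[R]_K :=
  n%:R^-1 *: \sum_i a i *: (vec (tnth xs i) *m (vec (tnth xs i))^T).

Definition gram {R : realType} {K n : nat} (xs : n.-tuple (K.-tuple R)) :
    'M[R]_K :=
  weighted_gram xs (fun=> 1).

Definition sandwich {R : realType} {K n : nat} (xs : n.-tuple (K.-tuple R))
    (a : 'I_n -> R) : 'M[R]_K :=
  invmx (gram xs) *m weighted_gram xs a *m invmx (gram xs).

Definition ols_equation {R : realType} {K n : nat}
    (xs : n.-tuple (K.-tuple R)) (ys : n.-tuple R) (b : 'cV[R]_K) : Prop :=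
  n%:R^-1 *: \sum_i (tnth ys i - lin (tnth xs i) b) *: vec (tnth xs i) = 0.

(** The default value of [xget] matters only when the equation has no
  solution; the solution is unique as soon as [gram xs] is invertible. *)
Definition ols {R : realType} {K n : nat} (xs : n.-tuple (K.-tuple R))
    (ys : n.-tuple R) : 'cV[R]_K :=
  xget 0 [set b | ols_equation xs ys b].

Definition residual {R : realType} {K n : nat} (xs : n.-tuple (K.-tuple R))
    (ys : n.-tuple R) (i : 'I_n) : R :=
  tnth ys i - lin (tnth xs i) (ols xs ys).

Definition V_EHW {R : realType} {K n : nat} (xs : n.-tuple (K.-tuple R))
    (ys : n.-tuple R) : 'M[R]_K :=
  n%:R^-1 *: sandwich xs (fun i => residual xs ys i ^+ 2).

(** [kappa x] is the conditional law of one outcome given that its covariate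
  vector is [x]. *)

Section FixedDesign.
Context {R : realType} {K : nat}.
Variable kappa : R.-pker (K.-tuple R) ~> R.

Definition cond_exp (x : K.-tuple R) (f : R -> R) : R :=
  (\int[kappa x]_(u in setT) f u)%R.

Definition cond_var (x : K.-tuple R) : R :=
  cond_exp x (fun u => (u - cond_exp x id) ^+ 2).

Definition beta_f_equation {n : nat} (xs : n.-tuple (K.-tuple R))
    (b : 'cV[R]_K) : Prop :=
  n%:R^-1 *: \sum_i \col_j
    cond_exp (tnth xs i)
      (fun u => vec (tnth xs i) j 0 * (u - lin (tnth xs i) b)) = 0.

Definition beta_f {n : nat} (xs : n.-tuple (K.-tuple R)) : 'cV[R]_K :=
  xget 0 [set b | beta_f_equation xs b].

Definition V_f {n : nat} (xs : n.-tuple (K.-tuple R)) : 'M[R]_K :=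
  sandwich xs (fun i => cond_var (tnth xs i)).

Definition B_f {n : nat} (xs : n.-tuple (K.-tuple R)) : 'M[R]_K :=
  sandwich xs (fun i =>
    cond_exp (tnth xs i) (fun u => u - lin (tnth xs i) (beta_f xs)) ^+ 2).

End FixedDesign.

Definition sample {T U : Type} (z : nat -> T -> U) (n : nat) (w : T) :
    n.-tuple U :=
  [tuple z i w | i < n].

(** [x n] is the [n]-th conditioning variable, and [Q n] the conditional law
  of the [n]-th sample given it. *)
Section Modes.
Context {R : realType} {d d1 d2 : measure_display} {T : measurableType d}
  {X : nat -> measurableType d1} {Y : nat -> measurableType d2} {K : nat}.
Variables (P : probability T R) (x : forall n, T -> X n)
  (Q : forall n, R.-pker X n ~> Y n).

(** [Wn | X_n] converges in distribution to [W]; vectors are compared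
  coordinatewise. *)
Definition cvg_in_distribution_given
    (Wn : forall n, X n -> Y n -> 'cV[R]_K)
    {d' : measure_display} {T' : measurableType d'} (P' : probability T' R)
    (W : 'I_K -> T' -> R) : Prop :=
  {ae P, forall w,
    limn_esup (fun n => ereal_sup (range (fun t : 'cV[R]_K =>
      `| Q n (x n w) [set u | forall j, (Wn n (x n w) u j 0 <= t j 0)%R]
         - P' [set v | forall j, (W j v <= t j 0)%R] |%E))) = 0%E}.

(** [Dn = o(1; P_{y|x})], in the norm of ['M[R]_K] (maximum of the absolute
  values of the entries). *)
Definition negligible_given (Dn : forall n, X n -> Y n -> 'M[R]_K) : Prop :=
  {ae P, forall w, forall eps : R, 0 < eps ->
    Q n (x n w) [set u | eps < `| Dn n (x n w) u |] @[n --> \oo] --> 0%E}.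

End Modes.

(* Main.v *)
(** Given the covariates, the outcomes are independent with laws [kappa x_i], and
  [beta-hat - beta^f = G^-1 (1/n) sum eps_i x_i] with [eps_i] centered.  The law of large numbers
  is only needed in a weak form: for the envelope [D_i = 1 + E(y_i^4|x_i) + |x_i|^4], almost
  surely [sum D_i = O(n)] and [sum D_i^2 = o(n^2)], and the smallest eigenvalues of [G] and
  [Omega = (1/n) sum sigma^2(x_i) x_i x_i^T] stay away from 0 (truncated weights make the entries
  bounded, and their limit is positive definite because [G] and [V^f] eventually are).

  The studentized estimator is then [sum eps_i a_i] with [sum sigma_i^2 a_i a_i^T = I] and
  [|a_i|^2 <= C |x_i|^2 / n].  Lindeberg's replacement of the [eps_i] by Gaussian variables,
  tested on smoothed orthant indicators, costs [O(e + n^-2 sum D_i^2 / e)] uniformly in the orthant;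
  the Gaussian sum is standard normal because Gaussian averages depend only on the Gram matrix of
  their directions.

  For the variance estimator, expanding the squared residuals leaves
  [(eps_i^2 - sigma_i^2) + 2 m_i eps_i] with [m_i = E(eps_i^f|x_i)], of variance
  [O(n^-2 sum D_i^2)] after averaging, and terms controlled by [E|beta-hat - beta^f|^2 = O(1/n)];
  Markov's inequality concludes. *)

Require Import Defs.
From HB Require Import structures.
From mathcomp Require Import all_boot all_order all_algebra.
From mathcomp Require Import ring lra spectral complex.
From mathcomp Require Import all_classical all_reals all_analysis.
From mathcomp Require Import measurable_realfun.
Set Implicit Arguments.
Unset Strict Implicit.
Unset Printing Implicit Defensive.
Import Order.TTheory GRing.Theory Num.Theory.
Import numFieldNormedType.Exports.
Local Open Scope classical_set_scope.
Local Open Scope ring_scope.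

(** * Expectations of real functions *)

(** The obstacle is that [D_i] has only a first moment: [D_i^2] need not be integrable, so
    [sum D_i^2 = o(n^2)] cannot come from a law of large numbers for [D_i^2]. It comes from
    [E sum_i min(1, D_i^2 / i^2) <= 6 E D], a telescoping estimate, followed by a Kronecker
    argument. Dyadic sample sizes are enough for the averages, because sums of nonnegative terms are
    monotone: the gaps cost a factor 2, which harms neither [O(n)] nor an eigenvalue bound.

    The conditional laws are known only through integral identities, so the product form of [Q n]
    holds off a null set that depends on the tested set; a countable class of rectangles yields a
    single null set. From then on one outcome is fixed, and every estimate is an explicit inequality
    at finite [n] in the two averages of [D_i] and an eigenvalue bound.

    Uniformity over orthants is obtained because the Taylor constant of a smoothed indicator depends
    on [K] and the smoothing width alone, and because the Gaussian side is exact for each [n]: the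
    studentized directions have Gram matrix [I] before any limit is taken. *)

Section real_expectation.
Context d (T : measurableType d) (R : realType) (m : probability T R).
Implicit Types (f g : T -> R) (k : R).

Definition rint f := m.-integrable setT (EFin \o f).

Lemma rint_measurable f : rint f -> measurable_fun setT f.
Proof. by move=> /measurable_int/measurable_EFinP. Qed.

Lemma rint_dominated f g : measurable_fun setT f -> rint g ->
  (forall x, `|f x| <= g x) -> rint f.
Proof.
move=> mf ig fg; apply: (le_integrable measurableT _ _ ig).
  exact/measurable_EFinP.
by move=> x _ /=; rewrite lee_fin (le_trans (fg x))// ler_norm.
Qed.

Lemma rint_cst k : rint (fun=> k).
Proof. exact: finite_measure_integrable_cst. Qed.

Lemma rint_bounded f k : measurable_fun setT f -> (forall x, `|f x| <= k) -> rint f.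
Proof. by move=> mf; apply: rint_dominated => //; exact: rint_cst. Qed.

Lemma rintD f g : rint f -> rint g -> rint (fun x => f x + g x).
Proof. by move=> fi gi; have := integrableD measurableT fi gi. Qed.

Lemma rintB f g : rint f -> rint g -> rint (fun x => f x - g x).
Proof. by move=> fi gi; have := integrableB measurableT fi gi. Qed.

Lemma rintZ k f : rint f -> rint (fun x => k * f x).
Proof. by move=> fi; have := integrableZl measurableT k fi. Qed.

Lemma rint_norm f : rint f -> rint (fun x => `|f x|).
Proof. by move=> fi; have := integrable_norm fi. Qed.

Lemma rint_sum I (s : seq I) (f : I -> T -> R) : (forall i, rint (f i)) ->
  rint (fun x => \sum_(i <- s) f i x).
Proof.
move=> fi; elim: s => [|i s IH].
  by under eq_fun do rewrite big_nil; exact: rint_cst.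
by under eq_fun do rewrite big_cons; exact: rintD.
Qed.

Lemma ExpE f : rint f -> (\int[m]_x f x)%:E = (\int[m]_x (f x)%:E)%E.
Proof. by move=> fi; rewrite fineK// integrable_fin_num. Qed.

Lemma ExpD f g : rint f -> rint g ->
  \int[m]_x (f x + g x) = \int[m]_x f x + \int[m]_x g x.
Proof. by move=> fi gi; rewrite RintegralD. Qed.

Lemma ExpB f g : rint f -> rint g ->
  \int[m]_x (f x - g x) = \int[m]_x f x - \int[m]_x g x.
Proof. by move=> fi gi; rewrite RintegralB. Qed.

Lemma ExpZ k f : rint f -> \int[m]_x (k * f x) = k * \int[m]_x f x.
Proof. by move=> fi; rewrite RintegralZl. Qed.

Lemma Exp_cst k : \int[m]_x k = k.
Proof. by rewrite /Rintegral integral_cst// [X in (_ * X)%E]probability_setT mule1. Qed.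

Lemma Exp_sum I (s : seq I) (f : I -> T -> R) : (forall i, rint (f i)) ->
  \int[m]_x (\sum_(i <- s) f i x) = \sum_(i <- s) \int[m]_x f i x.
Proof.
move=> fi; elim: s => [|i s IH].
  by under eq_Rintegral do rewrite big_nil; rewrite big_nil Exp_cst.
under eq_Rintegral do rewrite big_cons; rewrite big_cons ExpD// ?IH//.
exact: rint_sum.
Qed.

Lemma Exp_ge0 f : (forall x, 0 <= f x) -> 0 <= \int[m]_x f x.
Proof. by move=> f0; apply: Rintegral_ge0. Qed.

Lemma Exp_le f g : rint f -> rint g -> (forall x, f x <= g x) ->
  \int[m]_x f x <= \int[m]_x g x.
Proof. by move=> fi gi fg; apply: le_Rintegral. Qed.

Lemma Exp_norm_le f : rint f -> `|\int[m]_x f x| <= \int[m]_x `|f x|.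
Proof. by move=> fi; apply: le_normr_Rintegral. Qed.

Lemma Exp_norm_le_cst f k : rint f -> (forall x, `|f x| <= k) -> `|\int[m]_x f x| <= k.
Proof.
move=> fi fk; apply: le_trans (Exp_norm_le fi) _.
by rewrite -[leRHS]Exp_cst; apply: Exp_le => //; [exact: rint_norm|exact: rint_cst].
Qed.

Lemma rint_ge0 f : measurable_fun setT f -> (forall x, 0 <= f x) ->
  (\int[m]_x (f x)%:E < +oo)%E -> rint f.
Proof.
move=> mf f0 foo; apply/integrableP; split; first exact/measurable_EFinP.
by under eq_integral => x _ do rewrite /= ger0_norm//.
Qed.

Lemma rint_lty f : rint f -> (\int[m]_x (f x)%:E < +oo)%E.
Proof. by move=> fi; rewrite -ExpE// ltry. Qed.

Lemma prob_indic (A : set T) : measurable A -> \int[m]_x (\1_A x : R) = fine (m A).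
Proof. by move=> mA; rewrite /Rintegral integral_indic// setIT. Qed.

Lemma rint_indic (A : set T) : measurable A -> rint (\1_A).
Proof.
move=> mA; apply: (@rint_bounded _ 1); first exact: measurable_indic.
by move=> x; rewrite indicE; case: (_ \in _); rewrite ?normr1 ?normr0.
Qed.

Lemma markov_ineq f (k : R) : measurable_fun setT f -> rint f -> (forall x, 0 <= f x) ->
  0 < k -> (m [set x | (k < f x)%R] <= (k^-1 * \int[m]_x f x)%R%:E)%E.
Proof.
move=> mf fi f0 k0.
have mA : measurable [set x | k < f x].
  by rewrite -[X in measurable X]setTI; exact: measurable_fun_ltr.
rewrite -[leLHS]fineK ?fin_num_measure// lee_fin -prob_indic// -ExpZ//.
apply: Exp_le; [exact: rint_indic|exact: rintZ|].
move=> x; rewrite indicE; have [|_] := boolP (x \in _).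
  by rewrite inE /= => kf; rewrite ler_pdivlMl// mulr1 ltW.
by rewrite mulr_ge0// invr_ge0 ltW.
Qed.

End real_expectation.

(** * Positive definite matrices and their square roots *)

(** Makes a root of a diagonalizable matrix a polynomial in that matrix, so that it inherits
    symmetry and real entries. A new node is fitted by adding a multiple of the product that
    vanishes at the old ones. *)
Lemma poly_interpolation (F : fieldType) (s : seq F) (g : F -> F) :
  exists p : {poly F}, forall x, x \in s -> p.[x] = g x.
Proof.
elim: s => [|a s [p hp]]; first by exists 0.
have [as_|nas] := boolP (a \in s).
  by exists p => x; rewrite inE => /orP[/eqP->|]; exact: hp.
pose q : {poly F} := \prod_(y <- s) ('X - y%:P).
have qs x : (q.[x] == 0) = (x \in s) by rewrite -rootE root_prod_XsubC.
exists (p + ((g a - p.[a]) / q.[a])%:P * q) => x; rewrite inE => /orP[/eqP->|xs].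
  by rewrite !hornerE divfK ?qs// addrC subrK.
by have := qs x; rewrite xs !hornerE hp// => /eqP->; rewrite mulr0 addr0.
Qed.

(** The rows of [P] are left eigenvectors, which is the convention of [eigenvalue]. *)
Lemma diagonalized_eigenvalue (F : fieldType) n (A P : 'M[F]_n) (d : 'rV_n) i :
  P \in unitmx -> A = invmx P *m diag_mx d *m P -> eigenvalue A (d 0 i).
Proof.
move=> Pu AE; apply/eigenvalueP; exists (row i P).
  have PA : P *m A = diag_mx d *m P by rewrite AE !mulmxA mulmxV// mul1mx.
  by rewrite -row_mul PA row_mul row_diag_mx -scalemxAl -rowE.
apply/eqP => rP0; have : row i (P *m invmx P) = 0 by rewrite row_mul rP0 mul0mx.
by rewrite mulmxV// => /rowP/(_ i)/eqP; rewrite !mxE eqxx oner_eq0.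
Qed.

Lemma diagonalized_horner (F : fieldType) n (A P : 'M[F]_n.+1) (d : 'rV_n.+1) p :
  P \in unitmx -> A = invmx P *m diag_mx d *m P ->
  (forall i, p.[d 0 i] = d 0 i) -> horner_mx A p = A.
Proof.
move=> Pu AE pd; rewrite [in LHS]AE horner_mx_uconjC// horner_mx_diag [in RHS]AE.
by congr (_ *m diag_mx _ *m _); apply/rowP => i; rewrite mxE pd.
Qed.

Section posdef_matrices.
Context {R : realType}.

Lemma quadformE {K} (A : 'M[R]_K) v :
  quadform A v = \sum_i \sum_j v i 0 * A i j * v j 0.
Proof.
rewrite /quadform mxE exchange_big /=; apply: eq_bigr => j _.
by rewrite mxE mulr_suml; apply: eq_bigr => i _; rewrite mxE.
Qed.

Lemma sqnorm_gt0 {K} (v : 'cV[R]_K) : v != 0 -> 0 < \sum_i v i 0 ^+ 2.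
Proof.
move=> v0; rewrite lt_def sumr_ge0 ?andbT; last by move=> i _; exact: sqr_ge0.
apply: contra v0; rewrite psumr_eq0; last by move=> i _; exact: sqr_ge0.
move=> /allP h; apply/eqP/matrixP => i j; rewrite ord1 mxE.
by have := h i (mem_index_enum _); rewrite /= sqrf_eq0 => /eqP.
Qed.

Lemma mulmx_trl {K} (v : 'cV[R]_K) : (v^T *m v) 0 0 = \sum_i v i 0 ^+ 2.
Proof. by rewrite mxE; apply: eq_bigr => i _; rewrite mxE expr2. Qed.

Lemma posdef_unitmx {K} (A : 'M[R]_K) : posdef A -> A \in unitmx.
Proof.
move=> [As Ap]; rewrite -row_free_unit -kermx_eq0; apply/eqP/row_matrixP => i.
rewrite row0; apply/eqP; apply: contraT => r0.
have := Ap (row i (kermx A))^T; rewrite trmx_eq0 => /(_ r0).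
by rewrite /quadform trmxK -row_mul mulmx_ker row0 mul0mx mxE ltxx.
Qed.

Lemma posdef_eigenvalue_gt0 {K} (A : 'M[R]_K) a :
  posdef A -> eigenvalue A a -> 0 < a.
Proof.
move=> [As Ap] /eigenvalueP[v vA v0].
have vT0 : v^T != 0 by rewrite trmx_eq0.
have := Ap v^T vT0; rewrite /quadform trmxK vA -scalemxAl mxE -{1}(trmxK v).
by rewrite mulmx_trl pmulr_lgt0// sqnorm_gt0.
Qed.

(** A fourth root rather than a square root, because the square of a symmetric [T] is visibly
    positive semidefinite. The diagonalization takes place over the complex numbers, but the
    interpolating polynomial has real coefficients, so [T] is real. *)
Lemma posdef_fourth_root {K} (A : 'M[R]_K) : posdef A ->
  exists T : 'M[R]_K, T^T = T /\ (T *m T) *m (T *m T) = A.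
Proof.
case: K A => [A _|K A pA].
  by exists 0; split; apply/matrixP => -[].
pose f := @real_complex R; pose AC := map_mx f A.
have AC_herm : AC \is hermsymmx.
  apply: realsym_hermsym.
    apply/is_hermitianmxP; rewrite expr0 scale1r map_mx_id//.
    by rewrite /AC map_trmx pA.1.
  by apply/mxOverP => i j; rewrite mxE; apply/complex_realP; exists (A i j).
have /orthomx_spectralP := hermitian_normalmx AC_herm.
set P := spectralmx AC; set d := spectral_diag AC => ACE.
have Pu : P \is a GRing.unit by exact: spectral_unit.
have dR : d \is a mxOver Num.real by exact: hermitian_spectral_diag_real.
have ACA : map_mx f A = AC by [].
clearbody P d AC.
(* Being roots of the characteristic polynomial, the complex eigenvalues descend to [A], where they
   are positive. *)
have d_real i : exists2 x, d 0 i = f x & 0 < x.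
  have /mxOverP/(_ 0 i)/complex_realP[x dx] := dR.
  exists x => //; apply: (posdef_eigenvalue_gt0 pA).
  rewrite eigenvalue_root_char -(fmorph_root f) map_char_poly -eigenvalue_root_char.
  by rewrite ACA -[_ x]dx; exact: diagonalized_eigenvalue ACE.
have [p hp] := @poly_interpolation R [seq complex.Re (d 0 i) | i <- enum 'I_K.+1]
  (fun x => Num.sqrt (Num.sqrt x)).
have trE : (horner_mx A p)^T = horner_mx A p.
  elim/poly_ind: p {hp} => [|q c IH]; first by rewrite rmorph0 trmx0.
  rewrite rmorphD rmorphM /= horner_mx_X horner_mx_C linearD/= tr_scalar_mx.
  rewrite -mulmxE trmx_mul IH pA.1; congr (_ + _).
  by have := comm_mx_horner q (erefl (A *m A)).
exists (horner_mx A p); split=> //.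
rewrite !mulmxE -!rmorphM /=; apply: (map_mx_inj (f := f)).
rewrite map_horner_mx ACA; apply: (diagonalized_horner Pu ACE) => i.
have [x dx x0] := d_real i.
rewrite dx horner_map; congr (f _); rewrite !hornerE hp; last first.
  by apply/mapP; exists i; rewrite ?mem_enum// dx.
set y := Num.sqrt (Num.sqrt x); transitivity ((y ^+ 2) ^+ 2).
  by rewrite !expr2 /= !mulrA.
by rewrite /y sqr_sqrtr ?sqrtr_ge0// sqr_sqrtr// ltW.
Qed.

(** [sym_sqrt] is a choice, so one witness is enough: the square of the symmetric fourth root [T],
    whose form at [v] is [|T v|^2]. *)
Lemma sym_sqrtP {K} (V : 'M[R]_K) : posdef V ->
  possemidef (sym_sqrt V) /\ sym_sqrt V *m sym_sqrt V = V.
Proof.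
move=> pV; have [T [Ts T4]] := posdef_fourth_root pV.
rewrite /sym_sqrt; case: xgetP => [S _ //|/(_ (T *m T))] h; exfalso; apply: h.
split; last exact: T4.
split; first by rewrite trmx_mul Ts.
move=> v; rewrite /quadform mulmxA -{1}Ts -trmx_mul -mulmxA mulmx_trl.
by apply: sumr_ge0 => i _; exact: sqr_ge0.
Qed.

Lemma sym_sqrt_unit {K} (V : 'M[R]_K) : posdef V -> sym_sqrt V \in unitmx.
Proof.
move=> pV; have := posdef_unitmx pV; rewrite -{1}(sym_sqrtP pV).2 unitmx_mul.
by case/andP.
Qed.

Lemma inv_sqrt_sandwich {K} (V : 'M[R]_K) : posdef V ->
  inv_sqrt V *m V *m (inv_sqrt V)^T = 1%:M.
Proof.
move=> pV; have [[Ss _] S2] := sym_sqrtP pV; have Su := sym_sqrt_unit pV.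
by rewrite /inv_sqrt trmx_inv Ss -{2}S2 mulmxA mulVmx// mul1mx mulmxV.
Qed.

(** A crude bound from [|v_i v_j| <= |v|^2]; it serves for the inverse in the coercivity estimate
    and for small perturbations of a matrix. *)
Lemma quadform_le {K} (B : 'M[R]_K) v :
  quadform B v <= (\sum_i \sum_j `|B i j|) * \sum_i v i 0 ^+ 2.
Proof.
rewrite quadformE mulr_suml; apply: ler_sum => i _.
rewrite mulr_suml; apply: ler_sum => j _.
have h k : v k 0 ^+ 2 <= \sum_i v i 0 ^+ 2.
  rewrite (bigD1 k)//= lerDl; apply: sumr_ge0 => ? _; exact: sqr_ge0.
have hij : `|v i 0 * v j 0| <= \sum_i v i 0 ^+ 2.
  have := h i; have := h j; set s := \sum__ _ => hj hi.
  rewrite ler_norml; apply/andP; split; nra.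
rewrite mulrAC; apply: le_trans (ler_norm _) _.
by rewrite normrM mulrC ler_wpM2l.
Qed.

Lemma quadformB_scale {K} (A : 'M[R]_K) (v w : 'cV[R]_K) (t : R) : A^T = A ->
  quadform A (v - t *: w) =
  quadform A v - 2 * t * (v^T *m A *m w) 0 0 + t ^+ 2 * quadform A w.
Proof.
move=> As; rewrite /quadform.
have -> : (v - t *: w)^T = v^T - t *: w^T by apply/matrixP => i j; rewrite !mxE.
rewrite !mulmxBl !mulmxBr -!scalemxAl -!scalemxAr.
have -> : w^T *m A *m v = (v^T *m A *m w)^T.
  by rewrite !trmx_mul trmxK As mulmxA.
by rewrite !mxE; ring.
Qed.

(* Nonnegativity of the form at [v - t A^-1 v], for a suitable constant [t]. *)
Lemma posdef_coercive {K} (A : 'M[R]_K) : posdef A ->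
  exists2 l : R, 0 < l & forall v : 'cV[R]_K, l * (\sum_i v i 0 ^+ 2) <= quadform A v.
Proof.
move=> pA; have Au := posdef_unitmx pA; have As := pA.1.
(* [C] bounds the form of [A^-1]; the added 1 keeps it positive when [K = 0]. With [t = 1/C] the
   terms [- 2 t |v|^2 + t^2 C |v|^2] add up to [- |v|^2 / C]. *)
pose C := 1 + \sum_i \sum_j `|invmx A i j|.
have C0 : 0 < C.
  by rewrite ltr_wpDr//; do 2 apply: sumr_ge0 => ? _.
exists C^-1; first by rewrite invr_gt0.
move=> v; pose w := invmx A *m v.
have A0 u : 0 <= quadform A u.
  have [->|u0] := eqVneq u 0; last by rewrite ltW// pA.2.
  by rewrite /quadform mulmx0 mxE.
have Aw : (v^T *m A *m w) 0 0 = \sum_i v i 0 ^+ 2.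
  by rewrite -mulmx_trl /w mulmxA mulmxK.
have ww : quadform A w <= C * \sum_i v i 0 ^+ 2.
  have -> : quadform A w = quadform (invmx A) v.
    by rewrite /quadform /w trmx_mul trmx_inv As !mulmxA mulmxKV.
  apply: le_trans (quadform_le _ _) _; rewrite ler_wpM2r ?lerDr//.
  by apply: sumr_ge0 => ? _; exact: sqr_ge0.
have := A0 (v - C^-1 *: w); rewrite quadformB_scale// Aw.
move: ww; set a := quadform A v; set b := \sum_i _; set c := quadform A w => ww h.
have : C^-1 ^+ 2 * c <= C^-1 * b.
  have -> : C^-1 * b = C^-1 ^+ 2 * (C * b) by field; rewrite gt_eqF.
  by rewrite ler_wpM2l// exprn_ge0// invr_ge0 ltW.
by lra.
Qed.

(** If [u] is column [j] of the inverse, its form is [u_j], so [l |u|^2 <= u_j]. This bounds first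
    [u_j] and then every [|u_i|] by [1/l]. *)
Lemma coercive_invmx {K} (A : 'M[R]_K) (l : R) : 0 < l ->
  (forall v : 'cV[R]_K, l * (\sum_i v i 0 ^+ 2) <= quadform A v) -> A \in unitmx ->
  forall i j, `|invmx A i j| <= l^-1.
Proof.
move=> l0 hA Au i j; pose u := col j (invmx A).
have := hA u; have -> : quadform A u = u j 0.
  rewrite /quadform -mulmxA {2}/u colE mulKVmx// -colE mxE -[in RHS](trmxK u).
  by rewrite [in RHS]mxE.
move=> h; have hk k : l * u k 0 ^+ 2 <= u j 0.
  apply: le_trans h; rewrite ler_pM2l// (bigD1 k)//= lerDl.
  by apply: sumr_ge0 => ? _; exact: sqr_ge0.
have uj : u j 0 <= l^-1.
  have := hk j; rewrite -[X in _ <= X]mulr1 => hj; rewrite leNgt; apply/negP => lu.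
  have u0 : 0 < u j 0 by apply: lt_trans lu; rewrite invr_gt0.
  have : 1 < l * u j 0 by rewrite mulrC -ltr_pdivrMr ?invr_gt0// mul1r; move: lu.
  by nra.
have -> : invmx A i j = u i 0 by rewrite mxE.
have : u i 0 ^+ 2 <= l^-1 ^+ 2.
  have := hk i; rewrite mulrC -ler_pdivlMr// => /le_trans; apply.
  by rewrite expr2 ler_wpM2r// invr_ge0 ltW.
have l'0 : 0 <= l^-1 by rewrite invr_ge0 ltW.
move=> h2; rewrite ler_norml; apply/andP; split; nra.
Qed.

(* Coercivity of [Om] at the columns of [M^T]. *)
Lemma whitening_bound {K} (M Om : 'M[R]_K) (l : R) : 0 < l ->
  (forall v : 'cV[R]_K, l * (\sum_i v i 0 ^+ 2) <= quadform Om v) ->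
  M *m Om *m M^T = 1%:M -> forall i j, M i j ^+ 2 <= l^-1.
Proof.
move=> l0 hO hM i j; have := hO (row i M)^T.
have -> : quadform Om (row i M)^T = 1.
  rewrite /quadform trmxK -row_mul tr_row.
  have -> : row i (M *m Om) *m col i M^T = row i (M *m Om *m M^T) *m delta_mx i 0.
    by rewrite [in RHS]row_mul -mulmxA -colE.
  by rewrite hM -colE !mxE eqxx.
rewrite -ler_pdivlMl// mulr1; apply: le_trans.
rewrite (bigD1 j)//= !mxE lerDl; apply: sumr_ge0 => ? _; exact: sqr_ge0.
Qed.

End posdef_matrices.

(** * Rotation invariance of the Gaussian law *)

Section std_normal_measure.
Context (R : realType).

(** The set function [normal_prob] is repackaged as a probability on [R] with its own display, so
    that it can stand beside the conditional laws in the averaging operators. *)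
Definition std_normal : set R -> \bar R := normal_prob (0 : R) 1.

Let std_normal0 : std_normal set0 = 0%E.
Proof. exact: (measure0 (normal_prob (0 : R) 1)). Qed.

Let std_normal_ge0 A : (0 <= std_normal A)%E.
Proof. exact: (measure_ge0 (normal_prob (0 : R) 1)). Qed.

Let std_normal_sigma_additive : semi_sigma_additive std_normal.
Proof. exact: (@measure_semi_sigma_additive _ _ _ (normal_prob (0 : R) 1)). Qed.

HB.instance Definition _ := isMeasure.Build _ _ _ std_normal
  std_normal0 std_normal_ge0 std_normal_sigma_additive.

Let std_normal_setT : std_normal setT = 1%E.
Proof. exact: (@probability_setT _ _ _ (normal_prob (0 : R) 1)). Qed.

HB.instance Definition _ :=
  @Measure_isProbability.Build _ _ _ std_normal std_normal_setT.

End std_normal_measure.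
Arguments std_normal R : clear implicits.

(* [lebesgue_measure] lives on [measurableTypeR R], whose display differs from
   that of [R]; [lebR] is the same set function on [R] itself. *)
Section lebesgue_measure_on_R.
Context (R : realType).

Definition lebR : set R -> \bar R := @lebesgue_measure R.

Let lebR0 : lebR set0 = 0%E.
Proof. exact: (measure0 (@lebesgue_measure R)). Qed.

Let lebR_ge0 A : (0 <= lebR A)%E.
Proof. exact: (measure_ge0 (@lebesgue_measure R)). Qed.

Let lebR_sigma_additive : semi_sigma_additive lebR.
Proof. exact: (@measure_semi_sigma_additive _ _ _ (@lebesgue_measure R)). Qed.

HB.instance Definition _ := isMeasure.Build _ _ _ lebR
  lebR0 lebR_ge0 lebR_sigma_additive.

Let lebR_sigma_finite : sigma_finite setT lebR.
Proof. exact: (sigma_finiteT (@lebesgue_measure R)). Qed.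

HB.instance Definition _ :=
  @Measure_isSigmaFinite.Build _ _ _ lebR lebR_sigma_finite.

End lebesgue_measure_on_R.
Arguments lebR R : clear implicits.

Definition image_measure d1 d2 (T1 : measurableType d1) (T2 : measurableType d2)
    (R : realType) (m : {measure set T1 -> \bar R}) (f : T1 -> T2)
    (mf : measurable_fun setT f) : {measure set T2 -> \bar R} :=
  measure_function_pushforward__canonical__measure_function_Measure m mf.

Section gaussian_integrals.
Context {R : realType}.
Local Notation mu := (lebR R).
Local Notation pdf := (normal_pdf (0 : R) 1).
Local Open Scope ereal_scope.

Let measurable_id_lebR : @measurable_fun _ _ (measurableTypeR R) R setT idfun.
Proof. by move=> _ A mA; rewrite setTI preimage_id. Qed.

Lemma integral_lebR (f : R -> \bar R) : measurable_fun setT f ->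
  (forall x, 0 <= f x) -> \int[mu]_x f x = \int[lebesgue_measure]_x f x.
Proof.
move=> mf f0.
transitivity (\int[image_measure (@lebesgue_measure R) measurable_id_lebR]_x f x).
  exact: eq_measure_integral.
by rewrite (ge0_integral_pushforward measurable_id_lebR)// preimage_setT.
Qed.

(** The scaled pushforward gives each half-open interval its length, and Lebesgue measure is the
    only measure that does. For [c < 0] the preimage is half-open at the other end, which leaves its
    length unchanged. *)
Lemma lebR_affine (c e : R) (A : set R) : c != 0%R -> measurable A ->
  mu A = `|c|%:E * mu ((fun x => (c * x + e)%R) @^-1` A).
Proof.
move=> c0 mA; pose phi (x : measurableTypeR R) : measurableTypeR R := (c * x + e)%R.
have mphi : measurable_fun setT phi.
  by apply: measurable_funD => //; exact: measurable_funM.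
have c0' : (0 <= `|c|)%R by [].
pose nu : {measure set (measurableTypeR R) -> \bar R} :=
  mscale (NngNum c0') (image_measure (@lebesgue_measure R) mphi).
transitivity (nu A); last by [].
apply: (lebesgue_measure_unique (mu := nu)) => // X [[a b] _ <-].
rewrite /nu /= /mscale /= /pushforward /= {nu}.
have [cp|cn|/eqP] := ltgtP c 0%R; last by rewrite (negbTE c0).
  have -> : phi @^-1` `]a, b]%classic = `[((b - e) / c)%R, ((a - e) / c)%R[%classic.
    apply/seteqP; split => x /=; rewrite !in_itv /= /phi.
      by rewrite ler_ndivrMr// ltr_ndivlMr// mulrC => /andP[]; lra.
    by rewrite ler_ndivrMr// ltr_ndivlMr// mulrC => /andP[]; lra.
  rewrite !lebesgue_measure_itv/= !lte_fin ltr_ndivrMr// divfK// ltrD2r.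
  case: ifPn => _; last by rewrite mule0.
  by rewrite -!EFinB -EFinM ltr0_norm//; congr (_%:E); field.
have -> : phi @^-1` `]a, b]%classic = `](((a - e) / c)%R), ((b - e) / c)%R]%classic.
  apply/seteqP; split => x /=; rewrite !in_itv /= /phi.
    by rewrite ler_pdivlMr// ltr_pdivrMr// mulrC => /andP[]; lra.
  by rewrite ler_pdivlMr// ltr_pdivrMr// mulrC => /andP[]; lra.
rewrite !lebesgue_measure_itv/= !lte_fin ltr_pdivrMr// divfK// ltrD2r.
case: ifPn => _; last by rewrite mule0.
by rewrite -!EFinB -EFinM gtr0_norm//; congr (_%:E); field.
Qed.

Lemma integral_affine (c e : R) (f : R -> \bar R) : c != 0%R ->
  measurable_fun setT f -> (forall x, 0 <= f x) ->
  \int[mu]_x f x = `|c|%:E * \int[mu]_x f (c * x + e)%R.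
Proof.
move=> c0 mf f0; pose phi (x : R) : R := (c * x + e)%R.
have mphi : measurable_fun setT phi.
  by apply: measurable_funD => //; exact: measurable_funM.
have c0' : (0 <= `|c|)%R by [].
pose nu : {measure set R -> \bar R} :=
  mscale (NngNum c0') (image_measure mu mphi).
rewrite (@eq_measure_integral _ _ _ _ nu); last first.
  by move=> A mA _; exact: lebR_affine.
by rewrite ge0_integral_mscale// (ge0_integral_pushforward mphi).
Qed.

(** The Radon-Nikodym derivative of the normal law agrees almost everywhere with [normal_pdf],
    because both have the same integral over every measurable set. *)
Lemma integral_std_normal (f : R -> \bar R) : measurable_fun setT f ->
  (forall x, 0 <= f x) ->
  \int[std_normal R]_x f x = \int[mu]_x (f x * (pdf x)%:E).
Proof.
move=> mf f0; have dom := normal_prob_dominates (0 : R) 1.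
transitivity (\int[normal_prob (0 : R) 1]_x f x).
  transitivity (\int[image_measure (normal_prob (0 : R) 1) measurable_id_lebR]_x f x).
    exact: eq_measure_integral.
  by rewrite (ge0_integral_pushforward measurable_id_lebR)// preimage_setT.
rewrite integral_lebR; last 2 first.
- by apply: emeasurable_funM => //; apply/measurable_EFinP; exact: measurable_normal_pdf.
- by move=> x; rewrite mule_ge0// lee_fin normal_pdf_ge0.
rewrite -(Radon_Nikodym_SigmaFinite.change_of_variables dom)//.
apply: ae_eq_integral => //.
- apply: emeasurable_funM => //.
  exact: measurable_int (Radon_Nikodym_SigmaFinite.f_integrable dom).
- by apply: emeasurable_funM => //; apply/measurable_EFinP; exact: measurable_normal_pdf.
- apply: ae_eqe_mul2l; apply: integral_ae_eq => //=.
  + exact: (Radon_Nikodym_SigmaFinite.f_integrable dom).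
  + by apply/measurable_EFinP; exact: measurable_normal_pdf.
  + by move=> E _ mE; rewrite -(Radon_Nikodym_SigmaFinite.f_integral dom).
Qed.

Lemma normal_pdf01E (x : R) : pdf x = (normal_peak 1 * expR (- x ^+ 2 / 2))%R.
Proof. by rewrite normal_pdfE ?oner_neq0// /normal_fun subr0 expr1n. Qed.

Let mlin (a b : R) : measurable_fun setT (fun z : R * R => (a * z.1 + b * z.2)%R).
Proof. by apply: measurable_funD; apply: measurable_funM. Qed.

Let mlinB (a b : R) : measurable_fun setT (fun z : R * R => (a * z.1 - b * z.2)%R).
Proof. by under eq_fun do rewrite /= -mulNr; exact: mlin. Qed.

Let mrot (c s : R) : measurable_fun setT
  (fun z : R * R => ((c * z.1 - s * z.2)%R, (s * z.1 + c * z.2)%R)).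
Proof. by apply/measurable_fun_pairP; split; [exact: mlinB|exact: mlin]. Qed.

(* The substitutions [w = s x + c y] in [y], then [v = (x - s w) / c] in [x],
   are one-dimensional. *)
Lemma lebR_rotation (c s : R) (H : R -> R -> \bar R) : c != 0%R ->
  (c ^+ 2 + s ^+ 2)%R = 1%R -> measurable_fun setT (fun z => H z.1 z.2) ->
  (forall x y, 0 <= H x y) ->
  \int[mu]_x \int[mu]_y H (c * x - s * y)%R (s * x + c * y)%R =
  \int[mu]_x \int[mu]_y H x y.
Proof.
move=> c0 cs1 mH H0.
have c0' : (c^-1 != 0)%R by rewrite invr_eq0.
pose Hs (z : R * R) := H (c^-1 * z.1 - s / c * z.2)%R z.2.
have Hs0 z : 0 <= Hs z by exact: H0.
have mHs : measurable_fun setT Hs.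
  have mshear : measurable_fun setT
      (fun z : R * R => ((c^-1 * z.1 - s / c * z.2)%R, z.2)).
    by apply/measurable_fun_pairP; split; [exact: mlinB|exact: measurable_snd].
  exact: (measurableT_comp mH mshear).
have step1 x : \int[mu]_y H (c * x - s * y)%R (s * x + c * y)%R =
    `|c^-1|%:E * \int[mu]_w Hs (x, w).
  rewrite (@integral_affine c^-1 (- (s / c * x))%R)//.
    have e1 w : (c * x - s * (c^-1 * w + - (s / c * x)) = c^-1 * x - s / c * w)%R.
      have -> : (c^-1 * x = (c ^+ 2 + s ^+ 2) / c * x)%R by rewrite cs1 mul1r.
      by field.
    have e2 w : (s * x + c * (c^-1 * w + - (s / c * x)) = w)%R by field.
    by under eq_integral do rewrite e1 e2.
  exact: (measurable_fun_pair2 x (measurableT_comp mH (mrot c s))).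
under eq_integral do rewrite step1.
rewrite ge0_integralZl//; last 2 first.
- exact: (measurable_fun_fubini_tonelli_F Hs mHs Hs0).
- by move=> x _; apply: integral_ge0.
rewrite (fubini_tonelli Hs mHs Hs0).
rewrite -ge0_integralZl//; last 2 first.
- exact: (measurable_fun_fubini_tonelli_G Hs mHs Hs0).
- by move=> x _; apply: integral_ge0.
rewrite [RHS](fubini_tonelli (fun z => H z.1 z.2) mH (fun z => H0 _ _)).
apply: eq_integral => w _.
rewrite [RHS](@integral_affine c^-1 (- (s / c * w))%R)//.
exact: (measurable_fun_pair1 w mH).
Qed.

(** The rotation preserves planar Lebesgue measure and [x^2 + y^2], hence the product of two
    standard normal densities. *)
Lemma std_normal_rotation (c s : R) (G : R -> R -> \bar R) : c != 0%R ->
  (c ^+ 2 + s ^+ 2)%R = 1%R -> measurable_fun setT (fun z => G z.1 z.2) ->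
  (forall x y, 0 <= G x y) ->
  \int[std_normal R]_x \int[std_normal R]_y G (c * x - s * y)%R (s * x + c * y)%R =
  \int[std_normal R]_x \int[std_normal R]_y G x y.
Proof.
move=> c0 cs1 mG G0.
have mp : measurable_fun setT (EFin \o pdf).
  by apply/measurable_EFinP; exact: measurable_normal_pdf.
have p0 x : 0 <= (pdf x)%:E by rewrite lee_fin normal_pdf_ge0.
have toH (F : R -> R -> \bar R) : measurable_fun setT (fun z => F z.1 z.2) ->
    (forall x y, 0 <= F x y) ->
    \int[std_normal R]_x \int[std_normal R]_y F x y =
    \int[mu]_x \int[mu]_y (F x y * (pdf x)%:E * (pdf y)%:E).
  move=> mF F0; rewrite integral_std_normal; last 2 first.
  - exact: (measurable_fun_fubini_tonelli_F (fun z => F z.1 z.2)).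
  - by move=> x; apply: integral_ge0.
  apply: eq_integral => x _; rewrite integral_std_normal//; last first.
    exact: (measurable_fun_pair2 x mF).
  transitivity (\int[mu]_y (F x y * (pdf y)%:E * (pdf x)%:E)); last first.
    by apply: eq_integral => y _; rewrite muleAC.
  rewrite ge0_integralZr//.
  - apply: emeasurable_funM => //.
    exact: (measurable_fun_pair2 x mF).
  - by move=> y _; rewrite mule_ge0.
pose Grot x y := G (c * x - s * y)%R (s * x + c * y)%R.
have mGrot : measurable_fun setT (fun z => Grot z.1 z.2).
  exact: (measurableT_comp mG (mrot c s)).
apply: etrans (esym (toH G mG G0)).
apply: etrans (toH Grot mGrot (fun x y => G0 _ _)) _.
pose H x y := G x y * (pdf x)%:E * (pdf y)%:E.
have H0 x y : 0 <= H x y by rewrite /H !mule_ge0.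
have mH : measurable_fun setT (fun z => H z.1 z.2).
  by apply: emeasurable_funM; [apply: emeasurable_funM => //|];
    apply: (measurableT_comp mp).
apply: etrans (lebR_rotation c0 cs1 mH H0).
apply: eq_integral => x _; apply: eq_integral => y _.
rewrite /H -!muleA; congr (_ * _).
rewrite -!EFinM !normal_pdf01E; congr (_%:E).
transitivity (normal_peak 1 ^+ 2 * expR (- x ^+ 2 / 2 + - y ^+ 2 / 2))%R.
  by rewrite expRD; ring.
have -> : (- x ^+ 2 / 2 + - y ^+ 2 / 2)%R =
    (- (c * x - s * y) ^+ 2 / 2 + - (s * x + c * y) ^+ 2 / 2)%R.
  transitivity ((- x ^+ 2 / 2 + - y ^+ 2 / 2) * (c ^+ 2 + s ^+ 2))%R.
    by rewrite cs1 mulr1.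
  by field.
by rewrite expRD; ring.
Qed.

(** The exponential factor turns the standard normal density into [s] times the density of variance
    [s^2], whose mass is 1. Both the integrability of moments and the value of the variance are
    drawn from this formula. *)
Lemma std_normal_exp_sqr (s : R) : (0 < s)%R ->
  \int[std_normal R]_z (expR ((1 - s ^- 2) / 2 * z ^+ 2))%:E = s%:E.
Proof.
move=> s0; have s0' : s != 0%R by rewrite gt_eqF.
rewrite integral_std_normal; last 2 first.
- apply/measurable_EFinP; apply: measurableT_comp => //.
  by apply: measurable_funM => //; exact: measurable_funX.
- by move=> z; rewrite lee_fin expR_ge0.
transitivity (\int[mu]_z (s%:E * (normal_pdf 0 s z)%:E)).
  apply: eq_integral => z _; rewrite -!EFinM; congr (_%:E).
  have -> : normal_pdf 0 s z = (s^-1 * normal_peak 1 * expR (- z ^+ 2 / (s ^+ 2 *+ 2)))%R.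
    rewrite normal_pdfE// /normal_fun subr0; congr (_ * _)%R.
    rewrite /normal_peak expr1n mul1r -mulrnAr sqrtrM ?sqr_ge0// sqrtr_sqr.
    by rewrite gtr0_norm// invfM.
  rewrite normal_pdf01E mulrCA -expRD !mulrA divff// mul1r; congr (_ * expR _)%R.
  by rewrite -mulr_natr; field.
rewrite ge0_integralZl//; last 3 first.
- by apply/measurable_EFinP; exact: measurable_normal_pdf.
- by move=> z _; rewrite lee_fin normal_pdf_ge0.
- by rewrite lee_fin ltW.
rewrite integral_lebR; last 2 first.
- by apply/measurable_EFinP; exact: measurable_normal_pdf.
- by move=> z; rewrite lee_fin normal_pdf_ge0.
by rewrite integral_normal_pdf mule1.
Qed.

Lemma std_normal_integrable4 :
  (std_normal R).-integrable setT (fun z => (z ^+ 4)%:E).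
Proof.
have m4 : measurable_fun setT (fun z : R => (z ^+ 4)%:E).
  by apply/measurable_EFinP; exact: measurable_funX.
(* [s = sqrt 2] gives [exp (z^2 / 4)], the square of [exp (z^2 / 8) >= 1 + z^2 / 8]; hence the
   factor 64. *)
apply: (@le_integrable _ _ _ _ _ measurableT _
  (fun z : R => (64 * expR ((1 - (Num.sqrt 2) ^- 2) / 2 * z ^+ 2))%:E)) => //.
  move=> z _; rewrite lee_fin; rewrite ger0_norm; last exact: exprn_even_ge0.
  rewrite ger0_norm ?mulr_ge0 ?expR_ge0// sqr_sqrtr//.
  have -> : ((1 - 2^-1) / 2 * z ^+ 2 = z ^+ 2 / 8 + z ^+ 2 / 8 :> R)%R by field.
  rewrite expRD; have := expR_ge1Dx (z ^+ 2 / 8).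
  have : (0 <= z ^+ 2)%R by exact: sqr_ge0.
  rewrite (_ : z ^+ 4 = (z ^+ 2) * (z ^+ 2))%R; last by rewrite -exprD.
  move: (z ^+ 2)%R (expR _) => a e a0 ae.
  have : ((1 + a / 8) * (1 + a / 8) <= e * e)%R by nra.
  by nra.
apply/integrableP; split.
  apply/measurable_EFinP; apply: measurable_funM => //; apply: measurableT_comp => //.
  by apply: measurable_funM => //; exact: measurable_funX.
under eq_integral => z _ do rewrite gee0_abs ?lee_fin ?mulr_ge0 ?expR_ge0// EFinM.
rewrite ge0_integralZl//; last first.
  apply/measurable_EFinP; apply: measurableT_comp => //.
  by apply: measurable_funM => //; exact: measurable_funX.
by rewrite std_normal_exp_sqr ?sqrtr_gt0// -EFinM ltry.
Qed.

End gaussian_integrals.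

Section std_normal_moments.
Context {R : realType}.
Local Notation N := (std_normal R).

Lemma std_normal_sym (F : R -> \bar R) : measurable_fun setT F ->
  (forall z, 0 <= F z)%E -> (\int[N]_z F (- z)%R = \int[N]_z F z)%E.
Proof.
move=> mF F0; have mp : measurable_fun setT (EFin \o (normal_pdf (0 : R) 1)).
  by apply/measurable_EFinP; exact: measurable_normal_pdf.
have p0 x : (0 <= (normal_pdf (0 : R) 1 x)%:E)%E by rewrite lee_fin normal_pdf_ge0.
rewrite !integral_std_normal//; last exact: measurableT_comp.
rewrite [RHS](@integral_affine _ (-1) 0)//.
- rewrite normrN1 mul1e; apply: eq_integral => z _.
  by rewrite mulN1r addr0 !normal_pdf01E sqrrN.
- exact: emeasurable_funM.
- by move=> x; rewrite mule_ge0.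
Qed.

Lemma std_normal_rint4 : rint N (fun z => z ^+ 4).
Proof. exact: std_normal_integrable4. Qed.

Lemma std_normal_rint2 : rint N (fun z => z ^+ 2).
Proof.
apply: (@rint_dominated _ _ _ N _ (fun z : R => 1 + z ^+ 4)).
- exact: measurable_funX.
- exact: rintD (rint_cst _ _) std_normal_rint4.
- move=> z; rewrite ger0_norm ?sqr_ge0// (_ : z ^+ 4 = z ^+ 2 * z ^+ 2).
    by move: (z ^+ 2) (sqr_ge0 z) => a; nra.
  by rewrite -exprD.
Qed.

Lemma std_normal_rint1 : rint N id.
Proof.
apply: (@rint_dominated _ _ _ N _ (fun z : R => 1 + z ^+ 2)).
- exact: measurable_id.
- exact: rintD (rint_cst _ _) std_normal_rint2.
- by move=> z; rewrite ler_norml; apply/andP; split; nra.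
Qed.

(** Symmetry is stated for nonnegative functions, so it is applied to [|z| + z]. *)
Lemma std_normal_mean : \int[N]_z z = 0.
Proof.
have mF : measurable_fun setT (fun z : R => (`|z| + z)%:E).
  by apply/measurable_EFinP; apply: measurable_funD => //; exact: normr_measurable.
have F0 (z : R) : (0 <= (`|z| + z)%:E)%E.
  by rewrite lee_fin; case: (ger0P z) => z0; lra.
have i1 := std_normal_rint1; have iN := rint_norm i1.
have := std_normal_sym mF F0.
have -> : (\int[N]_z (`|z| + z)%:E = (\int[N]_z `|z| + \int[N]_z z)%:E)%E.
  by rewrite -ExpD// ExpE//; exact: rintD.
have -> : (\int[N]_z (`|- z| + - z)%:E = (\int[N]_z `|z| - \int[N]_z z)%:E)%E.
  rewrite -ExpB// ExpE; last exact: rintB.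
  by apply: eq_integral => z _; rewrite normrN.
by move=> [] ; lra.
Qed.

(* Tangent-line comparison: [1 + a z^2 <= exp (a z^2)] holds with exact
   integrals on both sides for a = (1 - s^-2)/2, and s^2 is then chosen equal
   to the second moment. *)
Lemma std_normal_var : \int[N]_z (z ^+ 2) = 1.
Proof.
have i2 := std_normal_rint2; set v := \int[N]_z _.
have v0 : 0 <= v by apply: Exp_ge0 => z; exact: sqr_ge0.
have key s : 0 < s -> 2 * s ^+ 2 + (s ^+ 2 - 1) * v <= 2 * s ^+ 3.
  move=> s0; pose a := (1 - s ^- 2) / 2.
  suff h : 1 + a * v <= s.
    have s20 : 0 < 2 * s ^+ 2 by rewrite mulr_gt0// exprn_gt0.
    rewrite -(ler_pM2l s20) in h; apply: le_trans (le_trans _ h) _; last first.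
      by rewrite -mulrA -exprSr.
    by rewrite /a le_eqVlt; apply/orP; left; apply/eqP; field; rewrite gt_eqF.
  rewrite -lee_fin -(std_normal_exp_sqr s0) -/a.
  have -> : (1 + a * v)%:E = (\int[N]_z (1 + a * z ^+ 2)%:E)%E.
    rewrite -ExpE; last exact: rintD (rint_cst _ _) (rintZ _ i2).
    by rewrite ExpD ?Exp_cst ?ExpZ//; [exact: rint_cst|exact: rintZ].
  apply: le_integral => //.
  - exact: rintD (rint_cst _ _) (rintZ _ i2).
  - apply: rint_ge0.
    + by apply: measurableT_comp => //; apply: measurable_funM => //; exact: measurable_funX.
    + by move=> z; exact: expR_ge0.
    + by rewrite std_normal_exp_sqr// ltry.
  - by move=> z _; rewrite lee_fin expR_ge1Dx.
have [v_0|v0'] := eqVneq v 0.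
  by exfalso; have := key (1 / 2) ltac:(lra); rewrite v_0; lra.
have vp : 0 < v by rewrite lt_def v0' v0.
(* At [s^2 = v] the inequality [key] becomes [s^2 (s - 1)^2 <= 0]. *)
have s0 : 0 < Num.sqrt v by rewrite sqrtr_gt0.
have ks := key _ s0; have vE := sqr_sqrtr v0; move: ks vE s0; move: (Num.sqrt v) => s h vE s0.
rewrite -vE in h *.
suff -> : s = 1 by rewrite expr1n.
have : (s - 1) ^+ 2 <= 0.
  have s20 : 0 < s ^+ 2 by rewrite exprn_gt0.
  have h' : s ^+ 2 * (s - 1) ^+ 2 <= 0 by move: h; rewrite !exprS expr0; nra.
  by rewrite -(pmulr_rle0 _ s20).
move=> h'; have : (s - 1) ^+ 2 == 0 by rewrite eq_le h' sqr_ge0.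
by rewrite sqrf_eq0 subr_eq0 => /eqP.
Qed.

End std_normal_moments.

(** * Averaging operators *)

Section averaging_operators.
Context {R : realType} {K : nat}.
Implicit Types (a : 'cV[R]_K) (F : K.-tuple R -> R).

Definition translate (x : K.-tuple R) a (u : R) : K.-tuple R :=
  [tuple tnth x j + u * a j 0 | j < K].

(** The class of test functions: with values in [0, 1] they are integrable for every probability,
    Fubini applies, and averaging stays within the class. *)
Definition unit_fun d (T : measurableType d) (F : T -> R) :=
  measurable_fun setT F /\ forall x, 0 <= F x <= 1.

Lemma unit_fun_rint d (T : measurableType d) (m : probability T R) (F : T -> R) :
  unit_fun F -> rint m F.
Proof.
move=> [mF F01]; apply: (@rint_bounded _ _ _ _ _ 1) => // x.
by rewrite ger0_norm; case/andP: (F01 x).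
Qed.

Lemma unit_fun_comp d d' (T : measurableType d) (U : measurableType d')
    (F : T -> R) (g : U -> T) : measurable_fun setT g -> unit_fun F ->
  unit_fun (F \o g).
Proof. by move=> mg [mF F01]; split => [|x]; [exact: measurableT_comp|exact: F01]. Qed.

Lemma unit_fun_avg d d' (T : measurableType d) (U : measurableType d')
    (m : probability U R) (F : T * U -> R) :
  unit_fun F -> unit_fun (fun x => \int[m]_u F (x, u)).
Proof.
move=> uF; have [mF F01] := uF.
have i1 x : rint m (fun u => F (x, u)).
  by apply: unit_fun_rint; exact: (unit_fun_comp (pair1_measurable x) uF).
split => [|x].
  apply/measurable_EFinP; rewrite [X in measurable_fun _ X](_ : _ =
    fubini_F m (EFin \o F)); last by apply/funext => x; rewrite /= ExpE.
  apply: measurable_fun_fubini_tonelli_F; first exact/measurable_EFinP.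
  by move=> x; rewrite lee_fin; case/andP: (F01 x).
apply/andP; split; first by apply: Exp_ge0 => u; case/andP: (F01 (x, u)).
rewrite -[leRHS](Exp_cst m); apply: Exp_le => //; first exact: rint_cst.
by move=> u; case/andP: (F01 (x, u)).
Qed.

Lemma unit_fun_Fubini d d' (T : measurableType d) (U : measurableType d')
    (m : probability T R) (m' : probability U R) (F : T * U -> R) : unit_fun F ->
  \int[m]_x \int[m']_u F (x, u) = \int[m']_u \int[m]_x F (x, u).
Proof.
move=> uF; have uFs := unit_fun_comp (@measurable_swap _ _ _ _) uF.
apply: EFin_inj; have i1 x : rint m' (fun u => F (x, u)).
  by apply: unit_fun_rint; exact: (unit_fun_comp (pair1_measurable x) uF).
have i2 u : rint m (fun x => F (x, u)).
  by apply: unit_fun_rint; exact: (unit_fun_comp (pair2_measurable u) uF).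
rewrite ExpE; last by apply: unit_fun_rint; exact: unit_fun_avg.
rewrite ExpE; last by apply: unit_fun_rint; exact: (unit_fun_avg m uFs).
under eq_integral do rewrite ExpE//.
under [RHS]eq_integral do rewrite ExpE//.
apply: (fubini_tonelli (EFin \o F)); first by apply/measurable_EFinP; exact: uF.1.
by move=> x; rewrite lee_fin; case/andP: (uF.2 x).
Qed.

Lemma measurable_translate a (b : R) :
  measurable_fun setT (fun z : K.-tuple R * R => translate z.1 a (z.2 - b)).
Proof.
apply/measurable_fun_tnthP => j.
rewrite [X in measurable_fun _ X](_ : _ =
  (fun z => tnth z.1 j + (z.2 - b) * a j 0)); last first.
  by apply/funext => z /=; rewrite tnth_mktuple.
apply: measurable_funD; last by apply: measurable_funM => //; exact: measurable_funB.
exact: (measurableT_comp (measurable_tnth j)).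
Qed.

Lemma measurable_translate2 x a b a' b' : measurable_fun setT
  (fun z : R * R => translate (translate x a (z.1 - b)) a' (z.2 - b')).
Proof.
apply/measurable_fun_tnthP => j.
rewrite [X in measurable_fun _ X](_ : _ =
  (fun z => tnth x j + (z.1 - b) * a j 0 + (z.2 - b') * a' j 0)); last first.
  by apply/funext => z /=; rewrite !tnth_mktuple.
by apply: measurable_funD; [apply: measurable_funD => //|];
  apply: measurable_funM => //; exact: measurable_funB.
Qed.

(** Convolution with the law of [(U - b) a], where [U] has law [m]; [b] will be the mean of [U]. *)
Definition avg (m : probability R R) a (b : R) F (x : K.-tuple R) : R :=
  \int[m]_u F (translate x a (u - b)).

Lemma avg_unit m a b F : unit_fun F -> unit_fun (avg m a b F).
Proof.
by move=> uF; apply: (unit_fun_avg m (unit_fun_comp (measurable_translate a b) uF)).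
Qed.

Lemma translateC (x : K.-tuple R) a a' u u' :
  translate (translate x a u) a' u' = translate (translate x a' u') a u.
Proof. by apply: eq_from_tnth => j; rewrite !tnth_mktuple; ring. Qed.

(** Fubini, since translations commute. Commutation lets any one operator act directly on the test
    function, where its effect can be estimated. *)
Lemma avgC m a b m' a' b' F : unit_fun F ->
  avg m a b (avg m' a' b' F) = avg m' a' b' (avg m a b F).
Proof.
move=> uF; apply/funext => x; rewrite /avg.
pose G (z : R * R) := F (translate (translate x a (z.1 - b)) a' (z.2 - b')).
have uG : unit_fun G := unit_fun_comp (measurable_translate2 x a b a' b') uF.
rewrite [LHS](unit_fun_Fubini m m' uG).
by apply: eq_Rintegral => u' _; apply: eq_Rintegral => u _; rewrite /G translateC.
Qed.

Lemma avg_contract m a b F G (e : R) : unit_fun F -> unit_fun G ->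
  (forall x, `|F x - G x| <= e) -> forall x, `|avg m a b F x - avg m a b G x| <= e.
Proof.
move=> uF uG FG x; have i1 H : unit_fun H -> rint m (fun u => H (translate x a (u - b))).
  move=> uH; apply: unit_fun_rint.
  exact: (unit_fun_comp (measurable_fun_pair2 x (measurable_translate a b)) uH).
rewrite -ExpB; [|exact: i1..]; apply: Exp_norm_le_cst => //.
by apply: rintB; exact: i1.
Qed.

Definition avg_iter (s : seq (probability R R * 'cV[R]_K * R)) F :=
  foldr (fun p G => avg p.1.1 p.1.2 p.2 G) F s.

Lemma avg_iter_unit s F : unit_fun F -> unit_fun (avg_iter s F).
Proof. by move=> uF; elim: s => //= p s; exact: avg_unit. Qed.

Lemma avg_iterC p s F : unit_fun F ->
  avg p.1.1 p.1.2 p.2 (avg_iter s F) = avg_iter s (avg p.1.1 p.1.2 p.2 F).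
Proof.
move=> uF; elim: s => //= q s IH.
by rewrite avgC ?IH//; exact: avg_iter_unit.
Qed.

Lemma avg_iter_contract s F G (e : R) : unit_fun F -> unit_fun G ->
  (forall x, `|F x - G x| <= e) ->
  forall x, `|avg_iter s F x - avg_iter s G x| <= e.
Proof.
move=> uF uG FG; elim: s => //= p s IH; apply: avg_contract => //;
  exact: avg_iter_unit.
Qed.

(* Lindeberg's replacement: the operators commute and are contractions, so
   exchanging one factor costs only its discrepancy on [F] itself. *)
Lemma avg_iter_swap (I : Type) (s : seq I) (p q : I -> probability R R * 'cV[R]_K * R)
    (e : I -> R) F : unit_fun F ->
  (forall i x, `|avg (p i).1.1 (p i).1.2 (p i).2 F x -
                 avg (q i).1.1 (q i).1.2 (q i).2 F x| <= e i) ->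
  forall x, `|avg_iter (map p s) F x - avg_iter (map q s) F x| <= \sum_(i <- s) e i.
Proof.
move=> uF H x; elim: s => [|i s IH] /= in x *; first by rewrite subrr normr0 big_nil.
rewrite big_cons.
pose A := avg (p i).1.1 (p i).1.2 (p i).2 (avg_iter [seq q i | i <- s] F) x.
have -> : forall u v : R, u - v = (A - v) + (u - A) by move=> u v; ring.
apply: le_trans (ler_normD _ _) _; apply: lerD.
  rewrite /A !avg_iterC//; apply: avg_iter_contract => //; exact: avg_unit.
by apply: avg_contract => //; exact: avg_iter_unit.
Qed.

End averaging_operators.

(** * Gaussian averages depend only on the Gram matrix of their directions *)

Section gaussian_averages.
Context {R : realType} {K : nat}.
Implicit Types (x : K.-tuple R) (a b : 'cV[R]_K) (F : K.-tuple R -> R).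
Local Notation N := (std_normal R).
Local Notation gavg a := (avg (std_normal R) a 0).

Lemma gavg_opp a F : unit_fun F -> gavg (- a) F = gavg a F.
Proof.
move=> uF; apply/funext => x; rewrite /avg; apply: EFin_inj.
have mF c : measurable_fun setT (fun u : R => F (translate x c (u - 0))).
  exact: (measurableT_comp uF.1 (measurable_fun_pair2 x (measurable_translate c 0))).
have i1 c : rint N (fun u => F (translate x c (u - 0))).
  by apply: unit_fun_rint; split=> // u; exact: uF.2.
rewrite !ExpE// -[RHS]std_normal_sym; last 2 first.
- exact/measurable_EFinP.
- by move=> z; rewrite lee_fin; case/andP: (uF.2 (translate x a (z - 0))).
apply: eq_integral => z _; congr (F _)%:E.
by apply: eq_from_tnth => j; rewrite !tnth_mktuple mxE; ring.
Qed.

Lemma gavg0 F : gavg 0 F = F.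
Proof.
apply/funext => x; rewrite /avg -[RHS](Exp_cst N); apply: eq_Rintegral => u _.
by congr F; apply: eq_from_tnth => j; rewrite !tnth_mktuple mxE mulr0 addr0.
Qed.

(** Substituting the rotated pair in [u a + v b] gives [(c u - s v) a + (s u + c v) b], which
    regroups as [u (c a + s b) + v (c b - s a)]. *)
Lemma gavg_rotation (c s : R) a b F : c != 0 -> c ^+ 2 + s ^+ 2 = 1 -> unit_fun F ->
  gavg a (gavg b F) = gavg (c *: a + s *: b) (gavg (c *: b - s *: a) F).
Proof.
move=> c0 cs1 uF; apply/funext => x; rewrite /avg; apply: EFin_inj.
have uG a' b' : unit_fun (fun z : R * R => F (translate (translate x a' (z.1 - 0)) b' (z.2 - 0))).
  exact: (unit_fun_comp (measurable_translate2 x a' 0 b' 0) uF).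
have E a' b' : (\int[N]_u \int[N]_v F (translate (translate x a' (u - 0)) b' (v - 0)))%:E =
   (\int[N]_u \int[N]_v (F (translate (translate x a' (u - 0)) b' (v - 0)))%:E)%E.
  rewrite ExpE; last exact: unit_fun_rint (unit_fun_avg N (uG a' b')).
  apply: eq_integral => u _; rewrite ExpE//; apply: unit_fun_rint.
  exact: (unit_fun_comp (pair1_measurable u) (uG a' b')).
apply: etrans (E a b) (etrans _ (esym (E _ _))).
pose G (u v : R) := (F (translate (translate x a (u - 0)) b (v - 0)))%:E.
apply: etrans (esym (@std_normal_rotation _ c s G c0 cs1 _ _)) _.
- by apply/measurable_EFinP; exact: (uG a b).1.
- by move=> u v; rewrite lee_fin; case/andP: ((uG a b).2 (u, v)).
- apply: eq_integral => u _; apply: eq_integral => v _; congr (F _)%:E.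
  by apply: eq_from_tnth => j; rewrite !tnth_mktuple !mxE; ring.
Qed.

Definition gavg_iter (bs : seq 'cV[R]_K) F := foldr (fun b G => gavg b G) F bs.

Lemma gavg_iterE bs F :
  gavg_iter bs F = avg_iter [seq (std_normal R : probability R R, b, 0) | b <- bs] F.
Proof. by elim: bs => //= b bs ->. Qed.

Lemma gavg_iter_unit bs F : unit_fun F -> unit_fun (gavg_iter bs F).
Proof. by move=> uF; rewrite gavg_iterE; exact: avg_iter_unit. Qed.

(* One Givens rotation per vector of [bs]. *)
Lemma gavg_iter_eliminate (k : 'I_K) (bs : seq 'cV[R]_K) : exists b0 bs',
  [/\ forall F, unit_fun F -> gavg_iter bs F = gavg b0 (gavg_iter bs' F),
      forall b, b \in bs' -> b k 0 = 0,
      \sum_(b <- bs) b *m b^T = b0 *m b0^T + \sum_(b <- bs') b *m b^T &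
      forall j, (forall b, b \in bs -> b j 0 = 0) ->
        b0 j 0 = 0 /\ forall b, b \in bs' -> b j 0 = 0].
Proof.
elim: bs => [|a bs [b0 [bs' [IHF IHk IHS IHj]]]].
  exists 0, [::]; split => //.
  - by move=> F _; rewrite gavg0.
  - by rewrite mul0mx !big_nil addr0.
  - by move=> j _; rewrite mxE.
have IHj' j : (forall b, b \in a :: bs -> b j 0 = 0) ->
    [/\ a j 0 = 0, b0 j 0 = 0 & forall b, b \in bs' -> b j 0 = 0].
  move=> h; have [h0 h'] := IHj j (fun b bbs => h b (@mem_behead _ (a :: bs) b bbs)).
  by split => //; apply: h; exact: mem_head.
have [ak0|ak0] := eqVneq (a k 0) 0.
  exists b0, (a :: bs'); split.
  - move=> F uF; apply: etrans (congr1 (gavg a) (IHF F uF)) _.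
    exact: avgC (gavg_iter_unit _ uF).
  - by move=> b; rewrite inE => /orP[/eqP->//|]; exact: IHk.
  - by rewrite !big_cons IHS addrCA.
  - move=> j /IHj'[aj b0j bsj]; split => // b; rewrite inE => /orP[/eqP->//|].
    exact: bsj.
(* The Givens angle: [c b0 - s a] vanishes at [k], and [c] is nonzero as [gavg_rotation]
   requires. *)
pose r := Num.sqrt (a k 0 ^+ 2 + b0 k 0 ^+ 2).
have r2 : r ^+ 2 = a k 0 ^+ 2 + b0 k 0 ^+ 2.
  by rewrite sqr_sqrtr// addr_ge0// sqr_ge0.
have r0 : r != 0.
  rewrite -sqrf_eq0 r2 gt_eqF// ltr_wpDr ?sqr_ge0//.
  by rewrite lt_def sqr_ge0 sqrf_eq0 ak0.
pose c := a k 0 / r; pose s := b0 k 0 / r.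
have c0 : c != 0 by rewrite mulf_neq0// invr_eq0.
have cs1 : c ^+ 2 + s ^+ 2 = 1.
  by rewrite /c /s !exprMn -mulrDl -r2 -exprMn divff// expr1n.
exists (c *: a + s *: b0), ((c *: b0 - s *: a) :: bs'); split.
- move=> F uF; apply: etrans (congr1 (gavg a) (IHF F uF)) _.
  exact: gavg_rotation c0 cs1 (gavg_iter_unit _ uF).
- move=> b; rewrite inE => /orP[/eqP->|]; last exact: IHk.
  by rewrite !mxE /c /s; field.
- rewrite !big_cons IHS !addrA; congr (_ + _); apply/matrixP => i j.
  rewrite !mxE !big_ord1 !mxE.
  transitivity ((a i 0 * a j 0 + b0 i 0 * b0 j 0) * (c ^+ 2 + s ^+ 2)).
    by rewrite cs1 mulr1.
  by ring.
- move=> j /IHj'[aj b0j bsj]; split; first by rewrite !mxE aj b0j !mulr0 addr0.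
  move=> b; rewrite inE => /orP[/eqP->|]; last exact: bsj.
  by rewrite !mxE aj b0j !mulr0 subr0.
Qed.

(** Triangularization by rotations: once coordinate [k] is eliminated, only [b0] sees it, and the
    identity Gram matrix forces [b0] to be plus or minus the basis vector of index [k]. The sign is
    absorbed by the symmetry of the Gaussian law. *)
Lemma gavg_iter_gram (bs : seq 'cV[R]_K) F : unit_fun F ->
  \sum_(b <- bs) b *m b^T = 1%:M ->
  gavg_iter bs F = gavg_iter [seq delta_mx j 0 | j <- enum 'I_K] F.
Proof.
move=> uF.
(* Invariant: the coordinates below [k] are already cleared, and the Gram matrix is the identity on
   the others. *)
suff H n k : (n + k = K)%N -> forall bs : seq 'cV[R]_K,
    (forall j : 'I_K, (j < k)%N -> forall b, b \in bs -> b j 0 = 0) ->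
    (forall i j : 'I_K, (\sum_(b <- bs) b *m b^T) i j = ((i == j) && (k <= i)%N)%:R) ->
    gavg_iter bs F =
      gavg_iter [seq delta_mx j 0 | j <- drop k (enum 'I_K)] F.
  move=> h; rewrite (H K 0%N) ?addn0 ?drop0// => i j.
  by rewrite h mxE leq0n andbT.
elim: n k => [|n IH] k.
  rewrite add0n => kK {}bs bs0 _; rewrite drop_oversize ?size_enum_ord ?kK//=.
  elim: bs bs0 => //= b bs IHbs bs0.
  rewrite (_ : b = 0) ?gavg0; last first.
    apply/matrixP => j z; rewrite ord1 mxE; apply: (bs0 j) => //; last exact: mem_head.
    by rewrite kK.
  by apply: IHbs => j jk b' b'bs; apply: (bs0 j) => //; rewrite inE b'bs orbT.
rewrite addSn => nk {}bs bs0 bsS.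
have kK : (k < K)%N by rewrite -nk ltnS leq_addl.
pose k' := Ordinal kK.
have [b0 [bs' [hF hk hS hj]]] := gavg_iter_eliminate k' bs.
have rowk j : b0 k' 0 * b0 j 0 = (k' == j)%:R.
  have := bsS k' j; rewrite /= leqnn andbT => <-.
  rewrite hS mxE summxE big1_seq ?addr0; last first.
    by move=> b /= bbs; rewrite mxE big_ord1 mxE hk// mul0r.
  by rewrite mxE big_ord1 mxE.
have b0j j : j != k' -> b0 j 0 = 0.
  move=> jk; have := rowk j; rewrite eq_sym (negbTE jk) => /eqP.
  rewrite mulf_eq0 => /orP[/eqP b0k|/eqP//].
  by have := rowk k'; rewrite b0k mul0r eqxx => /eqP; rewrite eq_sym oner_eq0.
have gb0 G : unit_fun G -> gavg b0 G = gavg (delta_mx k' 0) G.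
  move=> uG; have /eqP : b0 k' 0 ^+ 2 = 1 by rewrite expr2 rowk eqxx.
  rewrite sqrf_eq1 => /orP[] /eqP b0k.
    congr (gavg _ G); apply/matrixP => j z; rewrite ord1 mxE eqxx andbT.
    by have [->//|/b0j->] := eqVneq j k'.
  rewrite -[RHS]gavg_opp//; congr (gavg _ G); apply/matrixP => j z.
  rewrite ord1 !mxE eqxx andbT.
  by have [->//|/b0j->] := eqVneq j k'; rewrite ?oppr0.
have -> : drop k (enum 'I_K) = k' :: drop k.+1 (enum 'I_K).
  rewrite (drop_nth k') ?size_enum_ord//; congr (_ :: _).
  by apply: val_inj; rewrite /= nth_enum_ord.
rewrite /= hF// gb0; last exact: gavg_iter_unit.
congr (gavg _ _); apply: IH => //; first by rewrite addnS.
  move=> j; rewrite ltnS leq_eqVlt => /orP[/eqP jk|jk].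
    by rewrite (_ : j = k'); [exact: hk|exact: val_inj].
  by have [_] := hj j (bs0 j jk).
move=> i j; have := bsS i j; rewrite hS mxE [X in X + _ = _]mxE big_ord1 mxE.
have [->|ik] := eqVneq i k'.
  rewrite rowk /= leqnn andbT ltnn andbF => /eqP.
  by rewrite -subr_eq0 addrAC addrC subrr addr0 => /eqP.
rewrite b0j// mul0r add0r => ->; congr (_ && _)%:R.
rewrite [RHS]ltn_neqAle; have -> : k != i => //.
by rewrite eq_sym; apply: contra ik => /eqP ik; apply/eqP/val_inj.
Qed.

Lemma gavg_iter_delta (h : 'I_K -> R -> R) : (forall j, unit_fun (h j)) ->
  gavg_iter [seq delta_mx j 0 | j <- enum 'I_K] (fun x => \prod_j h j (tnth x j)) =
  fun x => \prod_j \int[N]_z h j (tnth x j + z).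
Proof.
(* [g s] is the factor once the coordinates listed in [s] have been averaged. *)
move=> uh; pose g (s : seq 'I_K) j t := if j \in s then \int[N]_z h j (t + z) else h j t.
have H s : uniq s -> gavg_iter [seq delta_mx j 0 | j <- s]
    (fun x => \prod_j h j (tnth x j)) = fun x => \prod_j g s j (tnth x j).
  elim: s => [|k s IH] //=; move=> /andP[ks us]; rewrite IH//.
  have gk t : g (k :: s) k t = \int[N]_z h k (t + z) by rewrite /g mem_head.
  have gs t : g s k t = h k t by rewrite /g (negbTE ks).
  have gj j t : j != k -> g (k :: s) j t = g s j t.
    by move=> jk; rewrite /g inE (negbTE jk).
  apply/funext => x; rewrite /avg [RHS](bigD1 k)//= gk mulrC -ExpZ; last first.
    apply: unit_fun_rint; apply: (unit_fun_comp _ (uh k)).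
    exact: measurable_funD.
  apply: eq_Rintegral => z _; rewrite (bigD1 k)//= mulrC; congr (_ * _).
    apply: eq_bigr => j jk; rewrite tnth_mktuple mxE (negbTE jk) mulr0 addr0.
    by rewrite gj.
  by rewrite gs tnth_mktuple mxE !eqxx mulr1 subr0.
rewrite H ?enum_uniq//; apply/funext => x; apply: eq_bigr => j _.
by rewrite /g mem_enum.
Qed.

End gaussian_averages.

(** * Smoothed orthant indicators and Lindeberg replacement *)

Section smooth_step.
Context {R : realType}.
Implicit Types (u v x : R) (h : R -> R).

Definition cube_pos u : R := Num.max u 0 ^+ 3.

(* The integral of the quadratic B-spline with knots 0, 1, 2, 3. *)
Definition spline u : R :=
  (cube_pos u - 3 * cube_pos (u - 1) + 3 * cube_pos (u - 2) - cube_pos (u - 3)) / 6.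

Lemma cube_posE u : cube_pos u = if 0 <= u then u ^+ 3 else 0.
Proof. by rewrite /cube_pos; case: (lerP 0 u) => // _; rewrite expr0n. Qed.

Lemma spline_le0 u : u <= 0 -> spline u = 0.
Proof.
move=> u0; rewrite /spline !cube_posE.
have -> : (0 <= u - 1) = false by apply/negbTE; rewrite -ltNge; lra.
have -> : (0 <= u - 2) = false by apply/negbTE; rewrite -ltNge; lra.
have -> : (0 <= u - 3) = false by apply/negbTE; rewrite -ltNge; lra.
have [u0'|_] := lerP 0 u; last by field.
have -> : u = 0 by apply/eqP; rewrite eq_le u0 u0'.
by field.
Qed.

Lemma spline_ge3 u : 3 <= u -> spline u = 1.
Proof.
move=> u3; rewrite /spline !cube_posE.
have -> : 0 <= u by lra.
have -> : 0 <= u - 1 by lra.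
have -> : 0 <= u - 2 by lra.
have -> : 0 <= u - 3 by lra.
by field.
Qed.

Lemma spline01 u : 0 <= spline u <= 1.
Proof.
have [u0|u0] := lerP u 0; first by rewrite spline_le0// lexx ler01.
have [u3|u3] := lerP 3 u; first by rewrite spline_ge3// lexx ler01.
rewrite /spline !cube_posE (ltW u0).
have -> : (0 <= u - 3) = false by apply/negbTE; rewrite -ltNge; lra.
have [u1|u1] := lerP 0 (u - 1); have [u2|u2] := lerP 0 (u - 2).
(* By the symmetry [spline u + spline (3 - u) = 1], the last piece mirrors the first. *)
- pose w := 3 - u; have w0 : 0 <= w by rewrite /w; lra.
  have w1 : w <= 1 by rewrite /w; lra.
  have -> : (u ^+ 3 - 3 * (u - 1) ^+ 3 + 3 * (u - 2) ^+ 3 - 0) / 6 = 1 - w ^+ 3 / 6.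
    by rewrite /w; field.
  have : 0 <= w ^+ 3 <= 1 by rewrite exprn_ge0//= exprn_ile1.
  by move: (w ^+ 3) => c /andP[? ?]; apply/andP; split; lra.
- pose w := u - 1; have w1 : w <= 1 by rewrite /w; lra.
  have -> : (u ^+ 3 - 3 * (u - 1) ^+ 3 + 3 * 0 - 0) / 6 =
    (- 2 * w ^+ 3 + 3 * w ^+ 2 + 3 * w + 1) / 6 by rewrite /w; field.
  have w0 : 0 <= w by [].
  have h2 : 0 <= w ^+ 2 <= w by apply/andP; split; nra.
  have h3 : 0 <= w ^+ 3 <= w ^+ 2.
    by rewrite (_ : w ^+ 3 = w * w ^+ 2)//; apply/andP; split; nra.
  (* The tangent line at 1; it yields the upper bound for the middle piece. *)
  have h4 : 3 * w - 2 <= w ^+ 3.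
    rewrite -subr_ge0 (_ : _ - _ = (w - 1) ^+ 2 * (w + 2)); last by ring.
    by rewrite mulr_ge0 ?sqr_ge0// addr_ge0.
  by move: h2 h3 h4; move: (w ^+ 2) (w ^+ 3) => a b /andP[? ?] /andP[? ?] ?; apply/andP; split; lra.
- by exfalso; lra.
- have u0' := ltW u0; have u1' : u <= 1 by lra.
  have : 0 <= u ^+ 3 <= 1 by rewrite exprn_ge0//= exprn_ile1.
  by move: (u ^+ 3) => c /andP[? ?]; apply/andP; split; lra.
Qed.

Lemma measurable_spline : measurable_fun setT (@spline).
Proof.
have mc k : measurable_fun setT (fun u => cube_pos (u - k)).
  by apply: measurable_funX; apply: measurable_maxr => //; exact: measurable_funB.
have mc0 : measurable_fun setT (fun u => cube_pos u).
  by apply: measurable_funX; exact: measurable_maxr.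
by apply: measurable_funM => //; apply: measurable_funB => //;
  apply: measurable_funD; [apply: measurable_funB => //|]; exact: measurable_funM.
Qed.

(** The mere existence of the two coefficients replaces derivatives: in the comparison of two laws
    with the same first two moments they cancel. The remainder is controlled on the whole line, so
    unbounded variables are allowed. *)
Definition taylor3 (M : R) h := exists p q, forall u,
  `|h u - h 0 - p * u - q * u ^+ 2| <= M * `|u| ^+ 3.

Lemma taylor3_cube_pos x : taylor3 1 (fun u => cube_pos (x + u)).
Proof.
rewrite /taylor3; have [x0|x0] := lerP 0 x.
  exists (3 * x ^+ 2), (3 * x) => u; rewrite addr0 !cube_posE x0 mul1r.
  have [xu|xu] := lerP 0 (x + u).
    by rewrite (_ : _ - _ = u ^+ 3) ?normrX//; ring.
  have -> : 0 - x ^+ 3 - 3 * x ^+ 2 * u - 3 * x * u ^+ 2 = u ^+ 3 - (x + u) ^+ 3 by ring.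
  (* In these nonnegative variables the remainder [b^3 - a^3] lies between [- a^3] and 0. *)
  pose a := - u; pose b := - (x + u).
  have b0 : 0 <= b by rewrite /b; lra.
  have ba : b <= a by rewrite /a /b; lra.
  have b3a3 : b ^+ 3 <= a ^+ 3 by rewrite lerXn2r// ?nnegrE// (le_trans b0).
  have -> : u ^+ 3 - (x + u) ^+ 3 = b ^+ 3 - a ^+ 3 by rewrite /a /b; ring.
  have -> : `|u| = a by rewrite ler0_norm// /a; lra.
  have : 0 <= b ^+ 3 by rewrite exprn_ge0.
  by rewrite ler0_norm; lra.
exists 0, 0 => u; rewrite addr0 !cube_posE [0 <= x]leNgt x0 /= !mul0r !subr0 mul1r.
have [xu|_] := lerP 0 (x + u); last by rewrite normr0 exprn_ge0.
rewrite ger0_norm ?exprn_ge0// lerXn2r ?nnegrE//.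
by apply: le_trans (ler_norm _); lra.
Qed.

(** The four remainders add up with total weight [(1 + 3 + 3 + 1) / 6 <= 2]. *)
Lemma taylor3_spline x : taylor3 2 (fun u => spline (x + u)).
Proof.
have [p0 [q0 h0]] := taylor3_cube_pos x.
have [p1 [q1 h1]] := taylor3_cube_pos (x - 1).
have [p2 [q2 h2]] := taylor3_cube_pos (x - 2).
have [p3 [q3 h3]] := taylor3_cube_pos (x - 3).
exists ((p0 - 3 * p1 + 3 * p2 - p3) / 6), ((q0 - 3 * q1 + 3 * q2 - q3) / 6) => u.
have := h0 u; have := h1 u; have := h2 u; have := h3 u.
rewrite /spline !addr0 !mul1r ![x - _ + u]addrAC.
move: (cube_pos (x + u)) (cube_pos x) (cube_pos (x + u - 1)) (cube_pos (x - 1)).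
move: (cube_pos (x + u - 2)) (cube_pos (x - 2)) (cube_pos (x + u - 3)) (cube_pos (x - 3)).
have : 0 <= `|u| ^+ 3 by rewrite exprn_ge0.
move: (`|u| ^+ 3) (u ^+ 2) => c w c0 a1 a2 a3 a4 a5 a6 a7 a8.
rewrite !ler_norml => /andP[? ?] /andP[? ?] /andP[? ?] /andP[? ?].
by apply/andP; split; lra.
Qed.

Lemma taylor3_scale (M b : R) h : 0 <= M -> taylor3 M h ->
  taylor3 (M * `|b| ^+ 3) (fun u => h (b * u)).
Proof.
move=> M0 [p [q H]]; exists (p * b), (q * b ^+ 2) => u.
by have := H (b * u); rewrite /= mulr0 normrM !exprMn !mulrA.
Qed.

Lemma taylor3_le (M M' : R) h : M <= M' -> taylor3 M h -> taylor3 M' h.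
Proof.
move=> MM' [p [q H]]; exists p, q => u; apply: le_trans (H u) _.
by rewrite ler_wpM2r// exprn_ge0.
Qed.

Lemma taylor3_cst (k : R) : taylor3 0 (fun=> k).
Proof. by exists 0, 0 => u; rewrite subrr !mul0r !subr0 normr0. Qed.

(** Dominates both remainder bounds of a product, the one for [|u| <= 1] and the one for [|u| > 1];
    the coefficients of each factor are at most [2 + M1] and [2 + M2]. *)
Definition taylor3_mulc (M1 M2 : R) : R :=
  3 * (2 + M1) * (2 + M2) + (1 + M1) * M2 + M1 + 2 + 2 * (4 + M1 + M2).

(* Evaluating the remainder bound at u = 1 and u = -1 bounds the two
   coefficients, since the functions take values in [0, 1]. *)
Lemma taylor3_mul (M1 M2 : R) h1 h2 : 0 <= M1 -> 0 <= M2 ->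
  (forall u, 0 <= h1 u <= 1) -> (forall u, 0 <= h2 u <= 1) ->
  taylor3 M1 h1 -> taylor3 M2 h2 ->
  taylor3 (taylor3_mulc M1 M2) (fun u => h1 u * h2 u).
Proof.
move=> M10 M20 h101 h201 [p1 [q1 H1]] [p2 [q2 H2]].
have coef (M p q : R) h : (forall u, 0 <= h u <= 1) ->
    (forall u, `|h u - h 0 - p * u - q * u ^+ 2| <= M * `|u| ^+ 3) ->
    `|p| <= 2 + M /\ `|q| <= 2 + M.
  move=> h01 H; have := H 1; have := H (-1).
  have := h01 1; have := h01 (-1); have := h01 0.
  rewrite normrN normr1 !expr1n sqrrN expr1n !mulr1 mulrN1 !ler_norml.
  by move=> /andP[? ?] /andP[? ?] /andP[? ?] /andP[? ?] /andP[? ?];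
    split; apply/andP; split; lra.
have [p1B q1B] := coef _ _ _ _ h101 H1.
have [p2B q2B] := coef _ _ _ _ h201 H2.
exists (h1 0 * p2 + h2 0 * p1), (h1 0 * q2 + h2 0 * q1 + p1 * p2) => u.
move: p1B q1B p2B q2B.
set B1 := 2 + M1; set B2 := 2 + M2 => p1B q1B p2B q2B.
have B10 : 0 <= B1 by rewrite /B1; lra.
have B20 : 0 <= B2 by rewrite /B2; lra.
have nM (a b A B : R) : `|a| <= A -> `|b| <= B -> `|a * b| <= A * B.
  by move=> aA bB; rewrite normrM ler_pM.
have nh1 v : `|h1 v| <= 1 by rewrite ger0_norm; case/andP: (h101 v).
have nh2 v : `|h2 v| <= 1 by rewrite ger0_norm; case/andP: (h201 v).
have pp := nM _ _ _ _ p1B p2B; have pq := nM _ _ _ _ p1B q2B.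
have qp := nM _ _ _ _ q1B p2B; have qq := nM _ _ _ _ q1B q2B.
have BB0 : 0 <= B1 * B2 by exact: mulr_ge0.
have u30 : 0 <= `|u| ^+ 3 by exact: exprn_ge0.
have MM0 : 0 <= (1 + M1) * M2 by rewrite mulr_ge0// addr_ge0.
rewrite /taylor3_mulc -/B1 -/B2.
(* Up to 1 the expansions are multiplied out, and every surviving term carries a cube or a
   remainder. Beyond 1 each term is dominated by [|u|^3] on its own. *)
have [u1|u1] := lerP `|u| 1.
  pose r1 := h1 u - h1 0 - p1 * u - q1 * u ^+ 2.
  pose r2 := h2 u - h2 0 - p2 * u - q2 * u ^+ 2.
  have r1B : `|r1| <= M1 * `|u| ^+ 3 by exact: H1.
  have r2B : `|r2| <= M2 * `|u| ^+ 3 by exact: H2.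
  have -> : h1 u * h2 u - h1 0 * h2 0 - (h1 0 * p2 + h2 0 * p1) * u
      - (h1 0 * q2 + h2 0 * q1 + p1 * p2) * u ^+ 2 =
      (p1 * q2 + q1 * p2 + q1 * q2 * u) * u ^+ 3 + (h1 u - r1) * r2 + r1 * h2 u.
    by rewrite /r1 /r2; ring.
  have e1 : `|(p1 * q2 + q1 * p2 + q1 * q2 * u) * u ^+ 3| <= 3 * (B1 * B2) * `|u| ^+ 3.
    rewrite normrM normrX ler_wpM2r//.
    apply: le_trans (ler_normD _ _) _; apply: le_trans (lerD (ler_normD _ _) (lexx _)) _.
    have : `|q1 * q2 * u| <= B1 * B2 * 1 by exact: (@nM).
    by lra.
  have e2 : `|(h1 u - r1) * r2| <= (1 + M1) * (M2 * `|u| ^+ 3).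
    apply: (@nM) => //; apply: le_trans (ler_normB _ _) _; apply: lerD => //.
    apply: le_trans r1B _; rewrite -[leRHS]mulr1 ler_wpM2l// exprn_ile1//.
  have e3 : `|r1 * h2 u| <= M1 * `|u| ^+ 3 * 1 by exact: (@nM).
  apply: le_trans (ler_normD _ _) _; apply: le_trans (lerD (ler_normD _ _) (lexx _)) _.
  apply: le_trans (lerD (lerD e1 e2) e3) _.
  have : 0 <= (2 + 2 * (4 + M1 + M2)) * `|u| ^+ 3 by rewrite mulr_ge0//; lra.
  by move: (`|u| ^+ 3) u30 => c c0; lra.
have u12 : `|u| <= `|u| ^+ 3.
  by rewrite -[leLHS]expr1 ler_weXn2l// ltW.
have u23 : `|u ^+ 2| <= `|u| ^+ 3.
  by rewrite normrX ler_weXn2l// ltW.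
have u13 : 1 <= `|u| ^+ 3 by apply: exprn_ege1; exact: ltW.
have e1 : `|h1 u * h2 u - h1 0 * h2 0| <= 2.
  have := h101 u; have := h101 0; have := h201 u; have := h201 0.
  move=> /andP[? ?] /andP[? ?] /andP[? ?] /andP[? ?].
  by rewrite ler_norml; apply/andP; split; nra.
have e2 : `|(h1 0 * p2 + h2 0 * p1) * u| <= (1 * B2 + 1 * B1) * `|u| ^+ 3.
  by apply: (@nM) => //; apply: le_trans (ler_normD _ _) _; apply: lerD; exact: (@nM).
have e3 : `|(h1 0 * q2 + h2 0 * q1 + p1 * p2) * u ^+ 2| <=
    (1 * B2 + 1 * B1 + B1 * B2) * `|u| ^+ 3.
  apply: (@nM) => //; apply: le_trans (ler_normD _ _) _; apply: lerD => //.
  by apply: le_trans (ler_normD _ _) _; apply: lerD; exact: (@nM).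
apply: le_trans (ler_normB _ _) _; apply: le_trans (lerD (ler_normB _ _) (lexx _)) _.
apply: le_trans (lerD (lerD e1 e2) e3) _.
have -> : 2 * (4 + M1 + M2) = 2 * (B1 + B2) by rewrite /B1 /B2; ring.
have : 0 <= (2 * (B1 * B2) + (1 + M1) * M2 + M1) * `|u| ^+ 3.
  by rewrite mulr_ge0//; lra.
by move: (`|u| ^+ 3) u30 u13 => c c0 c1; lra.
Qed.

Fixpoint taylor3_prodc (n : nat) (M : R) : R :=
  if n is n'.+1 then taylor3_mulc M (taylor3_prodc n' M) else 0.

Lemma taylor3_prodc_ge0 n M : 0 <= M -> 0 <= taylor3_prodc n M.
Proof.
move=> M0; elim: n => //= n IH; rewrite /taylor3_mulc.
by rewrite !addr_ge0 ?mulr_ge0 ?addr_ge0.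
Qed.

Lemma taylor3_prod (I : Type) (s : seq I) (M : R) (h : I -> R -> R) : 0 <= M ->
  (forall i u, 0 <= h i u <= 1) -> (forall i, taylor3 M (h i)) ->
  taylor3 (taylor3_prodc (size s) M) (fun u => \prod_(i <- s) h i u).
Proof.
move=> M0 h01 hT; elim: s => [|i s IH] /=.
  by under eq_fun do rewrite big_nil; exact: taylor3_cst.
under eq_fun do rewrite big_cons; apply: taylor3_mul => //.
- exact: taylor3_prodc_ge0.
- move=> u; rewrite prodr_ge0 /=; last by move=> j _; case/andP: (h01 j u).
  by apply: prodr_ile1 => j _; exact: h01.
Qed.

End smooth_step.

(** * Replacement of one variable by a Gaussian one *)

Section lindeberg_step.
Context {R : realType} {K : nat}.
Implicit Types (a : 'cV[R]_K) (F : K.-tuple R -> R).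
Local Notation N := (std_normal R).

(* AM-GM: [|v|^3] is the geometric mean of [e v^2] and [v^4 / e], up to a factor. *)
Lemma cube_le_sq_fourth (v e : R) : 0 < e -> `|v| ^+ 3 <= e * v ^+ 2 + v ^+ 4 / e.
Proof.
move=> e0; rewrite -[v ^+ 2](real_normK (num_real v)) (_ : v ^+ 4 = `|v| ^+ 4); last first.
  by rewrite -[RHS]normrX ger0_norm// exprn_even_ge0.
move: (`|v|) (normr_ge0 v) => w w0.
rewrite -(ler_pM2l e0).
have -> : e * w ^+ 3 = (e * w) * w ^+ 2 by ring.
have -> : e * (e * w ^+ 2 + w ^+ 4 / e) = (e * w) ^+ 2 + (w ^+ 2) ^+ 2.
  by field; rewrite gt_eqF.
have : 0 <= w ^+ 2 by exact: sqr_ge0.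
move: (w ^+ 2) (e * w) => p q p0.
have : 0 <= (q - p) ^+ 2 by exact: sqr_ge0.
by have : 0 <= (q + p) ^+ 2 := sqr_ge0 _; nra.
Qed.

Definition gauss4 : R := \int[N]_z (z ^+ 4).

Lemma gauss4_ge0 : 0 <= gauss4.
Proof. by apply: Exp_ge0 => z; exact: exprn_even_ge0. Qed.

Section one_variable.
Variables (m : probability R R) (b : R).
Hypotheses (m4 : rint m (fun u => (u - b) ^+ 4)) (mean0 : \int[m]_u (u - b) = 0).

Let mX k : measurable_fun setT (fun u : R => (u - b) ^+ k).
Proof. by apply: measurable_funX; exact: measurable_funB. Qed.

Lemma rint_sq_of_fourth : rint m (fun u => (u - b) ^+ 2).
Proof.
apply: (@rint_dominated _ _ _ m _ (fun u : R => 1 + (u - b) ^+ 4)) => //.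
- exact: rintD (rint_cst _ _) m4.
- move=> u; rewrite ger0_norm ?sqr_ge0// (_ : (u - b) ^+ 4 = ((u - b) ^+ 2) ^+ 2).
    by move: ((u - b) ^+ 2) => v; nra.
  by rewrite -exprM.
Qed.

Lemma rint_of_fourth : rint m (fun u => u - b).
Proof.
apply: (@rint_dominated _ _ _ m _ (fun u : R => 1 + (u - b) ^+ 2)) => //.
- exact: (mX 1).
- exact: rintD (rint_cst _ _) rint_sq_of_fourth.
- by move=> u; move: (u - b) => v; rewrite ler_norml; apply/andP; split; nra.
Qed.

(** Expand [E ((u - b)^2 - s)^2 >= 0]. *)
Lemma sq_moment_le_fourth :
  (\int[m]_u ((u - b) ^+ 2)) ^+ 2 <= \int[m]_u ((u - b) ^+ 4).
Proof.
set s := \int[m]_u _ ^+ 2.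
have i2 := rint_sq_of_fourth.
have : 0 <= \int[m]_u (((u - b) ^+ 4 - 2 * s * (u - b) ^+ 2) + s ^+ 2).
  apply: Exp_ge0 => u.
  have -> : (u - b) ^+ 4 - 2 * s * (u - b) ^+ 2 + s ^+ 2 = ((u - b) ^+ 2 - s) ^+ 2 by ring.
  exact: sqr_ge0.
rewrite ExpD; [|exact: rintB m4 (rintZ _ i2)|exact: rint_cst].
rewrite ExpB//; last exact: rintZ.
rewrite ExpZ// Exp_cst -/s.
by lra.
Qed.

(* Both averages are compared with the same quadratic polynomial, at a fixed
   base point. *)
Lemma lindeberg_step (M A e s2 mu4 : R) a F x : unit_fun F -> 0 <= M -> 0 <= A -> 0 < e ->
  (exists p q, forall u,
     `|F (translate x a u) - F x - p * u - q * u ^+ 2| <= M * (A * `|u|) ^+ 3) ->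
  s2 = \int[m]_u ((u - b) ^+ 2) -> mu4 = \int[m]_u ((u - b) ^+ 4) ->
  `|avg m a b F x - avg N (Num.sqrt s2 *: a) 0 F x| <=
    2 * (1 + gauss4) * M * (e * (A ^+ 2 * s2) + A ^+ 4 * mu4 / e).
Proof.
move=> uF M0 A0 e0 [p [q H]] s2E mu4E.
have i2 := rint_sq_of_fourth; have i1 := rint_of_fourth.
have s20 : 0 <= s2 by rewrite s2E; apply: Exp_ge0 => u; exact: sqr_ge0.
have mu40 : 0 <= mu4 by rewrite mu4E; apply: Exp_ge0 => u; exact: exprn_even_ge0.
(* The bound of [cube_le_sq_fourth] at [A u], which turns the third absolute moment into second and
   fourth moments. *)
pose rho (u : R) := M * (e * (A ^+ 2 * u ^+ 2) + A ^+ 4 * u ^+ 4 / e).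
have Hrho u : `|F (translate x a u) - F x - p * u - q * u ^+ 2| <= rho u.
  apply: le_trans (H u) _; rewrite /rho ler_wpM2l//.
  have := cube_le_sq_fourth (A * u) e0; rewrite normrM (ger0_norm A0) !exprMn.
  by [].
have mFs (t : R -> R) : measurable_fun setT t ->
    unit_fun (fun u => F (translate x a (t u))).
  move=> mt; apply: (@unit_fun_comp _ _ _ _ _ F (fun u => translate x a (t u))) => //.
  have := measurable_fun_pair2 x (measurable_translate a 0) => /= h.
  have := measurableT_comp h mt; congr (measurable_fun _ _).
  by apply/funext => u /=; rewrite subr0.
(* Centering removes the linear term. The polynomial part that remains, [F x + q s2], is the same
   for both laws because the Gaussian variable is scaled to variance [s2]. *)
have common (m' : probability R R) (t : R -> R) : measurable_fun setT t ->
    rint m' t -> rint m' (fun u => t u ^+ 2) -> rint m' (fun u => t u ^+ 4) ->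
    \int[m']_u t u = 0 ->
    `|\int[m']_u F (translate x a (t u)) - F x - q * \int[m']_u (t u ^+ 2)| <=
    M * (e * (A ^+ 2 * \int[m']_u (t u ^+ 2)) + A ^+ 4 * \int[m']_u (t u ^+ 4) / e).
  move=> mt it1 it2 it4 t0.
  have iF : rint m' (fun u => F (translate x a (t u))) by apply: unit_fun_rint; exact: mFs.
  have -> : \int[m']_u F (translate x a (t u)) - F x - q * \int[m']_u (t u ^+ 2) =
      \int[m']_u (F (translate x a (t u)) - F x - p * t u - q * t u ^+ 2).
    rewrite !ExpB ?ExpZ ?Exp_cst ?t0 ?mulr0 ?subr0//.
    - exact: rint_cst.
    - by apply: rintB => //; exact: rint_cst.
    - exact: rintZ.
    - by apply: rintB; [apply: rintB => //; exact: rint_cst|exact: rintZ].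
    - exact: rintZ.
  have irem : rint m' (fun u => F (translate x a (t u)) - F x - p * t u - q * t u ^+ 2).
    apply: rintB; last exact: rintZ.
    by apply: rintB; [apply: rintB => //; exact: rint_cst|exact: rintZ].
  have irho : rint m' (fun u => rho (t u)).
    apply: rintZ; apply: rintD; first by apply: rintZ; exact: rintZ.
    by under eq_fun do rewrite mulrAC; exact: rintZ.
  apply: le_trans (Exp_norm_le irem) _.
  apply: (@le_trans _ _ (\int[m']_u rho (t u))).
    by apply: Exp_le => //; exact: rint_norm.
  rewrite /rho ExpZ; last first.
    apply: rintD; first by apply: rintZ; exact: rintZ.
    by under eq_fun do rewrite mulrAC; exact: rintZ.
  rewrite ExpD; last 2 first.
  - by apply: rintZ; exact: rintZ.
  - by under eq_fun do rewrite mulrAC; exact: rintZ.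
  have -> : \int[m']_u (A ^+ 4 * t u ^+ 4 / e) = A ^+ 4 * \int[m']_u (t u ^+ 4) / e.
    by under eq_Rintegral do rewrite mulrAC; rewrite ExpZ// mulrAC.
  by rewrite !ExpZ//; exact: rintZ.
have c1 := common m (fun u => u - b) (mX 1) i1 i2 m4 mean0.
have mN : measurable_fun setT (fun z : R => Num.sqrt s2 * z) by exact: measurable_funM.
have EX k : (fun z : R => (Num.sqrt s2 * z) ^+ k) = (fun z : R => Num.sqrt s2 ^+ k * z ^+ k).
  by apply/funext => z; rewrite exprMn.
have N1 : rint N (fun z : R => Num.sqrt s2 * z) by apply: rintZ; exact: std_normal_rint1.
have N2 : rint N (fun z : R => (Num.sqrt s2 * z) ^+ 2).
  by rewrite EX; apply: rintZ; exact: std_normal_rint2.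
have N4 : rint N (fun z : R => (Num.sqrt s2 * z) ^+ 4).
  by rewrite EX; apply: rintZ; exact: std_normal_rint4.
have N0 : \int[N]_z (Num.sqrt s2 * z) = 0.
  by rewrite ExpZ ?std_normal_mean ?mulr0//; exact: std_normal_rint1.
have c2 := common N _ mN N1 N2 N4 N0.
have E2 : \int[N]_z ((Num.sqrt s2 * z) ^+ 2) = s2.
  rewrite EX ExpZ; last exact: std_normal_rint2.
  by rewrite std_normal_var mulr1 sqr_sqrtr.
have E4 : \int[N]_z ((Num.sqrt s2 * z) ^+ 4) = s2 ^+ 2 * gauss4.
  rewrite EX ExpZ; last exact: std_normal_rint4.
  by rewrite (_ : 4 = 2 * 2)%N// exprM sqr_sqrtr.
rewrite E2 E4 in c2.
have -> : avg N (Num.sqrt s2 *: a) 0 F x = \int[N]_z F (translate x a (Num.sqrt s2 * z)).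
  apply: eq_Rintegral => z _; congr F; apply: eq_from_tnth => j.
  by rewrite !tnth_mktuple mxE; ring.
rewrite /avg; rewrite -s2E -mu4E in c1.
set I1 := \int[m]_u F _ in c1 *; set I2 := \int[N]_z F _ in c2 *.
have -> : I1 - I2 = (I1 - F x - q * s2) - (I2 - F x - q * s2) by ring.
apply: le_trans (ler_normB _ _) _; apply: le_trans (lerD c1 c2) _.
have := sq_moment_le_fourth; rewrite -s2E -mu4E => s2m.
have g0 := gauss4_ge0.
have A20 : 0 <= A ^+ 2 by exact: exprn_ge0.
have A40 : 0 <= A ^+ 4 by exact: exprn_ge0.
have X0 : 0 <= e * (A ^+ 2 * s2) by rewrite !mulr_ge0// ltW.
have Y0 : 0 <= A ^+ 4 * mu4 / e by rewrite !mulr_ge0// invr_ge0 ltW.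
(* The Gaussian fourth moment [s2^2 * gauss4] is at most [mu4 * gauss4], so the fourth moment of the
   original variable controls both sides. *)
have Y1 : A ^+ 4 * (s2 ^+ 2 * gauss4) / e <= gauss4 * (A ^+ 4 * mu4 / e).
  rewrite (_ : gauss4 * (A ^+ 4 * mu4 / e) = A ^+ 4 * (mu4 * gauss4) / e); last by ring.
  by rewrite ler_wpM2r ?invr_ge0 ?(ltW e0)// ler_wpM2l// ler_wpM2r.
move: X0 Y0 Y1; set X := e * _; set Y := A ^+ 4 * mu4 / e; set Z := _ / e => X0 Y0 Y1.
rewrite -mulrDr [leRHS](_ : _ = M * (2 * (1 + gauss4) * (X + Y))); last by ring.
rewrite ler_wpM2l//.
have : 0 <= gauss4 * X by exact: mulr_ge0.
have : 0 <= gauss4 * Y by exact: mulr_ge0.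
by lra.
Qed.

End one_variable.

End lindeberg_step.

(** * From smoothed orthants to the Gaussian distribution function *)

Section normal_cdf.
Context {R : realType}.
Local Notation N := (std_normal R).

Definition ncdf (t : R) : R := fine (N [set z | z <= t]).

Lemma measurable_le_set (t : R) : measurable [set z : R | z <= t].
Proof. by rewrite -set_itvNyc; exact: measurable_itv. Qed.

Lemma ncdfE t : (ncdf t)%:E = N [set z | z <= t].
Proof. by rewrite /ncdf fineK// fin_num_measure//; exact: measurable_le_set. Qed.

Lemma ncdf01 t : 0 <= ncdf t <= 1.
Proof.
by rewrite -!lee_fin ncdfE measure_ge0 probability_le1//; exact: measurable_le_set.
Qed.

Lemma normal_peak1_le1 : normal_peak (1 : R) <= 1.
Proof.
have p2 := @pi_ge2 R.
have p0 : 0 <= (pi : R) *+ 2 by rewrite mulrn_wge0// (le_trans _ p2).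
have h : (1 : R) <= Num.sqrt (pi *+ 2).
  by rewrite -[leLHS]sqrtr1 ler_sqrt// -mulr_natr; lra.
by rewrite /normal_peak expr1n mul1r invf_le1// (lt_le_trans _ h).
Qed.

(** The normal density is at most 1. This is what converts a shift of an orthant's corner into an
    error in probability. *)
Lemma ncdf_lipschitz s t : s <= t -> ncdf t <= ncdf s + (t - s).
Proof.
move=> st; rewrite -lee_fin EFinD !ncdfE.
have mI : measurable (`]s, t]%classic : set R) by exact: measurable_itv.
have -> : [set z | z <= t] = [set z | z <= s] `|` `]s, t]%classic.
  apply/seteqP; split => z /=; rewrite in_itv /=.
    by move=> zt; case: (lerP z s) => zs; [left|right; rewrite zt].
  by case=> [zs|/andP[]//]; exact: le_trans st.
apply: le_trans (measureU2 _ _ _) _ => //; first exact: measurable_le_set.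
apply: leeD2l.
change (\int[lebesgue_measure]_(z in `]s, t]) (normal_pdf (0 : R) 1 z)%:E <= (t - s)%:E)%E.
apply: (@le_trans _ _ (\int[lebesgue_measure]_(z in `]s, t]) (cst 1%:E z))%E).
  apply: ge0_le_integral => //.
  - by move=> z _; rewrite lee_fin normal_pdf_ge0.
  - by apply/measurable_EFinP/measurable_funTS; exact: measurable_normal_pdf.
  - move=> z _; rewrite lee_fin; apply: le_trans (normal_pdf_ub _ _ _) normal_peak1_le1.
    exact: oner_neq0.
rewrite integral_cst//= mul1e lebesgue_measure_itv/= lte_fin.
by case: ifPn => [_|]; rewrite ?EFinB// -leNgt lee_fin subr_ge0.
Qed.

End normal_cdf.

Section smooth_orthant.
Context {R : realType} {K : nat}.
Implicit Types (tau : 'I_K -> R) (x : K.-tuple R) (a : 'cV[R]_K).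
Local Notation N := (std_normal R).
Variable dlt : R.
Hypothesis dlt0 : 0 < dlt.

(** It is 1 for [v <= t - 3 dlt] and 0 for [v >= t]: the spline rises on [0, 3], hence the recurring
    width [3 * dlt]. *)
Definition step_fun (t v : R) : R := spline ((t - v) / dlt).

Lemma step_fun_unit t : unit_fun (step_fun t).
Proof.
split => [|v]; last exact: spline01.
apply: (measurableT_comp measurable_spline).
by apply: measurable_funM => //; exact: measurable_funB.
Qed.

Lemma step_fun_le t v : step_fun t v <= (v <= t)%R%:R.
Proof.
have [vt|vt] := lerP v t; first by case/andP: (spline01 ((t - v) / dlt)).
by rewrite /step_fun spline_le0// ler_pdivrMr// mul0r; lra.
Qed.

Lemma step_fun_ge t v : (v <= t)%R%:R <= step_fun (t + 3 * dlt) v.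
Proof.
have [vt|vt] := lerP v t; last by case/andP: (spline01 ((t + 3 * dlt - v) / dlt)).
by rewrite /step_fun spline_ge3// ler_pdivlMr//; lra.
Qed.

Definition orthant_fun tau x : R := \prod_j step_fun (tau j) (tnth x j).

Lemma orthant_fun_unit tau : unit_fun (orthant_fun tau).
Proof.
split => [|x]; last first.
  rewrite /orthant_fun prodr_ge0 /=; last first.
    by move=> j _; case/andP: (spline01 ((tau j - tnth x j) / dlt)).
  by apply: prodr_ile1 => j _; exact: spline01.
apply: measurable_prod => j _.
exact: (measurableT_comp (step_fun_unit (tau j)).1 (measurable_tnth j)).
Qed.

(** Each of the [K] factors has the constant 2 of [taylor3_spline], rescaled by [1 / dlt]. Neither
    the corner nor the base point enters, which makes the final bound uniform over orthants. *)
Definition orthant_taylor : R :=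
  taylor3_prodc (size (index_enum 'I_K)) (2 * dlt^-1 ^+ 3).

Lemma orthant_taylor_ge0 : 0 <= orthant_taylor.
Proof. by apply: taylor3_prodc_ge0; rewrite mulr_ge0// exprn_ge0// invr_ge0 ltW. Qed.

Lemma orthant_fun_taylor tau (A : R) a x : 0 <= A -> (forall j, `|a j 0| <= A) ->
  exists p q, forall u,
    `|orthant_fun tau (translate x a u) - orthant_fun tau x - p * u - q * u ^+ 2| <=
      orthant_taylor * (A * `|u|) ^+ 3.
Proof.
move=> A0 aA; have [A_0|Ap] := eqVneq A 0.
  exists 0, 0 => u; rewrite !mul0r !subr0 (_ : translate x a u = x).
    by rewrite subrr normr0 mulr_ge0 ?orthant_taylor_ge0// exprn_ge0// mulr_ge0.
  apply: eq_from_tnth => j; rewrite tnth_mktuple.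
  by have := aA j; rewrite A_0 normr_le0 => /eqP->; rewrite mulr0 addr0.
have {}Ap : 0 < A by rewrite lt_def Ap.
(* The direction is normalized by [A]: its coordinates are then at most 1 in absolute value, so the
   constant of each factor depends on [dlt] only. The scale [A] returns through [taylor3_scale]. *)
pose h j (v : R) := spline ((tau j - tnth x j) / dlt + (- (a j 0 / A / dlt)) * v).
have hT : taylor3 orthant_taylor (fun v => \prod_j h j v).
  apply: taylor3_prod; first by rewrite mulr_ge0// exprn_ge0// invr_ge0 ltW.
    by move=> j u; exact: spline01.
  move=> j; have := taylor3_scale (- (a j 0 / A / dlt)) (ler0n R 2)
    (taylor3_spline ((tau j - tnth x j) / dlt)).
  apply: taylor3_le; rewrite ler_wpM2l// lerXn2r ?nnegrE ?invr_ge0 ?(ltW dlt0)//.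
  rewrite normrN normrM (gtr0_norm (x := dlt^-1)) ?invr_gt0//.
  rewrite ler_piMl ?invr_ge0 ?(ltW dlt0)// normrM normfV (gtr0_norm Ap).
  by rewrite ler_pdivrMr// mul1r.
have [p [q H]] := taylor3_scale A orthant_taylor_ge0 hT.
exists p, q => u; have := H u.
have -> : \prod_j h j (A * u) = orthant_fun tau (translate x a u).
  apply: eq_bigr => j _; rewrite /h /step_fun tnth_mktuple; congr spline.
  by field; rewrite !gt_eqF.
have -> : \prod_j h j (A * 0) = orthant_fun tau x.
  by apply: eq_bigr => j _; rewrite /h mulr0 mulr0 addr0.
by rewrite (gtr0_norm Ap) -mulrA -exprMn.
Qed.

(** After the replacement the directions [sqrt (s2 i) a i] have Gram matrix [1%:M], so the Gaussian
    average may be computed along the coordinate axes, where the test function factors. *)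
Lemma lindeberg_orthant (I : Type) (s : seq I) (m : I -> probability R R)
    (b A s2 mu4 : I -> R) (a : I -> 'cV[R]_K) (e : R) tau x :
  0 < e -> (forall i, 0 <= A i) -> (forall i j, `|a i j 0| <= A i) ->
  (forall i, rint (m i) (fun u => (u - b i) ^+ 4)) ->
  (forall i, \int[m i]_u (u - b i) = 0) ->
  (forall i, s2 i = \int[m i]_u ((u - b i) ^+ 2)) ->
  (forall i, mu4 i = \int[m i]_u ((u - b i) ^+ 4)) ->
  \sum_(i <- s) s2 i *: (a i *m (a i)^T) = 1%:M ->
  `|avg_iter [seq (m i, a i, b i) | i <- s] (orthant_fun tau) x -
    \prod_j \int[N]_z step_fun (tau j) (tnth x j + z)| <=
  2 * (1 + gauss4) * orthant_taylor *
    \sum_(i <- s) (e * (A i ^+ 2 * s2 i) + A i ^+ 4 * mu4 i / e).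
Proof.
move=> e0 A0 aA m4 m0 s2E mu4E gram1.
have uF := orthant_fun_unit tau.
have s20 i : 0 <= s2 i by rewrite s2E; apply: Exp_ge0 => u; exact: sqr_ge0.
have := gavg_iter_delta (fun j => step_fun_unit (tau j)).
rewrite -(@gavg_iter_gram _ _ [seq Num.sqrt (s2 i) *: a i | i <- s])//; last first.
  rewrite big_map -gram1; apply: eq_bigr => i _.
  by rewrite linearZ/= -scalemxAl -scalemxAr scalerA -expr2 sqr_sqrtr.
move=> /(congr1 (fun f => f x)) <-.
rewrite gavg_iterE -map_comp mulr_sumr.
apply: (@avg_iter_swap _ _ _ s (fun i => (m i, a i, b i))
  (fun i => (std_normal R : probability R R, Num.sqrt (s2 i) *: a i, 0)) _ _ uF).
move=> i y /=; apply: lindeberg_step => //; first exact: orthant_taylor_ge0.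
exact: orthant_fun_taylor.
Qed.

(** A step function lies between the indicators of two half-lines whose ends differ by [3 * dlt],
    and [ncdf] is 1-Lipschitz. *)
Lemma step_fun_integral t : ncdf t <= \int[N]_z step_fun (t + 3 * dlt) (0 + z) <= ncdf t + 3 * dlt
  /\ ncdf t - 3 * dlt <= \int[N]_z step_fun t (0 + z) <= ncdf t.
Proof.
have ncdfI s : ncdf s = \int[N]_z ((z <= s)%R%:R : R).
  rewrite /ncdf -prob_indic; last exact: measurable_le_set.
  by apply: eq_Rintegral => z _; rewrite indicE mem_setE.
have ri s : rint N (fun z => (z <= s)%R%:R).
  have := @rint_indic _ _ _ N _ (measurable_le_set s); congr (rint N _).
  by apply/funext => z; rewrite indicE mem_setE.
have rs s : rint N (fun z => step_fun s (0 + z)).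
  by under eq_fun do rewrite add0r; apply: unit_fun_rint; exact: step_fun_unit.
have up s : \int[N]_z step_fun s (0 + z) <= ncdf s.
  by rewrite ncdfI; apply: Exp_le => // z; rewrite add0r; exact: step_fun_le.
have lo s : ncdf s <= \int[N]_z step_fun (s + 3 * dlt) (0 + z).
  by rewrite ncdfI; apply: Exp_le => // z; rewrite add0r; exact: step_fun_ge.
have L s : ncdf (s + 3 * dlt) <= ncdf s + 3 * dlt.
  have ss : s <= s + 3 * dlt by rewrite lerDl mulr_ge0// ltW.
  by have := ncdf_lipschitz ss; lra.
split; apply/andP; split => //; first exact: le_trans (up _) (L _).
have := lo (t - 3 * dlt); rewrite subrK; apply: le_trans.
by have := L (t - 3 * dlt); rewrite subrK; lra.
Qed.

(** Telescoping, one factor at a time, while the others stay in [0, 1]. *)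
Lemma prod_diff (f g : 'I_K -> R) (e : R) :
  (forall j, 0 <= f j <= 1) -> (forall j, 0 <= g j <= 1) ->
  (forall j, `|f j - g j| <= e) -> `|\prod_j f j - \prod_j g j| <= K%:R * e.
Proof.
move=> f01 g01 fg.
suff H (s : seq 'I_K) : `|\prod_(j <- s) f j - \prod_(j <- s) g j| <= (size s)%:R * e.
  have := H (index_enum 'I_K).
  by rewrite (_ : size _ = K)// -[RHS](card_ord K) cardE enumT.
elim: s => [|j s IH]; first by rewrite !big_nil subrr normr0 mul0r.
rewrite !big_cons /= -natr1 mulrDl mul1r [leRHS]addrC.
set p := \prod_(i <- s) f i in IH *; set p' := \prod_(i <- s) g i in IH *.
have -> : f j * p - g j * p' = (f j - g j) * p + g j * (p - p') by ring.
have p01 : 0 <= p <= 1.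
  rewrite /p prodr_ge0 /=; last by move=> i _; case/andP: (f01 i).
  by apply: prodr_ile1 => i _; exact: f01.
apply: le_trans (ler_normD _ _) _; rewrite !normrM; apply: lerD.
  apply: le_trans _ (fg j); rewrite ler_piMr//.
  by rewrite ger0_norm; case/andP: p01.
apply: le_trans _ IH; rewrite ler_piMl//.
by rewrite ger0_norm; case/andP: (g01 j).
Qed.

(** The indicator of the orthant lies between the smoothed ones with corners [t] and [t + 3 dlt];
    this is why the hypothesis ranges over all corners [tau]. *)
Lemma orthant_sandwich d (Om : measurableType d) (Q : probability Om R)
    (S : Om -> K.-tuple R) (t : 'I_K -> R) (E : R) : measurable_fun setT S ->
  (forall tau, `|\int[Q]_w orthant_fun tau (S w) -
     \prod_j \int[N]_z step_fun (tau j) (0 + z)| <= E) ->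
  `|fine (Q [set w | forall j, tnth (S w) j <= t j]) - \prod_j ncdf (t j)| <=
    E + K%:R * (3 * dlt).
Proof.
move=> mS HE.
pose D := [set w | forall j, tnth (S w) j <= t j].
have mD : measurable D.
  have -> : D = \bigcap_(j in [set: 'I_K]) [set w | tnth (S w) j <= t j].
    by apply/seteqP; split => w /= h j => [_|]; [exact: h|exact: (h j)].
  apply: fin_bigcap_measurable => // j _.
  rewrite -[X in measurable X]setTI.
  apply: (measurableT_comp (measurable_tnth j) mS _ (measurable_le_set (t j))) => //.
have DI w : \1_D w = \prod_j (tnth (S w) j <= t j)%R%:R :> R.
  rewrite indicE; have [|nD] := boolP (w \in D).
    by rewrite inE => Dw; rewrite big1// => j _; rewrite Dw.
  have [j jD] : exists j, ~~ (tnth (S w) j <= t j).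
    apply: contrapT => h; move: nD; rewrite notin_setE; apply => j.
    by apply: contrapT => /negP h'; apply: h; exists j.
  by rewrite (bigD1 j)//= (negbTE jD) mul0r.
have rD := @rint_indic _ _ _ Q _ mD.
have rO tau : rint Q (fun w => orthant_fun tau (S w)).
  by apply: unit_fun_rint; exact: (unit_fun_comp mS (orthant_fun_unit tau)).
have b01 (c : bool) : 0 <= (c%:R : R) by case: c.
have lo : \int[Q]_w orthant_fun t (S w) <= fine (Q D).
  rewrite -prob_indic//; apply: Exp_le => // w; rewrite DI; apply: ler_prod => j _.
  by rewrite step_fun_le andbT; case/andP: (spline01 ((t j - tnth (S w) j) / dlt)).
have up : fine (Q D) <= \int[Q]_w orthant_fun (fun j => t j + 3 * dlt) (S w).
  rewrite -prob_indic//; apply: Exp_le => // w; rewrite DI; apply: ler_prod => j _.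
  by rewrite step_fun_ge b01.
have i01 r : 0 <= \int[N]_z step_fun r (0 + z) <= 1.
  apply/andP; split.
    by apply: Exp_ge0 => z; case/andP: (spline01 ((r - (0 + z)) / dlt)).
  apply: (@le_trans _ _ (ncdf r)); last by case/andP: (ncdf01 r).
  by have [_ /andP[]] := step_fun_integral r.
have P1 : `|\prod_j \int[N]_z step_fun (t j) (0 + z) - \prod_j ncdf (t j)| <= K%:R * (3 * dlt).
  apply: prod_diff => // j; first exact: ncdf01.
  have [_ /andP[? ?]] := step_fun_integral (t j).
  by rewrite ler_norml; apply/andP; split; lra.
have P2 : `|\prod_j \int[N]_z step_fun (t j + 3 * dlt) (0 + z) - \prod_j ncdf (t j)| <=
      K%:R * (3 * dlt).
  apply: prod_diff => // j; first exact: ncdf01.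
  have [/andP[? ?] _] := step_fun_integral (t j).
  by rewrite ler_norml; apply/andP; split; lra.
move: (HE t) (HE (fun j => t j + 3 * dlt)) P1 P2 lo up.
rewrite !ler_norml => /andP[? ?] /andP[? ?] /andP[? ?] /andP[? ?] ? ?.
by apply/andP; split; lra.
Qed.

End smooth_orthant.

Lemma finite_prod_measure_eq d1 d2 (T1 : measurableType d1) (T2 : measurableType d2)
    (R : realType) (m1 m2 : {measure set (T1 * T2) -> \bar R}) : (m1 setT < +oo)%E ->
  (forall A B, measurable A -> measurable B -> m1 (A `*` B) = m2 (A `*` B)) ->
  forall C, measurable C -> m1 C = m2 C.
Proof.
move=> m1oo m12 C mC.
apply: (measure_unique [set A `*` B | A in measurable & B in measurable] (fun=> setT)) => //.
- exact: measurable_prod_measurableType.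
- move=> _ _ [A1 mA1 [B1 mB1 <-]] [A2 mA2 [B2 mB2 <-]]; rewrite -setXI.
  by exists (A1 `&` A2); [exact: measurableI|exists (B1 `&` B2) => //; exact: measurableI].
- by move=> _; exists setT => //; exists setT => //; rewrite setXTT.
- by rewrite bigcup_const//; exists 0%N.
- by move=> _ [A mA [B mB <-]]; exact: m12.
Qed.

(** * Independence *)

Section law_of_random_element.
Context d d' (Om : measurableType d) (V : measurableType d') (R : realType).
Variables (Q : probability Om R) (X : Om -> V) (mX : measurable_fun setT X).

Let Xm : {mfun Om >-> V} := HB.pack X (isMeasurableFun.Build _ _ _ _ X mX).

Definition law : probability V R := distribution Q Xm.

Lemma rint_law f : measurable_fun setT f -> rint Q (f \o X) -> rint law f.
Proof.
move=> mf fi; apply: (integrable_pushforward mX) => //.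
  exact/measurable_EFinP.
Qed.

Lemma Exp_law f : measurable_fun setT f -> rint Q (f \o X) ->
  \int[law]_v f v = \int[Q]_w f (X w).
Proof.
move=> mf fi; rewrite /Rintegral; congr fine.
by rewrite (@integral_distribution _ _ _ _ _ Q Xm (EFin \o f))//; exact/measurable_EFinP.
Qed.

End law_of_random_element.

Section independence.
Context d (Om : measurableType d) (R : realType) (Q : probability Om R).

Definition indep2 d1 d2 (U : measurableType d1) (V : measurableType d2)
    (X : Om -> U) (Y : Om -> V) : Prop :=
  forall A B, measurable A -> measurable B ->
    (Q (X @^-1` A `&` Y @^-1` B) = Q (X @^-1` A) * Q (Y @^-1` B))%E.

Lemma indep2_comp d1 d2 d3 d4 (U : measurableType d1) (V : measurableType d2)
    (U' : measurableType d3) (V' : measurableType d4) (X : Om -> U) (Y : Om -> V)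
    (f : U -> U') (g : V -> V') : measurable_fun setT f -> measurable_fun setT g ->
  indep2 X Y -> indep2 (f \o X) (g \o Y).
Proof.
move=> mf mg XY A B mA mB; apply: (XY (f @^-1` A) (g @^-1` B)).
- by rewrite -[X in measurable X]setTI; exact: mf.
- by rewrite -[X in measurable X]setTI; exact: mg.
Qed.

Lemma indep2_law d1 d2 (U : measurableType d1) (V : measurableType d2)
    (X : Om -> U) (Y : Om -> V) (mX : measurable_fun setT X) (mY : measurable_fun setT Y)
    (mXY : measurable_fun setT (fun w => (X w, Y w))) : indep2 X Y ->
  forall C, measurable C -> law Q mXY C = (law Q mX \x law Q mY)%E C.
Proof.
by move=> XY C mC; apply/esym; apply: product_measure_unique.
Qed.

Lemma measurable_pairf d1 d2 (U : measurableType d1) (V : measurableType d2)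
    (X : Om -> U) (Y : Om -> V) : measurable_fun setT X -> measurable_fun setT Y ->
  measurable_fun setT (fun w => (X w, Y w)).
Proof. by move=> mX mY; apply/measurable_fun_pairP; split. Qed.

(** The law of [Y] is prescribed as [m], so that the conditional law itself, and not an image
    measure, appears in the averaging operator. *)
Lemma indep2_Exp d1 d2 (U : measurableType d1) (V : measurableType d2)
    (X : Om -> U) (Y : Om -> V) (m : probability V R) (F : U * V -> R) :
  measurable_fun setT X -> measurable_fun setT Y -> indep2 X Y ->
  (forall B, measurable B -> Q (Y @^-1` B) = m B) -> unit_fun F ->
  \int[Q]_w F (X w, Y w) = \int[Q]_w \int[m]_v F (X w, v).
Proof.
move=> mX mY XY Ym uF; have mXY := measurable_pairf mX mY.
have mF := uF.1; have F0 z : (0 <= (F z)%:E)%E by rewrite lee_fin; case/andP: (uF.2 z).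
rewrite -(@Exp_law _ _ _ _ _ Q _ mXY F) //; last first.
  by apply: unit_fun_rint; exact: (unit_fun_comp mXY uF).
have uG : unit_fun (fun u => \int[m]_v F (u, v)) by exact: unit_fun_avg.
rewrite -(@Exp_law _ _ _ _ _ Q _ mX (fun u => \int[m]_v F (u, v)) uG.1); last first.
  by apply: unit_fun_rint; exact: (unit_fun_comp mX uG).
apply: EFin_inj; rewrite !ExpE; [|exact: unit_fun_rint..].
rewrite (eq_measure_integral (law Q mX \x m)%E); last first.
  move=> C mC _; apply/esym; apply: product_measure_unique => // A B mA mB.
  by rewrite [LHS]XY// Ym.
rewrite (fubini_tonelli1 (EFin \o F))//; last exact/measurable_EFinP.
apply: eq_integral => u _; rewrite ExpE//; apply: unit_fun_rint.
exact: (unit_fun_comp (pair1_measurable u) uF).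
Qed.

(** The joint law is the product of the marginals. Tonelli first gives integrability of the product,
    then Fubini its value. *)
Lemma indep2_ExpM (X Y : Om -> R) : rint Q X -> rint Q Y -> indep2 X Y ->
  rint Q (fun w => X w * Y w) /\
  \int[Q]_w (X w * Y w) = (\int[Q]_w X w) * (\int[Q]_w Y w).
Proof.
move=> iX iY XY; have mX := rint_measurable iX; have mY := rint_measurable iY.
have mXY := measurable_pairf mX mY.
have jX : rint (law Q mX) id by exact: rint_law.
have jY : rint (law Q mY) id by exact: rint_law.
pose f (z : R * R) := (z.1 * z.2)%:E.
have mf' : measurable_fun setT (fun z : R * R => z.1 * z.2) by exact: measurable_funM.
have mf : measurable_fun setT f by exact/measurable_EFinP.
have fi : (law Q mX \x law Q mY)%E.-integrable setT f.
  apply: (integrable12ltyP _ _ mf).2.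
  under eq_integral => x _.
    under eq_integral do rewrite /f /= normrM EFinM.
    rewrite ge0_integralZl//; last by apply/measurable_EFinP; exact: normr_measurable.
    over.
  rewrite ge0_integralZr//; last 2 first.
  - by apply/measurable_EFinP; exact: normr_measurable.
  - exact: integral_ge0.
  rewrite -!ExpE; [|exact: rint_norm..].
  by rewrite -EFinM ltry.
have E C : measurable C -> law Q mXY C = (law Q mX \x law Q mY)%E C.
  by move=> mC; exact: indep2_law.
have fi' : rint (law Q mXY) (fun z => z.1 * z.2).
  have /integrableP[_ foo] := fi.
  apply/integrableP; split; first exact/measurable_EFinP.
  by rewrite (eq_measure_integral (law Q mX \x law Q mY)%E)// => C mC _; exact: E.
have ri : rint Q (fun w => X w * Y w).
  apply/integrableP; split.
    by apply/measurable_EFinP; exact: measurable_funM.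
  have /integrableP[_] := fi'.
  rewrite (ge0_integral_pushforward mXY)//=; last first.
    by apply/measurable_EFinP; apply: measurableT_comp => //; exact: normr_measurable.
split => //.
rewrite -(@Exp_law _ _ _ _ _ Q _ mXY (fun z => z.1 * z.2))//.
rewrite -[X in X * _](@Exp_law _ _ _ _ _ Q _ mX id)//.
rewrite -[X in _ * X](@Exp_law _ _ _ _ _ Q _ mY id)//.
apply: EFin_inj; rewrite ExpE// (eq_measure_integral (law Q mX \x law Q mY)%E); last first.
  by move=> C mC _; exact: E.
rewrite -[LHS]integral12_prod_meas1// /fubini_F.
under eq_integral => x _.
  rewrite (_ : (\int[_]_y f (x, y))%E = (x * \int[law Q mY]_y y)%:E); last first.
    by rewrite EFinM ExpE// -integralZl.
  over.
rewrite -ExpE; last by under eq_fun do rewrite mulrC; exact: rintZ.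
by under eq_Rintegral do rewrite mulrC; rewrite ExpZ// mulrC.
Qed.

End independence.

Section independent_families.
Context d d' (Om : measurableType d) (U : measurableType d') (R : realType)
  (Q : probability Om R) (I : choiceType) (Z : I -> Om -> U).
Hypotheses (mZ : forall i, measurable_fun setT (Z i))
  (iZ : mutually_independent Q Z).

Let mZB i B : measurable B -> measurable (Z i @^-1` B).
Proof. by move=> mB; rewrite -[X in measurable X]setTI; exact: mZ. Qed.

Lemma mutually_independent_indep2 i j : i != j -> indep2 Q (Z i) (Z j).
Proof.
move=> ij A B mA mB.
have := @iZ [:: i; j] (fun k => if k == i then A else B).
rewrite /= inE ij /= => /(_ isT) h.
rewrite !big_cons big_nil mule1 eqxx eq_sym (negbTE ij) in h.
rewrite -h; last by move=> k; case: ifP.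
congr (Q _); apply/seteqP; split => w /=.
  by move=> [wA wB] k; rewrite !inE => /orP[] /eqP->; rewrite ?eqxx// eq_sym (negbTE ij).
move=> h'; split.
  by have := h' i (mem_head _ _); rewrite eqxx.
by have := h' j; rewrite !inE eqxx orbT eq_sym (negbTE ij); apply.
Qed.

Definition cylinder (r : seq I) (B : I -> set U) : set Om :=
  [set w | forall i, i \in r -> B i (Z i w)].

Lemma measurable_cylinder r B : (forall i, measurable (B i)) -> measurable (cylinder r B).
Proof.
move=> mB; elim: r => [|i r IH].
  by rewrite (_ : cylinder _ _ = setT)//; apply/seteqP; split.
rewrite (_ : cylinder _ _ = Z i @^-1` B i `&` cylinder r B).
  by apply: measurableI => //; exact: mZB.
apply/seteqP; split => w /=.
  move=> h; split => [|j jr]; apply: h; first exact: mem_head.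
  by rewrite inE jr orbT.
by move=> [wi wr] j; rewrite inE => /orP[/eqP->//|]; exact: wr.
Qed.

Section fold.
Context d1 (V : measurableType d1) (v0 : V) (phi : I -> V * U -> V).
Hypothesis mphi : forall i, measurable_fun setT (phi i).

(** A state updated by one variable at a time. Partial sums of vectors and partial products are both
    of this kind, so their independence from a fresh variable is proved once. *)
Definition fold_vars (s : seq I) (w : Om) : V :=
  foldr (fun i v => phi i (v, Z i w)) v0 s.

Lemma measurable_fold_vars s : measurable_fun setT (fold_vars s).
Proof.
elim: s => [|i s IH]; first exact: measurable_cst.
by apply: (measurableT_comp (mphi i)); exact: measurable_pairf.
Qed.

(* Two finite measures in the pair (folded value, next variable) agree on
   rectangles by induction, hence everywhere. *)
Lemma fold_vars_cylinder s r A B : uniq (s ++ r) -> measurable A ->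
  (forall i, measurable (B i)) ->
  (Q (fold_vars s @^-1` A `&` cylinder r B) =
   Q (fold_vars s @^-1` A) * \big[*%E/1%E]_(i <- r) Q (Z i @^-1` B i))%E.
Proof.
move=> + + mB; elim: s r A B mB => [|i s IH] r A B mB /= usr mA.
  rewrite -iZ// -/(cylinder r B); have [vA|vA] := pselect (A v0).
    rewrite (_ : fold_vars [::] @^-1` A = setT) ?setTI ?probability_setT ?mul1e//.
    by apply/seteqP; split.
  rewrite (_ : fold_vars [::] @^-1` A = set0) ?set0I ?measure0 ?mul0e//.
  by apply/seteqP; split.
have /andP[isr usr'] := usr.
have mE := measurable_cylinder r mB; set E := cylinder r B in mE *.
set c := (X in _ = (_ * X)%E).
have c0 : (0 <= c)%E.
  by rewrite /c; elim/big_ind : _ => // a b a0 b0; exact: mule_ge0.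
have ur : uniq r by move: usr'; rewrite cat_uniq => /and3P[].
have cE : c = Q E by rewrite /c -iZ.
have fc0 : 0 <= fine c by exact: fine_ge0.
have cfin : c = (fine c)%:E by rewrite cE fineK// fin_num_measure.
have mSZ := measurable_pairf (measurable_fold_vars s) (mZ i).
(* [nu] is the law of the pair restricted to the event [E], [nu'] its law scaled by the probability
   of [E]; their equality is the independence of the pair from [E]. *)
pose nu := image_measure (mrestr Q mE) mSZ.
pose nu' : {measure set (V * U) -> \bar R} := mscale (NngNum fc0) (image_measure Q mSZ).
have nuE C : measurable C -> nu C = nu' C.
  move=> mC; apply: finite_prod_measure_eq => //.
    rewrite /nu /= /pushforward /mrestr /= preimage_setT setTI.
    by rewrite (le_lt_trans (probability_le1 Q mE))// ltry.
  move=> A' B' mA' mB'; rewrite /nu /nu' /= /mscale /= /pushforward /mrestr /=.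
  have -> : (fun w => (fold_vars s w, Z i w)) @^-1` (A' `*` B') =
      fold_vars s @^-1` A' `&` Z i @^-1` B' by apply/seteqP; split.
  (* [B2] puts [B'] at index [i], so that the induction hypothesis applies with [i] moved from the
     fold to the cylinder. *)
  pose B2 j := if j == i then B' else B j.
  have mB2 j : measurable (B2 j) by rewrite /B2; case: ifP.
  have us1 : uniq (s ++ i :: r) by rewrite -[i :: r]cat1s uniq_catCA.
  have us2 : uniq (s ++ [:: i]).
    rewrite cats1 rcons_uniq; move: isr usr'; rewrite mem_cat negb_or cat_uniq.
    by move=> /andP[-> _] /and3P[->].
  have cyl1 : cylinder (i :: r) B2 = Z i @^-1` B' `&` E.
    apply/seteqP; split => w /=.
      move=> h; split; first by have := h i (mem_head _ _); rewrite /B2 eqxx.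
      move=> j jr; have := h j; rewrite inE jr orbT /B2 => /(_ isT).
      by case: eqP => // ji; move: isr; rewrite mem_cat -ji jr orbT.
    move=> [wi wr] j; rewrite inE /B2; case: eqP => [->//|_ /=].
    exact: wr.
  have cyl2 : cylinder [:: i] B2 = Z i @^-1` B'.
    apply/seteqP; split => w /=.
      by move=> h; have := h i (mem_head _ _); rewrite /B2 eqxx.
    by move=> wi j; rewrite inE /B2 => /eqP->; rewrite eqxx.
  rewrite -setIA -cyl1 (IH _ _ _ mB2 us1 mA') -cyl2 (IH _ _ _ mB2 us2 mA').
  rewrite !big_cons big_nil mule1 -cfin [RHS]muleC -muleA; congr (_ * (_ * _))%E.
  rewrite /c !big_seq; apply: eq_bigr => j jr; rewrite /B2; case: eqP => // ji.
  by move: isr; rewrite mem_cat -ji jr orbT.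
have mC : measurable (phi i @^-1` A) by rewrite -[X in measurable X]setTI; exact: mphi.
have := nuE _ mC; rewrite /nu /nu' /= /mscale /= /pushforward /mrestr /= -cfin.
by rewrite muleC.
Qed.

Lemma fold_vars_indep2 s i : uniq (i :: s) -> indep2 Q (fold_vars s) (Z i).
Proof.
move=> uis A B mA mB.
have us : uniq (s ++ [:: i]) by rewrite cats1 rcons_uniq.
have := @fold_vars_cylinder s [:: i] A (fun=> B) us mA (fun=> mB).
rewrite big_cons big_nil mule1 => <-; congr (Q (_ `&` _)).
apply/seteqP; split => w /= h; last exact: (h i (mem_head _ _)).
by move=> j; rewrite inE => /eqP->.
Qed.

End fold.

Lemma mutually_independent_Exp_prod (f : I -> U -> R) s : uniq s ->
  (forall i, unit_fun (f i)) ->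
  \int[Q]_w (\prod_(i <- s) f i (Z i w)) = \prod_(i <- s) \int[Q]_w f i (Z i w).
Proof.
move=> us uf.
have ri i : rint Q (fun w => f i (Z i w)).
  by apply: unit_fun_rint; exact: (unit_fun_comp (mZ i) (uf i)).
pose phi i (z : R * U) := z.1 * f i z.2.
have mphi i : measurable_fun setT (phi i).
  apply: measurable_funM => //.
  by apply: (measurableT_comp (uf i).1); exact: measurable_snd.
have accE r w : fold_vars (1 : R) phi r w = \prod_(i <- r) f i (Z i w).
  by elim: r => [|i r IH] /=; rewrite ?big_nil// big_cons /phi /= IH mulrC.
elim: s us => [|i s IH] us; first by under eq_Rintegral do rewrite big_nil; rewrite Exp_cst big_nil.
have := fold_vars_indep2 (1 : R) mphi us.
move=> /(indep2_comp (@measurable_id _ _ setT) (uf i).1) ind.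
have iacc r : rint Q (fold_vars (1 : R) phi r).
  apply: (@rint_bounded _ _ _ _ _ 1); first exact: measurable_fold_vars.
  move=> w; rewrite accE ger0_norm ?prodr_ge0//.
    by apply: prodr_ile1 => j _; exact: (uf j).2.
  by move=> j _; case/andP: ((uf j).2 (Z j w)).
have [_ E] := indep2_ExpM (iacc s) (ri i) ind.
transitivity (\int[Q]_w (fold_vars (1 : R) phi s w * f i (Z i w))).
  by apply: eq_Rintegral => w _; rewrite big_cons mulrC accE.
rewrite [LHS]E big_cons -IH; last by case/andP: us.
rewrite mulrC; congr (_ * _).
by apply: eq_Rintegral => w _; rewrite accE.
Qed.

End independent_families.

Section sums_of_independent.
Context d (Om : measurableType d) (R : realType) (K : nat)
  (Q : probability Om R) (I : choiceType) (Z : I -> Om -> R).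
Hypotheses (mZ : forall i, measurable_fun setT (Z i))
  (iZ : mutually_independent Q Z).
Variables (m : I -> probability R R) (a : I -> 'cV[R]_K) (b : I -> R).
Hypothesis mE : forall i B, measurable B -> Q (Z i @^-1` B) = m i B.

Definition origin : K.-tuple R := [tuple 0 | j < K].

Definition wsum (s : seq I) : Om -> K.-tuple R :=
  fold_vars Z origin (fun i z => translate z.1 (a i) (z.2 - b i)) s.

Lemma wsumE s w j : tnth (wsum s w) j = \sum_(i <- s) (Z i w - b i) * a i j 0.
Proof.
elim: s => [|i s IH] /=; first by rewrite tnth_mktuple big_nil.
by rewrite tnth_mktuple IH big_cons addrC.
Qed.

Lemma measurable_wsum s : measurable_fun setT (wsum s).
Proof. by apply: measurable_fold_vars => // i; exact: measurable_translate. Qed.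

(** The outermost variable is independent of the partial sum of the others; integrating it out
    applies one averaging operator to the test function, and commutation moves that operator to its
    place in the iteration. *)
Lemma Exp_wsum s (F : K.-tuple R -> R) : uniq s -> unit_fun F ->
  \int[Q]_w F (wsum s w) = avg_iter [seq (m i, a i, b i) | i <- s] F origin.
Proof.
elim: s F => [|i s IH] F us uF; first by rewrite /= Exp_cst.
have us' : uniq s by case/andP: us.
rewrite /= (avg_iterC (m i, a i, b i)) //= -IH//; last exact: avg_unit.
have mphi j : measurable_fun setT
    (fun z : K.-tuple R * R => translate z.1 (a j) (z.2 - b j)).
  exact: measurable_translate.
have ind := fold_vars_indep2 mZ iZ origin mphi us.
exact: (indep2_Exp (measurable_wsum s) (mZ i) ind (@mE i)
  (unit_fun_comp (measurable_translate (a i) (b i)) uF)).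
Qed.

End sums_of_independent.

Section orthogonal_sums.
Context d (Om : measurableType d) (R : realType) (Q : probability Om R).

Lemma Exp_sqr_sum (I : eqType) (s : seq I) (X : I -> Om -> R) : uniq s ->
  (forall i, measurable_fun setT (X i)) ->
  (forall i, rint Q (fun w => X i w ^+ 2)) ->
  (forall i j, i != j -> \int[Q]_w (X i w * X j w) = 0) ->
  rint Q (fun w => (\sum_(i <- s) X i w) ^+ 2) /\
  \int[Q]_w ((\sum_(i <- s) X i w) ^+ 2) = \sum_(i <- s) \int[Q]_w (X i w ^+ 2).
Proof.
move=> us mX i2 orth.
have ii i j : rint Q (fun w => X i w * X j w).
  apply: (@rint_dominated _ _ _ Q _ (fun w => X i w ^+ 2 + X j w ^+ 2)).
  - exact: measurable_funM.
  - exact: rintD.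
  - by move=> w; rewrite ler_norml; apply/andP; split; nra.
elim: s us => [_|i s IH /= /andP[is_ us]].
  under eq_fun do rewrite big_nil expr0n /=.
  split; first exact: rint_cst.
  by rewrite Exp_cst big_nil.
have [IH1 IH2] := IH us.
have E w : (\sum_(j <- i :: s) X j w) ^+ 2 =
    X i w ^+ 2 + (\sum_(j <- s) 2 * (X i w * X j w) + (\sum_(j <- s) X j w) ^+ 2).
  by rewrite big_cons sqrrD -mulr_sumr -mulr_sumr -mulr_natl; ring.
have rcross : rint Q (fun w => \sum_(j <- s) 2 * (X i w * X j w)).
  by apply: rint_sum => j; exact: rintZ.
under eq_fun do rewrite E.
split; first by apply: rintD => //; exact: rintD.
rewrite ExpD//; last exact: rintD.
rewrite ExpD// IH2 big_cons Exp_sum; last by move=> j; exact: rintZ.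
rewrite [X in _ + (X + _)]big_seq [X in _ + (X + _)]big1 ?add0r// => j js.
have ij : i != j by apply: contraNneq is_ => ->.
by rewrite ExpZ// orth ?mulr0.
Qed.

End orthogonal_sums.

(** * The conditional law of a sample *)

Section kernel_probability.
Context d d' (X : measurableType d) (Y : measurableType d') (R : realType).
Variables (k : R.-pker X ~> Y) (x : X).

(** The value of the kernel at one point, named so that a probability structure can be attached to
    it. *)
Definition kprob : set Y -> \bar R := k x.

HB.instance Definition _ := Measure.on kprob.

HB.instance Definition _ :=
  @Measure_isProbability.Build _ _ _ kprob (prob_kernel x).

End kernel_probability.

Section density_measure.
Context d (T : measurableType d) (R : realType).
Variables (mu : {measure set T -> \bar R}) (f : T -> \bar R).
Hypotheses (mf : measurable_fun setT f) (f0 : forall x, (0 <= f x)%E).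

(** The proofs of measurability and nonnegativity are arguments, so that every instance carries what
    its measure structure requires. *)
Definition density (h : measurable_fun setT f) (h0 : forall x, (0 <= f x)%E) (A : set T) :=
  (\int[mu]_(x in A) f x)%E.

Let density0 : density mf f0 set0 = 0%E.
Proof. exact: integral_set0. Qed.

Let density_ge0 A : (0 <= density mf f0 A)%E.
Proof. by apply: integral_ge0 => x _; exact: f0. Qed.

Let density_sigma_additive : semi_sigma_additive (density mf f0).
Proof.
move=> F mF tF mUF; rewrite /density ge0_integral_bigcup//.
- apply: is_cvg_ereal_nneg_natsum_cond => n _ _.
  by apply: integral_ge0 => x _; exact: f0.
- exact: measurable_funTS.
Qed.

HB.instance Definition _ := isMeasure.Build _ _ _ (density mf f0)
  density0 density_ge0 density_sigma_additive.

End density_measure.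

Section tuple_measures.
Context d (U : measurableType d) (R : realType) (n : nat).

Definition rect (B : 'I_n -> set U) : set (n.-tuple U) :=
  [set u | forall i, B i (tnth u i)].

Lemma measurable_rect B : (forall i, measurable (B i)) -> measurable (rect B).
Proof.
move=> mB; rewrite (_ : rect B = \bigcap_(i in [set: 'I_n]) ((@tnth n U ^~ i) @^-1` B i)).
  apply: fin_bigcap_measurable => // i _.
  by rewrite -[X in measurable X]setTI; exact: measurable_tnth.
by apply/seteqP; split => u /= h i => [_|]; [exact: h|exact: (h i)].
Qed.

Lemma tuple_measure_eq (m1 m2 : {measure set (n.-tuple U) -> \bar R}) :
  (m1 setT < +oo)%E ->
  (forall B, (forall i, measurable (B i)) -> m1 (rect B) = m2 (rect B)) ->
  forall A, measurable A -> m1 A = m2 A.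
Proof.
move=> m1oo m12 A mA.
have rectT : setT = rect (fun=> setT) by apply/seteqP; split.
apply: (measure_unique [set rect B | B in [set B | forall i, measurable (B i)]] (fun=> setT)) => //.
- rewrite eqEsubset; split.
    apply: smallest_sub; first exact: smallest_sigma_algebra.
    rewrite -bigcup_seq; apply: bigcup_sub => i _ _ [B mB <-].
    apply: sub_sigma_algebra; exists (fun j => if j == i then B else setT).
      by move=> j; case: ifP.
    apply/seteqP; split => u /=.
      by move=> h; split => //; have := h i; rewrite eqxx.
    by move=> [_ uB] j; case: eqP => // ->.
  apply: smallest_sub; first exact: sigma_algebra_measurable.
  by move=> _ [B mB <-]; exact: measurable_rect.
- move=> _ _ [B1 mB1 <-] [B2 mB2 <-]; exists (fun i => B1 i `&` B2 i).
    by move=> i; exact: measurableI.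
  apply/seteqP; split => u /=; first by move=> h; split => i; have [] := h i.
  by move=> [h1 h2] i; split.
- by move=> _; exists (fun=> setT) => //; rewrite rectT.
- by rewrite bigcup_const//; exists 0%N.
- by move=> _ [B mB <-]; exact: m12.
Qed.

End tuple_measures.

Section rational_rays.
Context {R : realType}.

(** A countable pi-system that generates the Borel sets; [None] adds the whole line. *)
Definition ray (c : option rat) : set R := if c is Some q then [set z | z < ratr q] else setT.

Lemma measurable_ray c : measurable (ray c).
Proof. by case: c => [q|] //=; rewrite -set_itvNyo; exact: measurable_itv. Qed.

Lemma ray_measure_eq (m1 m2 : {measure set R -> \bar R}) : (m1 setT < +oo)%E ->
  (forall c, m1 (ray c) = m2 (ray c)) -> forall A, measurable A -> m1 A = m2 A.
Proof.
move=> m1oo m12 A mA.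
apply: (measure_unique (range ray) (fun=> setT)) => //.
- rewrite eqEsubset; split; last first.
    apply: smallest_sub; first exact: sigma_algebra_measurable.
    by move=> _ [c _ <-]; exact: measurable_ray.
  move=> X mX; have {mX} : <<s @RGenInftyO.G R >> X.
    have h : @measurable _ (measurableTypeR R) X by [].
    by rewrite /measurableTypeR RGenInftyO.measurableE in h.
  apply: smallest_sub; first exact: smallest_sigma_algebra.
  move=> _ [x ->].
  pose F k := if unpickle k is Some q then
    (if (ratr q < x)%R then ray (Some q) else set0) else set0.
  have -> : `]-oo, x[%classic = \bigcup_k F k.
    apply/seteqP; split => z /=; rewrite in_itv /=.
      move=> /rat_in_itvoo[q]; rewrite in_itv /= => /andP[zq qx].
      exists (pickle q); first exact: I.
      by rewrite /F pickleK qx.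
    move=> [k _]; rewrite /F; case: unpickle => // q; case: ifP => // qx /= zq.
    exact: lt_trans zq qx.
  apply: sigma_algebra_bigcup => k; rewrite /F.
  case: unpickle => [q|]; last exact: sigma_algebra0.
  case: ifP => _; last exact: sigma_algebra0.
  by apply: sub_sigma_algebra; exists (Some q).
- move=> _ _ [[q1|] _ <-] [[q2|] _ <-]; rewrite /= ?setTI ?setIT.
  + exists (Some (Order.min q1 q2)) => //=; apply/seteqP; split => z /=.
      by move=> h; split; apply: lt_le_trans h _; rewrite ler_rat ge_min lexx ?orbT.
    by move=> [h1 h2]; case: (leP q1 q2).
  + by exists (Some q1).
  + by exists (Some q2).
  + by exists None.
- by move=> _; exists None.
- by rewrite bigcup_const//; exists 0%N.
- by move=> _ [c _ <-]; exact: m12.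
Qed.

End rational_rays.

Section independence_transfer.
Context d d' (T : measurableType d) (U : measurableType d') (R : realType)
  (P : probability T R).

Lemma mutually_independent_ord (Z : nat -> T -> U) n :
  mutually_independent P Z -> mutually_independent P (fun i : 'I_n => Z i).
Proof.
move=> iZ s B us mB.
pose B' (k : nat) := if insub k is Some i then B (i : 'I_n) else setT.
have B'E (i : 'I_n) : B' i = B i by rewrite /B' valK.
have := iZ (map val s) B'; rewrite map_inj_uniq; last exact: val_inj.
move=> /(_ us) h; rewrite big_map in h.
rewrite (_ : [set w | _] = [set w | forall i, i \in map val s -> B' i (Z i w)]).
  by rewrite h; [under eq_bigr do rewrite B'E|move=> k; rewrite /B'; case: insubP].
apply/seteqP; split => w /= hw.
  by move=> _ /mapP[i is_ ->]; rewrite B'E; exact: hw.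
by move=> i is_; rewrite -B'E; apply: hw; exact: map_f.
Qed.

Lemma mutually_independent_comp d2 (V : measurableType d2) (I : choiceType)
    (Z : I -> T -> U) (g : U -> V) : measurable_fun setT g ->
  mutually_independent P Z -> mutually_independent P (fun i => g \o Z i).
Proof.
move=> mg iZ s B us mB.
have := iZ s (fun i => g @^-1` B i) us; apply => i.
by rewrite -[X in measurable X]setTI; exact: mg.
Qed.

Lemma ae_law (X : T -> U) (mX : measurable_fun setT X) (S : U -> Prop) :
  {ae law P mX, forall v, S v} -> {ae P, forall w, S (X w)}.
Proof.
move=> [N [mN N0 SN]]; exists (X @^-1` N); split => //.
- by have := mX measurableT _ mN; rewrite setTI.
- by move=> w /= h; exact: (SN (X w) h).
Qed.

End independence_transfer.

Lemma ae_forall_countable d (T : measurableType d) (R : realType) (P : probability T R)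
    (I : countType) (S : I -> T -> Prop) :
  (forall i, {ae P, forall w, S i w}) -> {ae P, forall w, forall i, S i w}.
Proof.
move=> h; have : {ae P, forall w, forall k : nat,
    if unpickle k is Some i then S i w else True}.
  apply: ae_foralln => k; case: unpickle => [i|]; first exact: h.
  exact: aeW.
by apply: filterS => w hw i; have := hw (pickle i); rewrite pickleK.
Qed.

Section product_of_conditional_laws.
Context d (T : measurableType d) (R : realType) (K : nat) (P : probability T R).
Variables (y : nat -> {RV P >-> R}) (x : nat -> {RV P >-> K.-tuple R}).
Variables (kappa : R.-pker (K.-tuple R) ~> R).
Variables (Q : forall n, R.-pker (n.-tuple (K.-tuple R)) ~> (n.-tuple R)).
Hypotheses
  (indep : mutually_independent P (fun (i : nat) (w : T) => (y i w, x i w)))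
  (condk : forall i, cond_distribution P (x i) (y i) kappa)
  (condQ : forall n, cond_distribution P (sample x n) (sample y n) (Q n)).

Lemma measurable_sample d' (U : measurableType d') (z : nat -> {RV P >-> U}) n :
  measurable_fun setT (sample z n).
Proof.
apply/measurable_fun_tnthP => i.
rewrite (_ : _ \o _ = z i); first exact: measurable_funPT.
by apply/funext => w /=; rewrite tnth_mktuple.
Qed.

Lemma kernel_unit d1 d2 (V : measurableType d1) (U : measurableType d2)
    (k : R.-pker V ~> U) B : measurable B -> unit_fun (fun v => fine (k v B)).
Proof.
move=> mB; split.
  apply: measurableT_comp; first exact: fine_measurable.
  exact: measurable_kernel.
move=> v; rewrite -!lee_fin fineK; last by exact: (fin_num_measure (kprob k v)).
by rewrite measure_ge0 (probability_le1 (kprob k v) mB).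
Qed.

Lemma kernel_fineK d1 d2 (V : measurableType d1) (U : measurableType d2)
    (k : R.-pker V ~> U) v B : measurable B -> (fine (k v B))%:E = k v B.
Proof. by move=> mB; rewrite fineK//; exact: (fin_num_measure (kprob k v)). Qed.

(** Both sides are functions of the covariates and are compared as densities with respect to the law
    of the covariate sample. Over a rectangle the left one integrates to a joint probability, which
    factors by independence of the pairs and recombines, through [kappa], into the integral of the
    right one. Equal densities agree almost surely. *)
Lemma cond_rect_ae n (B : 'I_n -> set R) : (forall i, measurable (B i)) ->
  {ae P, forall w, fine (Q n (sample x n w) (rect B)) =
                   \prod_(i < n) fine (kappa (x i w) (B i))}.
Proof.
move=> mB; have mX : measurable_fun setT (sample x n) by exact: measurable_sample.
have mRB := measurable_rect mB.
pose q v := fine (Q n v (rect B)).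
pose phi (v : n.-tuple (K.-tuple R)) := \prod_i fine (kappa (tnth v i) (B i)).
have uq : unit_fun q by exact: kernel_unit.
have uphi : unit_fun phi.
  have u1 i := kernel_unit kappa (mB i); split => [|v]; last first.
    rewrite /phi prodr_ge0 /=; last by move=> i _; case/andP: ((u1 i).2 (tnth v i)).
    by apply: prodr_ile1 => i _; exact: (u1 i).2.
  apply: measurable_prod => i _.
  exact: (measurableT_comp (u1 i).1 (measurable_tnth i)).
have mE (f : n.-tuple (K.-tuple R) -> R) : unit_fun f -> measurable_fun setT (EFin \o f).
  by move=> uf; apply/measurable_EFinP; exact: uf.1.
have E0 (f : n.-tuple (K.-tuple R) -> R) : unit_fun f -> forall v, (0 <= (EFin \o f) v)%E.
  by move=> uf v; rewrite lee_fin; case/andP: (uf.2 v).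
have dE (f : n.-tuple (K.-tuple R) -> R) (uf : unit_fun f) A : measurable A ->
    density (law P mX) (mE f uf) (E0 f uf) A =
    (\int[P]_(w in sample x n @^-1` A) (f (sample x n w))%:E)%E.
  move=> mA; rewrite /density (ge0_integral_pushforward mX)//.
  - exact: (measurable_funTS (mE f uf)).
  - by move=> v _; exact: (E0 f uf v).
have dens_eq A : measurable A ->
    density (law P mX) (mE q uq) (E0 q uq) A =
    density (law P mX) (mE phi uphi) (E0 phi uphi) A.
  apply: tuple_measure_eq.
    change (density (law P mX) (mE q uq) (E0 q uq) setT < +oo)%E.
    rewrite dE// preimage_setT; apply: rint_lty.
    by apply: unit_fun_rint; exact: (unit_fun_comp mX uq).
  move=> {}A mA; have mRA := measurable_rect mA.
  change (density (law P mX) (mE q uq) (E0 q uq) (rect A) =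
    density (law P mX) (mE phi uphi) (E0 phi uphi) (rect A)).
  rewrite !dE//.
  have -> : (\int[P]_(w in sample x n @^-1` rect A) (q (sample x n w))%:E =
      P (sample x n @^-1` rect A `&` sample y n @^-1` rect B))%E.
    rewrite condQ//; apply: eq_integral => w _; rewrite /q kernel_fineK//.
  have -> : sample x n @^-1` rect A `&` sample y n @^-1` rect B =
      [set w | forall i : 'I_n, i \in index_enum 'I_n -> (B i `*` A i) (y i w, x i w)].
    apply/seteqP; split => w /=.
      move=> [hA hB] i _; have := hA i; have := hB i.
      by rewrite !tnth_mktuple.
    move=> h; split => i; have := h i (mem_index_enum _);
      by rewrite tnth_mktuple => -[].
  have iZn := mutually_independent_ord (n := n) indep.
  apply: etrans (iZn (index_enum 'I_n) (fun i => B i `*` A i) (index_enum_uniq _) _) _.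
    by move=> i; exact: measurableX.
  (* The joint probability of [A i] and [B i] is the mean of [f i (x i)]; independence of the
     covariates turns the product of these means into the mean of the product. *)
  pose f (i : 'I_n) (v : K.-tuple R) : R := \1_(A i) v * fine (kappa v (B i)).
  have uf i : unit_fun (f i).
    have u1 := kernel_unit kappa (mB i); split => [|v].
      by apply: measurable_funM; [exact: measurable_indic|exact: u1.1].
    rewrite /f indicE; case: (_ \in _); rewrite ?mul1r ?mul0r ?lexx ?ler01//.
    exact: u1.2.
  have ind : mutually_independent P (fun (i : 'I_n) => x i : T -> K.-tuple R).
    have := @mutually_independent_comp _ _ _ _ _ P _ _ _ _ snd measurable_snd
      (mutually_independent_ord (n := n) indep).
    by [].
  have EP0 := mutually_independent_Exp_prod (fun i : 'I_n => measurable_funPT (x i)) ind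
    (index_enum_uniq _) uf.
  have EP := congr1 EFin EP0.
  transitivity (\prod_(i <- index_enum 'I_n) \int[P]_w f i (x i w))%:E.
    rewrite -prodEFin; apply: eq_bigr => i _; rewrite ExpE; last first.
      by apply: unit_fun_rint; exact: (unit_fun_comp (measurable_funPT (x i)) (uf i)).
    transitivity (P (x i @^-1` A i `&` y i @^-1` B i)).
      by congr (P _); apply/seteqP; split => w /= -[].
    rewrite condk// integral_mkcond; apply: eq_integral => w _.
    rewrite /f patchE indicE.
    rewrite (_ : (w \in x i @^-1` A i) = (x i w \in A i)); last first.
      by apply/idP/idP; rewrite !inE.
    by case: (_ \in _); rewrite ?mul1r ?mul0r// kernel_fineK.
  rewrite -EP ExpE; last first.
    apply: unit_fun_rint; split => [|w].
      apply: measurable_prod => i _.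
      exact: (measurableT_comp (uf i).1 (measurable_funPT (x i))).
    rewrite prodr_ge0 /=; last by move=> i _; case/andP: ((uf i).2 (x i w)).
    by apply: prodr_ile1 => i _; exact: (uf i).2.
  rewrite [RHS]integral_mkcond; apply: eq_integral => w _.
  rewrite patchE; have [|nA] := boolP (_ \in _).
    rewrite inE => wA; congr (_%:E); apply: eq_bigr => i _.
    have := wA i; rewrite /f tnth_mktuple indicE => wAi.
    by rewrite mem_set// mul1r.
  have [i iA] : exists i : 'I_n, ~ A i (x i w).
    apply: contrapT => h; move: nA; rewrite notin_setE; apply => i /=.
    by rewrite tnth_mktuple; apply: contrapT => h'; apply: h; exists i.
  rewrite (bigD1 i)//= {1}/f indicE memNset// mul0r mul0r//.
have : ae_eq (law P mX) setT (EFin \o q) (EFin \o phi).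
  apply: integral_ae_eq => //.
  - exact: unit_fun_rint.
  - exact: (mE phi uphi).
  - by move=> A _ mA; exact: dens_eq.
move=> h; have := @ae_law _ _ _ _ _ P _ mX (fun v => q v = phi v).
have h' : {ae law P mX, forall v, q v = phi v}.
  by apply: filterS h => v /(_ I) [].
move=> /(_ h'); apply: filterS => w; rewrite /q => ->.
by apply: eq_bigr => i _; rewrite tnth_mktuple.
Qed.

(** The null set of [cond_rect_ae] depends on the rectangle. The countably many rectangles with
    rational rays as sides share one null set, and off it the identity extends to Borel sides one
    coordinate at a time. *)
Lemma cond_product_ae : {ae P, forall w, forall n (B : 'I_n -> set R),
  (forall i, measurable (B i)) ->
  fine (Q n (sample x n w) (rect B)) = \prod_(i < n) fine (kappa (x i w) (B i))}.
Proof.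
have : {ae P, forall w, forall n (c : {ffun 'I_n -> option rat}),
    fine (Q n (sample x n w) (rect (fun i => ray (c i)))) =
    \prod_(i < n) fine (kappa (x i w) (ray (c i)))}.
  apply: ae_foralln => n; apply: ae_forall_countable => c.
  by apply: cond_rect_ae => i; exact: measurable_ray.
apply: filterS => w h n B mB.
(* The first [k] sides are arbitrary Borel sets, the others are still rays. *)
suff H k : (k <= n)%N -> forall c : {ffun 'I_n -> option rat},
    let B' (i : 'I_n) := if (i < k)%N then B i else ray (c i) in
    fine (Q n (sample x n w) (rect B')) = \prod_(i < n) fine (kappa (x i w) (B' i)).
  have := H n (leqnn n) [ffun=> None].
  have -> : (fun i : 'I_n => if (i < n)%N then B i else ray ([ffun=> None] i)) = B.
    by apply/funext => i; rewrite ltn_ord.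
  by move=> ->.
elim: k => [_ c|k IH kn c B'].
  exact: h.
pose k' := Ordinal kn.
pose Bk (D : set R) (i : 'I_n) := if i == k' then D else B' i.
have mB' i : measurable (B' i).
  by rewrite /B'; case: ifP => // _; exact: measurable_ray.
have mBk D i : measurable D -> measurable (Bk D i).
  by rewrite /Bk; case: ifP.
have BkE : B' = Bk (B k').
  apply/funext => i; rewrite /Bk /B'; case: eqP => // ->.
  by rewrite /= ltnSn.
pose Qw := kprob (Q n) (sample x n w).
have mET : measurable (rect (Bk setT)) by apply: measurable_rect => i; exact: mBk.
(* With all sides but [k'] frozen, the two members of the identity are finite measures in the
   remaining side, and they agree on rays by induction. *)
pose m1 := image_measure (mrestr Qw mET) (@measurable_tnth _ R n k').
pose c0 : R := \prod_(i | i != k') fine (kappa (x i w) (B' i)).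
have c00 : 0 <= c0.
  by apply: prodr_ge0 => i _; exact: fine_ge0.
pose m2 : {measure set R -> \bar R} := mscale (NngNum c00) (kprob kappa (x k' w)).
have m1E D : measurable D -> m1 D = (fine (Q n (sample x n w) (rect (Bk D))))%:E.
  move=> mD; rewrite kernel_fineK; last by apply: measurable_rect => i; exact: mBk.
  rewrite /m1 /= /pushforward /mrestr /= /Qw /kprob; congr (Q n _ _).
  apply/seteqP; split => u /=.
    by move=> [uD h'] i; rewrite /Bk; case: eqP => [->//|/eqP ik];
      have := h' i; rewrite /Bk (negbTE ik).
  move=> h'; split; first by have := h' k'; rewrite /Bk eqxx.
  by move=> i; have := h' i; rewrite /Bk; case: eqP.
have m2E D : measurable D -> m2 D = (\prod_(i < n) fine (kappa (x i w) (Bk D i)))%:E.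
  move=> mD; rewrite /m2 /= /mscale /= (bigD1 k')//= /Bk eqxx mulrC EFinM kernel_fineK//.
  congr (_%:E * _)%E; apply: eq_bigr => i ik; by rewrite (negbTE ik).
apply: EFin_inj; have -> : (\prod_(i < n) fine (kappa (x i w) (B' i))) =
    \prod_(i < n) fine (kappa (x i w) (Bk (B k') i)) by rewrite -BkE.
rewrite -m2E// [in LHS]BkE -m1E//; apply: ray_measure_eq => //.
  by rewrite m1E// ltry.
move=> r; have mr : measurable (ray r : set R) := measurable_ray r.
rewrite m1E// m2E//; congr (_%:E).
have := IH (ltnW kn) [ffun i => if i == k' then r else c i].
have -> : (fun i : 'I_n => if (i < k)%N then B i
    else ray ([ffun i => if i == k' then r else c i] i)) = Bk (ray r).
  apply/funext => i; rewrite ffunE /Bk /B'; case: eqP => [->|/eqP ik].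
    by rewrite /= ltnn.
  rewrite ltnS [(i <= k)%N]leq_eqVlt; case: eqP => [ik'|//].
  by exfalso; move/eqP: ik; apply; apply: val_inj.
by move=> ->.
Qed.

End product_of_conditional_laws.

Section tuple_coordinates.
Context (R : realType) (n : nat) (q : probability (n.-tuple R) R)
  (m : 'I_n -> probability R R).
Hypothesis qE : forall B : 'I_n -> set R, (forall i, measurable (B i)) ->
  fine (q (rect B)) = \prod_i fine (m i (B i)).

Lemma coordinate_law i B : measurable B -> q ((@tnth n R ^~ i) @^-1` B) = m i B.
Proof.
move=> mB; pose B' j := if j == i then B else setT.
have mB' j : measurable (B' j) by rewrite /B'; case: ifP.
have -> : (@tnth n R ^~ i) @^-1` B = rect B'.
  apply/seteqP; split => u /=.
    by move=> uB j; rewrite /B'; case: eqP => // ->.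
  by move=> h; have := h i; rewrite /B' eqxx.
rewrite -[LHS]fineK; last by rewrite fin_num_measure//; exact: measurable_rect.
rewrite qE// (bigD1 i)//= big1 ?mulr1; last first.
  by move=> j ji; rewrite /B' (negbTE ji) probability_setT.
by rewrite /B' eqxx fineK// fin_num_measure.
Qed.

Lemma coordinates_mutually_independent :
  mutually_independent q (fun i : 'I_n => @tnth n R ^~ i).
Proof.
move=> s B us mB.
pose B' j := if j \in s then B j else setT.
have mB' j : measurable (B' j) by rewrite /B'; case: ifP.
have -> : [set w : n.-tuple R | forall i, i \in s -> B i (tnth w i)] = rect B'.
  apply/seteqP; split => u /=.
    by move=> h j; rewrite /B'; case: ifP => // js; exact: h.
  by move=> h j js; have := h j; rewrite /B' js.
rewrite -[LHS]fineK; last by rewrite fin_num_measure//; exact: measurable_rect.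
rewrite qE// (bigID (mem s)) /= [X in _ * X]big1 ?mulr1; last first.
  by move=> j js; rewrite /B' (negbTE js) probability_setT.
rewrite -big_uniq//= -prodEFin; apply: eq_big_seq => j js.
rewrite coordinate_law// fineK ?fin_num_measure// /B' js//.
Qed.

End tuple_coordinates.

(** * Almost sure bounds on averages *)

Section real_sequences.
Context {R : realType}.
Implicit Types a V : nat -> R.

Definition tends0 a := forall e : R, 0 < e -> exists N, forall n, (N <= n)%N -> `|a n| <= e.

Lemma sum_nonneg_le a m n : (forall k, 0 <= a k) -> (m <= n)%N ->
  \sum_(k < m) a k <= \sum_(k < n) a k.
Proof.
move=> a0 mn; rewrite -(subnKC mn) big_split_ord /= lerDl.
by apply: sumr_ge0 => k _; exact: a0.
Qed.

(* Bounded partial sums of nonnegative terms have a supremum, which bounds the tails. *)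
Lemma bounded_sums_tail a (M : R) : (forall k, 0 <= a k) ->
  (forall n, \sum_(k < n) a k <= M) ->
  forall e, 0 < e -> exists N, forall n, (N <= n)%N ->
    \sum_(k < n) a k - \sum_(k < N) a k <= e.
Proof.
move=> a0 aM e e0; pose S := [set \sum_(k < n) a k | n in [set: nat]].
have hS : has_sup S.
  split; first by exists (\sum_(k < 0) a k); exists 0%N.
  by exists M => _ [n _ <-].
have [_ [N _ <-] hN] := sup_adherent e0 hS.
exists N => n Nn.
have : \sum_(k < n) a k <= sup S by apply: ub_le_sup; [exact: hS.2|exists n].
by lra.
Qed.

Lemma bounded_sums_tends0 a (M : R) : (forall k, 0 <= a k) ->
  (forall n, \sum_(k < n) a k <= M) -> tends0 a.
Proof.
move=> a0 aM e e0; have [N hN] := bounded_sums_tail a0 aM e0.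
exists N => n Nn; rewrite ger0_norm//.
have := hN n.+1 (leqW Nn); rewrite big_ord_recr /=.
by have := sum_nonneg_le a0 Nn; lra.
Qed.

Lemma archi_large (c e : R) : 0 < e -> exists N, forall n, (N <= n)%N -> (0 < n)%N ->
  c / n%:R <= e.
Proof.
move=> e0; exists (Num.bound (c / e)) => n Nn n0.
rewrite ler_pdivrMr ?ltr0n// mulrC -ler_pdivrMr//.
have [ce0|ce0] := lerP (c / e) 0; first exact: le_trans ce0 (ler0n _ _).
apply: le_trans (ltW (archi_boundP (ltW ce0))) _.
by rewrite ler_nat.
Qed.

(* Telescoping: [min(1, r^2/c^2) <= 6 (r^2/(r+c) - r^2/(r+c+1))] for [c >= 1]. *)
Lemma sum_min_sq_le (r : R) n : 0 <= r ->
  \sum_(i < n) Num.min 1 (r ^+ 2 / i.+1%:R ^+ 2) <= 6 * r.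
Proof.
move=> r0; have [->|rp] := eqVneq r 0.
  rewrite big1 ?mulr0// => i _; rewrite expr0n /= mul0r.
  by apply/min_idPr.
have {}rp : 0 < r by rewrite lt_def rp.
have step (c : R) : 1 <= c ->
    Num.min 1 (r ^+ 2 / c ^+ 2) <= 6 * (r ^+ 2 / (r + c) - r ^+ 2 / (r + (c + 1))).
  move=> c1; have c0 : 0 < c by lra.
  have -> : 6 * (r ^+ 2 / (r + c) - r ^+ 2 / (r + (c + 1))) =
      6 * r ^+ 2 / ((r + c) * (r + (c + 1))).
    by field; apply/andP; split; rewrite gt_eqF//; lra.
  have d0 : 0 < (r + c) * (r + (c + 1)) by apply: mulr_gt0; lra.
  rewrite ler_pdivlMr//.
  (* Since [1 <= c], the product of the two denominators is at most [(2 r) (3 r)] or [(2 c) (3 c)];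
     hence the constant 6. *)
  have [cr|rc] := lerP c r.
    have : (r + c) * (r + (c + 1)) <= 6 * r ^+ 2 by nra.
    move=> h; apply: le_trans _ h; rewrite ler_piMl ?(ltW d0)// ge_min lexx//.
  apply: (@le_trans _ _ (r ^+ 2 / c ^+ 2 * ((r + c) * (r + (c + 1))))).
    by rewrite ler_wpM2r ?(ltW d0)// ge_min lexx orbT.
  rewrite mulrAC ler_pdivrMr ?exprn_gt0//.
  have h : (r + c) * (r + (c + 1)) <= 6 * c ^+ 2 by nra.
  by have := ler_wpM2l (sqr_ge0 r) h; rewrite [leRHS]mulrCA [leRHS]mulrA.
suff H : \sum_(i < n) Num.min 1 (r ^+ 2 / i.+1%:R ^+ 2) <=
    6 * (r ^+ 2 / (r + 1) - r ^+ 2 / (r + n.+1%:R)).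
  apply: le_trans H _; rewrite ler_pM2l//.
  have h1 : 0 <= r ^+ 2 / (r + n.+1%:R).
    by rewrite divr_ge0 ?exprn_ge0 ?addr_ge0.
  have h2 : r ^+ 2 / (r + 1) <= r by rewrite ler_pdivrMr ?ltr_wpDl//; nra.
  by lra.
elim: n => [|n IH]; first by rewrite big_ord0 subrr mulr0.
rewrite big_ord_recr /=; have := step n.+1%:R; rewrite ler1n => /(_ isT).
by rewrite natr1; lra.
Qed.

(** The minima are summable, so eventually they equal the quotients [y i / (i + 1)^2]. For [i < n]
    each [y i] is then at most [n^2] times a term of a convergent series, and the finitely many
    early terms vanish after division by [n^2]. *)
Lemma kronecker_sq (y : nat -> R) (M : R) : (forall k, 0 <= y k) ->
  (forall n, \sum_(i < n) Num.min 1 (y i / i.+1%:R ^+ 2) <= M) ->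
  tends0 (fun n => (\sum_(i < n) y i) / n%:R ^+ 2).
Proof.
move=> y0 yM e e0; pose a i := Num.min 1 (y i / i.+1%:R ^+ 2).
have a0 k : 0 <= a k by rewrite le_min ler01 divr_ge0// exprn_ge0.
have e2 : 0 < e / 2 by rewrite divr_gt0.
(* Once the minimum is at most 1/2 it is the quotient and not the constant 1. *)
have h12 : 0 < (1 / 2 : R) by rewrite divr_gt0.
have [N1 hN1] := bounded_sums_tends0 a0 yM h12.
have [N2 hN2] := bounded_sums_tail a0 yM e2.
pose N := maxn N1 N2; pose C := \sum_(i < N) y i.
have C0 : 0 <= C by exact: sumr_ge0.
have [N3 hN3] := archi_large C e2.
exists (maxn N.+1 N3) => n; rewrite geq_max => /andP[Nn N3n].
have n0 : (0 < n)%N by exact: leq_ltn_trans Nn.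
have nR0 : 0 < (n%:R : R) by rewrite ltr0n.
have n2 : 0 < (n%:R : R) ^+ 2 by rewrite exprn_gt0.
rewrite ger0_norm; last by apply: divr_ge0; [exact: sumr_ge0|exact: ltW].
have tail : \sum_(i < n) y i <= C + n%:R ^+ 2 * (e / 2).
  rewrite -(subnKC (ltnW Nn)) big_split_ord /= lerD2l.
  apply: (@le_trans _ _ (\sum_(i < n - N) n%:R ^+ 2 * a (N + i)%N)).
    apply: ler_sum => i _; set k := (N + i)%N.
    have kn : (k < n)%N by rewrite /k -ltn_subRL.
    have k1 : 0 < (k.+1%:R : R) ^+ 2 by rewrite exprn_gt0// ltr0n.
    have N1k : (N1 <= k)%N by rewrite (leq_trans (leq_maxl N1 N2))// leq_addr.
    have := hN1 k N1k; rewrite ger0_norm// => ak.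
    have akE : a k = y k / k.+1%:R ^+ 2.
      rewrite /a; apply/min_idPr; move: ak; rewrite /a ge_min; case/orP => [|ak].
        by move=> ?; exfalso; lra.
      by apply: le_trans ak _; lra.
    rewrite akE mulrA -mulrAC -[leLHS]mul1r ler_wpM2r// ler_pdivlMr// mul1r.
    by rewrite lerXn2r ?nnegrE// ler_nat.
  rewrite -mulr_sumr (subnKC (ltnW Nn)); apply: ler_wpM2l; first exact: ltW.
  have N2N : (N2 <= N)%N by rewrite leq_maxr.
  have := hN2 n (leq_trans N2N (ltnW Nn)).
  have sp p : \sum_(k < N + p) a k = \sum_(k < N) a k + \sum_(k < p) a (N + k)%N.
    by rewrite big_split_ord.
  have := sp (n - N)%N; rewrite (subnKC (ltnW Nn)) => ->.
  by have := sum_nonneg_le a0 N2N; rewrite /a; lra.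
rewrite ler_pdivrMr//; apply: le_trans tail _.
have CE : C <= n%:R ^+ 2 * (e / 2).
  have := hN3 n N3n n0; rewrite ler_pdivrMr// => h; apply: le_trans h _.
  rewrite mulrC ler_wpM2r ?(ltW e2)// expr2.
  by have : 1 <= (n%:R : R) by [rewrite ler1n]; nra.
by lra.
Qed.

(** Telescoping with [h k = min(1 / c^2, 4^-k)]: when [c <= 2^k], the difference [h k - h (k + 1)]
    is three quarters of [4^-k]. *)
Lemma geometric_tail (c : R) m : 1 <= c ->
  \sum_(k < m) (if c <= 2 ^+ k then (4 ^+ k)^-1 else 0) <= 2 / c ^+ 2.
Proof.
move=> c1; have c2 : 0 < c ^+ 2 by rewrite exprn_gt0//; lra.
pose h k : R := Num.min (c ^+ 2)^-1 (4 ^+ k)^-1.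
have p4 k : 0 < (4 ^+ k : R) by rewrite exprn_gt0.
have four k : (2 ^+ k) ^+ 2 = 4 ^+ k :> R by rewrite -exprM mulnC exprM -natrX.
have step k : (if c <= 2 ^+ k then (4 ^+ k)^-1 else 0) <= 2 * (h k - h k.+1).
  have hS : (4 ^+ k.+1)^-1 = (4 ^+ k)^-1 / 4 :> R.
    by rewrite exprS invfM mulrC.
  case: ifPn => [ck|_].
    have h1 : (4 ^+ k)^-1 <= (c ^+ 2)^-1.
      by rewrite lef_pV2 ?posrE// -four lerXn2r ?nnegrE ?exprn_ge0//; lra.
    have h0 : 0 < (4 ^+ k : R)^-1 by rewrite invr_gt0.
    rewrite /h (min_idPr h1) hS.
    have -> : Num.min (c ^+ 2)^-1 ((4 ^+ k)^-1 / 4) = (4 ^+ k)^-1 / 4 by apply/min_idPr; lra.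
    by lra.
  rewrite mulr_ge0// subr_ge0 le_min /h hS.
  have h0 : 0 < (4 ^+ k : R)^-1 by rewrite invr_gt0.
  by rewrite ge_min lexx /= ge_min; apply/orP; right; lra.
have : \sum_(k < m) (if c <= 2 ^+ k then (4 ^+ k)^-1 else 0) <= 2 * (h 0%N - h m).
  elim: m => [|m IH]; first by rewrite big_ord0 subrr mulr0.
  by rewrite big_ord_recr /=; apply: le_trans (lerD IH (step m)) _; lra.
have : h 0%N <= (c ^+ 2)^-1 by rewrite ge_min lexx.
have : 0 <= h m by rewrite le_min !invr_ge0 !ltW.
by lra.
Qed.

End real_sequences.

Section almost_sure_bounds.
Context d (T : measurableType d) (R : realType) (P : probability T R).

(** The sum of the series has finite mean by monotone convergence, hence is finite almost surely. *)
Lemma ae_bounded_sums (V : nat -> T -> R) C : (forall k w, 0 <= V k w) ->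
  (forall k, rint P (V k)) -> (forall m, \sum_(k < m) \int[P]_w V k w <= C) ->
  {ae P, forall w, exists M, forall m, \sum_(k < m) V k w <= M}.
Proof.
move=> V0 iV VC.
have mV k : measurable_fun setT (EFin \o V k).
  by apply/measurable_EFinP; exact: rint_measurable (iV k).
pose f w := (\sum_(0 <= k <oo) (V k w)%:E)%E.
have V0e k w : (0 <= (V k w)%:E)%E by rewrite lee_fin.
have f0 w : (0 <= f w)%E by apply: nneseries_ge0.
have fi : P.-integrable setT f.
  apply/integrableP; split.
    have : measurable_fun setT (fun x => (\sum_(i <oo | i \in xpredT) (V i x)%:E)%E).
      by apply: ge0_emeasurable_sum => [k w _ _|k _]; [exact: V0e|exact: mV].
    by apply.
  under eq_integral do rewrite gee0_abs//.
  rewrite integral_nneseries//.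
  apply: (@le_lt_trans _ _ C%:E); last exact: ltry.
  apply: lime_le.
    by apply: is_cvg_nneseries => k _ _; apply: integral_ge0.
  apply: nearW => m; rewrite big_mkord.
  under eq_bigr do rewrite -ExpE//.
  by rewrite sumEFin lee_fin.
have := integrable_ae measurableT fi; apply: filterS => w /(_ I) fw.
exists (fine (f w)) => m.
rewrite -lee_fin fineK// -sumEFin.
have := @nneseries_lim_ge R (fun k => (V k w)%:E) xpredT 0%N m.
by rewrite big_mkord; apply => k _ _.
Qed.

End almost_sure_bounds.

Section prescribed_law.
Context d d' (Om : measurableType d) (V : measurableType d') (R : realType).
Variables (Q : probability Om R) (m : probability V R) (Y : Om -> V).
Hypotheses (mY : measurable_fun setT Y)
  (YE : forall B, measurable B -> Q (Y @^-1` B) = m B).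

Lemma rint_prescribed_law (f : V -> R) : measurable_fun setT f -> rint m f -> rint Q (f \o Y).
Proof.
move=> mf /integrableP[_ fl]; apply/integrableP; split.
  by apply/measurable_EFinP; exact: measurableT_comp.
apply: le_lt_trans fl.
have H := @ge0_integral_pushforward _ _ _ _ _ Y mY Q setT (fun v => `|(f v)%:E|%E) measurableT.
rewrite (_ : (\int[Q]_x `|(EFin \o (f \o Y)) x|)%E =
  (\int[pushforward Q Y]_v `|(f v)%:E|)%E); last first.
  symmetry; apply: H; last by move=> v _; exact: abse_ge0.
  by apply: measurableT_comp => //; exact/measurable_EFinP.
rewrite le_eqVlt; apply/orP; left; apply/eqP; apply: eq_measure_integral => B mB _.
exact: YE.
Qed.

Lemma Exp_prescribed_law (f : V -> R) : measurable_fun setT f -> rint m f ->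
  \int[Q]_w f (Y w) = \int[m]_v f v.
Proof.
move=> mf fi; rewrite -(Exp_law mY mf (rint_prescribed_law mf fi)) /Rintegral; congr fine.
by apply: eq_measure_integral => B mB _; exact: YE.
Qed.

End prescribed_law.

Section identically_distributed_elements.
Context d d' (T : measurableType d) (V : measurableType d') (R : realType)
  (P : probability T R).
Variables (X X' : T -> V) (f : V -> R).
Hypotheses (mX : measurable_fun setT X) (mX' : measurable_fun setT X')
  (XX' : forall B, measurable B -> P (X @^-1` B) = P (X' @^-1` B))
  (mf : measurable_fun setT f) (fX : rint P (f \o X)).

Let X'E B : measurable B -> P (X' @^-1` B) = law P mX B.
Proof. by move=> mB; rewrite -XX'. Qed.

Lemma rint_same_law : rint P (f \o X').
Proof. exact: (rint_prescribed_law mX' X'E mf (rint_law mX mf fX)). Qed.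

Lemma Exp_same_law : \int[P]_w f (X' w) = \int[P]_w f (X w).
Proof.
by rewrite (Exp_prescribed_law mX' X'E mf (rint_law mX mf fX)) (Exp_law mX mf fX).
Qed.

End identically_distributed_elements.

(** * Laws of large numbers along powers of 2 *)

Section dyadic_law_of_large_numbers.
Context d (T : measurableType d) (R : realType) (P : probability T R).

(* Chebyshev's inequality along [2^k]: the variances of the dyadic averages are summable. *)
Lemma lln_dyadic (U : nat -> T -> R) (C : R) :
  (forall i, measurable_fun setT (U i)) -> (forall i, rint P (fun w => U i w ^+ 2)) ->
  (forall i j, i != j -> indep2 P (U i) (U j)) ->
  (forall n, \sum_(i < n) (\int[P]_w (U i w ^+ 2)) / i.+1%:R ^+ 2 <= C) ->
  {ae P, forall w,
    tends0 (fun k => (\sum_(i < 2 ^ k) (U i w - \int[P]_w (U i w))) / (2 ^ k)%:R)}.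
Proof.
move=> mU U2 indU UC.
have U1 i : rint P (U i).
  apply: (rint_dominated (mU i) (rintD (rint_cst P 1) (U2 i))) => w.
  by rewrite -[U i w ^+ 2]real_normK ?num_real//; nra.
pose c i := \int[P]_w (U i w).
pose Y i w := U i w - c i.
have mY i : measurable_fun setT (Y i) by apply: measurable_funB.
have Y1 i : rint P (Y i) by apply: rintB (U1 i) (rint_cst P _).
have YE i : (fun w => Y i w ^+ 2) = fun w => U i w ^+ 2 - (2 * c i) * U i w + c i ^+ 2.
  by apply: funext => w; rewrite /Y; ring.
have Y2 i : rint P (fun w => Y i w ^+ 2).
  by rewrite YE; apply: rintD (rintB (U2 i) (rintZ _ (U1 i))) (rint_cst P _).
have EY i : \int[P]_w Y i w = 0.
  by rewrite /Y ExpB//; [rewrite Exp_cst subrr|exact: rint_cst].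
have EY2 i : \int[P]_w (Y i w ^+ 2) <= \int[P]_w (U i w ^+ 2).
  rewrite YE ExpD; [|exact: rintB (U2 i) (rintZ _ (U1 i))|exact: rint_cst].
  rewrite ExpB//; last exact: rintZ.
  by rewrite ExpZ// Exp_cst -/(c i); nra.
have orth (i j : nat) : i != j -> \int[P]_w (Y i w * Y j w) = 0.
  move=> ij; have mB (e : R) : measurable_fun setT (fun u : R => u - e).
    by apply: measurable_funB.
  have := indep2_comp (mB (c i)) (mB (c j)) (indU i j ij).
  by case/(indep2_ExpM (Y1 i) (Y1 j)) => _ ->; rewrite EY mul0r.
pose S k w := (\sum_(i < 2 ^ k) Y i w) / (2 ^ k)%:R.
have iotaE n (F : nat -> R) : \sum_(i <- iota 0 n) F i = \sum_(i < n) F i.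
  by rewrite -(big_mkord xpredT F) /index_iota subn0.
have SS k : rint P (fun w => S k w ^+ 2) /\
    \int[P]_w (S k w ^+ 2) = (4 ^ k)%:R^-1 * \sum_(i < 2 ^ k) \int[P]_w (Y i w ^+ 2).
  have [] := @Exp_sqr_sum _ _ _ P nat (iota 0 (2 ^ k)) Y (iota_uniq _ _) mY Y2 orth.
  have E w : S k w ^+ 2 = (4 ^ k)%:R^-1 * (\sum_(i <- iota 0 (2 ^ k)) Y i w) ^+ 2.
    rewrite /S iotaE expr_div_n mulrC.
    by rewrite -natrX -expnM mulnC expnM.
  move=> i1 i2; have -> : (fun w => S k w ^+ 2) =
      fun w => (4 ^ k)%:R^-1 * (\sum_(i <- iota 0 (2 ^ k)) Y i w) ^+ 2 by apply: funext.
  split; first exact: rintZ.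
  by rewrite ExpZ// i2 iotaE.
(* After interchanging the sums, term [i] enters the averages with [2^k >= i + 1], whose weights
   [4^-k] add up to at most [2 / (i + 1)^2]. *)
have SC m : \sum_(k < m) \int[P]_w (S k w ^+ 2) <= 2 * C.
  pose v i := \int[P]_w (Y i w ^+ 2).
  have v0 i : 0 <= v i by apply: Exp_ge0 => w; exact: sqr_ge0.
  have E1 (k : 'I_m) : \int[P]_w (S k w ^+ 2) =
      \sum_(i < 2 ^ m) (if i.+1%:R <= 2 ^+ k :> R then (4 ^+ k)^-1 else 0) * v i.
    have km : (2 ^ k <= 2 ^ m)%N by rewrite leq_exp2l// ltnW.
    rewrite (SS k).2 mulr_sumr (big_ord_widen _ (fun i => (4 ^ k)%:R^-1 * v i) km).
    rewrite big_mkcond; apply: eq_bigr => i _.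
    by rewrite -natrX ler_nat -natrX; case: ifP => // _; rewrite mul0r.
  rewrite (eq_bigr _ (fun k _ => E1 k)) exchange_big /=.
  apply: (@le_trans _ _ (\sum_(i < 2 ^ m) 2 / i.+1%:R ^+ 2 * v i)).
    apply: ler_sum => i _; rewrite -mulr_suml ler_wpM2r// geometric_tail//.
    by rewrite ler1n.
  rewrite -[leRHS]/(2 * C); apply: le_trans (ler_wpM2l _ (UC (2 ^ m)%N)) => //.
  rewrite mulr_sumr; apply: ler_sum => i _.
  rewrite -mulrA ler_pM2l// mulrC ler_wpM2r//; exact: EY2.
have S2 k w : 0 <= S k w ^+ 2 by exact: sqr_ge0.
have := ae_bounded_sums S2 (fun k => (SS k).1) SC.
apply: filterS => w [M hM] e e0.
have e2 : 0 < e ^+ 2 by rewrite exprn_gt0.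
have [N hN] := bounded_sums_tends0 (fun k => S2 k w) hM e2.
exists N => n /hN; rewrite ger0_norm// => h.
by rewrite -(@ler_pXn2r _ 2)// ?nnegrE// ?(ltW e0)// real_normK ?num_real.
Qed.

End dyadic_law_of_large_numbers.

Section sample_averages.
Context d d' (T : measurableType d) (V : measurableType d') (R : realType)
  (P : probability T R) (X : nat -> T -> V).
Hypotheses (mX : forall i, measurable_fun setT (X i))
  (indX : mutually_independent P X) (idX : identically_distributed P X).

Let comp_indep2 (f g : V -> R) i j : measurable_fun setT f -> measurable_fun setT g ->
  i != j -> indep2 P (f \o X i) (g \o X j).
Proof.
move=> mf mg ij; apply: indep2_comp => //.
exact: mutually_independent_indep2.
Qed.

Lemma bounded_average_dyadic (f : V -> R) : measurable_fun setT f ->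
  (forall v, `|f v| <= 1) ->
  {ae P, forall w,
    tends0 (fun k => (\sum_(i < 2 ^ k) f (X i w)) / (2 ^ k)%:R - \int[P]_w f (X 0%N w))}.
Proof.
move=> mf f1; pose U i w := f (X i w).
have mU i : measurable_fun setT (U i) by apply: measurableT_comp.
have U2le i w : U i w ^+ 2 <= 1.
  rewrite -[U i w ^+ 2]real_normK ?num_real//.
  by have := f1 (X i w); have := normr_ge0 (U i w); rewrite /U; nra.
have U2 i : rint P (fun w => U i w ^+ 2).
  apply: (@rint_bounded _ _ _ _ _ 1); first exact: measurable_funX.
  by move=> w; rewrite ger0_norm ?sqr_ge0.
(* The sum of [1 / (i + 1)^2] is bounded through [sum_min_sq_le] at [r = 1]. *)
have UC n : \sum_(i < n) (\int[P]_w (U i w ^+ 2)) / i.+1%:R ^+ 2 <= 6 * 1.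
  apply: le_trans _ (@sum_min_sq_le R 1 n ler01); apply: ler_sum => i _.
  rewrite expr1n; have i1 : 1 <= (i.+1%:R : R) by rewrite ler1n.
  have i2 : 0 < (i.+1%:R : R) ^+ 2 by rewrite exprn_gt0.
  have h : \int[P]_w (U i w ^+ 2) <= 1.
    by have := Exp_le (U2 i) (rint_cst P 1) (U2le i); rewrite Exp_cst.
  rewrite (min_idPr _); first by rewrite ler_wpM2r// invr_ge0 ltW.
  by rewrite ler_pdivrMr// mul1r; nra.
have := lln_dyadic mU U2 (fun i j ij => comp_indep2 mf mf ij) UC.
apply: filterS => w h e /h[N hN]; exists N => n /hN.
suff -> : (\sum_(i < 2 ^ n) (U i w - \int[P]_w U i w)) / (2 ^ n)%:R =
  (\sum_(i < 2 ^ n) f (X i w)) / (2 ^ n)%:R - \int[P]_w f (X 0%N w) by [].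
have E i : \int[P]_w U i w = \int[P]_w f (X 0%N w).
  apply: (Exp_same_law (mX 0%N) (mX i) (@idX 0%N i)) => //.
  apply: (@rint_bounded _ _ _ _ _ 1); first exact: measurableT_comp.
  by move=> t; exact: f1.
under eq_bigr do rewrite E.
rewrite sumrB sumr_const card_ord mulrBl -[X in _ - X / _]mulr_natr mulfK//.
Qed.

Variable g : V -> R.
Hypotheses (mg : measurable_fun setT g) (g0 : forall v, 0 <= g v)
  (ig : rint P (g \o X 0%N)).

Let r := \int[P]_w g (X 0%N w).
Let r0 : 0 <= r. Proof. exact: Exp_ge0. Qed.
(** Only [E g] is finite. By [sum_min_sq_le] the truncated squares along the sample still have total
    mean at most [6 r]; the almost sure convergence of their sum drives both lemmas below. *)
Let h i v := Num.min 1 (g v ^+ 2 / i.+1%:R ^+ 2).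
Let mh i : measurable_fun setT (h i).
Proof.
apply: measurable_minr => //.
by apply: measurable_funM => //; exact: measurable_funX.
Qed.
Let h0 i v : 0 <= h i v.
Proof. by rewrite le_min ler01 divr_ge0// ?sqr_ge0// exprn_ge0. Qed.
Let h1 i v : `|h i v| <= 1.
Proof. by rewrite ger0_norm// ge_min lexx. Qed.
Let rint_h i j : rint P (fun w => h i (X j w)).
Proof.
apply: (@rint_bounded _ _ _ _ _ 1); first exact: measurableT_comp.
by move=> w; exact: h1.
Qed.
Let Exp_h n : \sum_(i < n) \int[P]_w h i (X i w) <= 6 * r.
Proof.
have E i : \int[P]_w h i (X i w) = \int[P]_w h i (X 0%N w).
  by apply: (Exp_same_law (mX 0%N) (mX i) (@idX 0%N i) (mh i)); exact: rint_h.
under eq_bigr do rewrite E.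
rewrite -(big_mkord xpredT (fun i => \int[P]_w h i (X 0%N w))).
rewrite -(@Exp_sum _ _ _ P nat _ (fun i w => h i (X 0%N w)))//.
rewrite -ExpZ//; apply: Exp_le.
- exact: rint_sum.
- exact: rintZ.
- by move=> w; rewrite big_mkord; exact: sum_min_sq_le.
Qed.

Let ae_h : {ae P, forall w, exists M, forall n, \sum_(i < n) h i (X i w) <= M}.
Proof. exact: (ae_bounded_sums (fun i w => h0 i (X i w)) (fun i => rint_h i i) Exp_h). Qed.

Lemma ae_sum_sqr_negligible :
  {ae P, forall w, tends0 (fun n => (\sum_(i < n) g (X i w) ^+ 2) / n%:R ^+ 2)}.
Proof.
apply: filterS ae_h => w [M hM].
exact: (@kronecker_sq R (fun i => g (X i w) ^+ 2) M (fun k => sqr_ge0 _) hM).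
Qed.

(* Truncation at level [i + 1] makes the dyadic law of large numbers applicable; the truncation
   is eventually void. *)
Lemma ae_sum_linear :
  {ae P, forall w, exists C, exists N, forall n, (N <= n)%N ->
     \sum_(i < n) g (X i w) <= C * n%:R}.
Proof.
pose u i v := if g v <= i.+1%:R then g v else 0.
have mu i : measurable_fun setT (u i).
  by apply: measurable_fun_ifT => //; apply: measurable_fun_ler.
have u0 i v : 0 <= u i v by rewrite /u; case: ifP.
have ug i v : u i v <= g v by rewrite /u; case: ifP.
have ui i v : u i v <= i.+1%:R by rewrite /u; case: ifP.
have uh i v : u i v ^+ 2 / i.+1%:R ^+ 2 <= h i v.
  have i2 : 0 < (i.+1%:R : R) ^+ 2 by rewrite exprn_gt0// ltr0n.
  rewrite /h le_min; apply/andP; split.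
    by rewrite ler_pdivrMr// mul1r lerXn2r ?nnegrE.
  by rewrite ler_pM2r ?invr_gt0// lerXn2r ?nnegrE.
pose U i w := u i (X i w).
have mU i : measurable_fun setT (U i) by apply: measurableT_comp.
have U2 i : rint P (fun w => U i w ^+ 2).
  apply: (@rint_bounded _ _ _ _ _ (i.+1%:R ^+ 2)); first exact: measurable_funX.
  move=> w; rewrite ger0_norm ?sqr_ge0// lerXn2r ?nnegrE//; [exact: u0|exact: ui].
have UC n : \sum_(i < n) (\int[P]_w (U i w ^+ 2)) / i.+1%:R ^+ 2 <= 6 * r.
  apply: le_trans _ (Exp_h n); apply: ler_sum => i _.
  rewrite mulrC -ExpZ//; apply: Exp_le; [exact: rintZ|exact: rint_h|].
  by move=> w; rewrite mulrC; exact: uh.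
have L := lln_dyadic mU U2 (fun i j ij => comp_indep2 (mu i) (mu j) ij) UC.
apply: filterS2 ae_h L => w [M hM] /(_ 1 ltr01)[N1 hN1].
(* From [N2] on [h] is at most 1/2, which excludes [g (X i w) > i + 1]: the truncation no longer
   acts. *)
have h12 : 0 < (1 / 2 : R) by rewrite divr_gt0.
have [N2 hN2] := bounded_sums_tends0 (fun k => h0 k (X k w)) hM h12.
pose A := \sum_(i < N2) g (X i w).
have A0 : 0 <= A by apply: sumr_ge0 => i _; exact: g0.
(* [A] pays for the first [N2] terms. The others are compared with the sum up to the next power of
   2, which is at most [2 n], where the truncated sum is at most [2^k (1 + r)]. *)
exists (A + 2 * (1 + r)), (maxn (maxn N2 (2 ^ N1)) 2) => n.
rewrite !geq_max -andbA => /and3P[N2n N1n n1].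
have nR : 1 <= (n%:R : R) by rewrite ler1n ltnW.
pose k := up_log 2 n.
have nk : (n <= 2 ^ k)%N by exact: up_logP.
have kn : (2 ^ k <= 2 * n)%N.
  have k0 : (0 < k)%N by rewrite up_log_gt0.
  by rewrite -(prednK k0) expnS leq_mul2l /= ltnW// up_log_gtn.
have N1k : (N1 <= k)%N by rewrite -(@leq_exp2l 2)// (leq_trans N1n).
have EU i : \int[P]_w U i w <= r.
  have gi := rint_same_law (mX 0%N) (mX i) (@idX 0%N i) mg ig.
  rewrite /r -(Exp_same_law (mX 0%N) (mX i) (@idX 0%N i) mg ig).
  apply: Exp_le => //; last by move=> t; exact: ug.
  apply: rint_dominated (mU i) gi _ => t; rewrite ger0_norm; last exact: u0.
  exact: ug.
have SU : \sum_(i < 2 ^ k) U i w <= (2 ^ k)%:R * (1 + r).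
  have := hN1 k N1k; have p2 : 0 < ((2 ^ k)%:R : R) by rewrite ltr0n expn_gt0.
  rewrite ler_norml ler_pdivrMr// mul1r sumrB => /andP[_].
  have : \sum_(i < 2 ^ k) \int[P]_w U i w <= \sum_(i < 2 ^ k) r by apply: ler_sum.
  rewrite sumr_const card_ord -[X in _ <= X -> _]mulr_natr.
  set a := \sum_(i < 2 ^ k) U i w; set b := \sum_(i < 2 ^ k) \int[P]_w U i w.
  by rewrite mulrDr mulr1 [r * _]mulrC; lra.
have gU : \sum_(i < n) g (X i w) <= A + \sum_(i < n) U i w.
  rewrite /A (big_ord_widen _ (fun i => g (X i w)) N2n) [X in _ <= X + _]big_mkcond -big_split /=.
  apply: ler_sum => i _; case: ifPn => iN2; first by rewrite lerDl; exact: u0.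
  rewrite add0r /U /u; case: ifPn => //; rewrite -ltNge => gi.
  have := hN2 i; rewrite leqNgt iN2 => /(_ isT); rewrite ger0_norm; last exact: h0.
  have i0 : 0 < (i.+1%:R : R) ^+ 2 by rewrite exprn_gt0.
  rewrite /h ge_min => /orP[|]; first by move=> ?; exfalso; lra.
  rewrite ler_pdivrMr// => ?; exfalso; move: gi i0.
  by have : 0 <= (i.+1%:R : R) by []; nra.
have : \sum_(i < n) U i w <= (2 ^ k)%:R * (1 + r).
  apply: le_trans SU; exact: (sum_nonneg_le (fun i => u0 i (X i w)) nk).
have : ((2 ^ k)%:R : R) <= 2 * n%:R by rewrite -natrM ler_nat.
move=> h2 hu; apply: le_trans gU _; rewrite mulrDl; apply: lerD.
  by rewrite ler_peMr.
apply: le_trans hu _; rewrite mulrAC; apply: ler_wpM2r => //.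
by have := r0; lra.
Qed.

End sample_averages.

(** * Conditional moments *)

Section fourth_moment.
Context (R : realType) (m : probability R R).
Hypothesis m4 : rint m (fun u => u ^+ 4).

Let mX k : measurable_fun setT (fun u : R => u ^+ k).
Proof. exact: measurable_funX. Qed.

Local Notation M4 := (\int[m]_u (u ^+ 4)).
Local Notation M2 := (\int[m]_u (u ^+ 2)).
Local Notation mean := (\int[m]_u u).

Lemma fourth_moment_rint2 : rint m (fun u => u ^+ 2).
Proof.
apply: (rint_dominated (mX 2) (rintD (rint_cst m 1) m4)) => u.
by rewrite ger0_norm ?sqr_ge0// (_ : u ^+ 4 = (u ^+ 2) ^+ 2) -?exprM//; nra.
Qed.

Lemma fourth_moment_rint1 : rint m (fun u => u).
Proof.
apply: (rint_dominated (mX 1) (rintD (rint_cst m 1) fourth_moment_rint2)) => u.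
by rewrite expr1 -[u ^+ 2]real_normK ?num_real//; nra.
Qed.

(* [E (u^2 - E u^2)^2 >= 0] *)
Lemma sqr_second_moment_le : M2 ^+ 2 <= M4.
Proof.
have := fourth_moment_rint2 => r2.
have : 0 <= \int[m]_u ((u ^+ 2 - M2) ^+ 2) by apply: Exp_ge0 => u; exact: sqr_ge0.
have -> : \int[m]_u ((u ^+ 2 - M2) ^+ 2) = \int[m]_u (u ^+ 4 - (2 * M2) * u ^+ 2 + M2 ^+ 2).
  by apply: eq_Rintegral => u _; ring.
rewrite ExpD; [|exact: rintB m4 (rintZ _ r2)|exact: rint_cst].
by rewrite ExpB//; [rewrite ExpZ// Exp_cst; lra|exact: rintZ].
Qed.

Lemma sqr_mean_le : mean ^+ 2 <= M2.
Proof.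
have := fourth_moment_rint2 => r2; have := fourth_moment_rint1 => r1.
have : 0 <= \int[m]_u ((u - mean) ^+ 2) by apply: Exp_ge0 => u; exact: sqr_ge0.
have -> : \int[m]_u ((u - mean) ^+ 2) = \int[m]_u (u ^+ 2 - (2 * mean) * u + mean ^+ 2).
  by apply: eq_Rintegral => u _; ring.
rewrite ExpD; [|exact: rintB r2 (rintZ _ r1)|exact: rint_cst].
by rewrite ExpB//; [rewrite ExpZ// Exp_cst; lra|exact: rintZ].
Qed.

Lemma variance_le : \int[m]_u ((u - mean) ^+ 2) <= M2.
Proof.
have := fourth_moment_rint2 => r2; have := fourth_moment_rint1 => r1.
have -> : \int[m]_u ((u - mean) ^+ 2) = \int[m]_u (u ^+ 2 - (2 * mean) * u + mean ^+ 2).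
  by apply: eq_Rintegral => u _; ring.
rewrite ExpD; [|exact: rintB r2 (rintZ _ r1)|exact: rint_cst].
rewrite ExpB//; last exact: rintZ.
by rewrite ExpZ// Exp_cst; nra.
Qed.

Lemma variance_ge0 : 0 <= \int[m]_u ((u - mean) ^+ 2).
Proof. by apply: Exp_ge0 => u; exact: sqr_ge0. Qed.

Lemma sqr_variance_le : (\int[m]_u ((u - mean) ^+ 2)) ^+ 2 <= M4.
Proof.
apply: le_trans sqr_second_moment_le; have := variance_le; have := variance_ge0.
by set a := \int[m]_u ((u - mean) ^+ 2) => *; nra.
Qed.

Lemma mean_fourth_le : mean ^+ 4 <= M4.
Proof.
apply: le_trans sqr_second_moment_le.
by rewrite (_ : 4 = 2 * 2)%N// exprM; have := sqr_mean_le; have := sqr_ge0 mean; nra.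
Qed.

Lemma fourth_le_centered (u b : R) : (u - b) ^+ 4 <= 8 * u ^+ 4 + 8 * b ^+ 4.
Proof.
have h : (u - b) ^+ 2 <= 2 * u ^+ 2 + 2 * b ^+ 2 by have := sqr_ge0 (u + b); lra.
have -> : (u - b) ^+ 4 = ((u - b) ^+ 2) ^+ 2 by rewrite -exprM.
have -> : u ^+ 4 = (u ^+ 2) ^+ 2 by rewrite -exprM.
have -> : b ^+ 4 = (b ^+ 2) ^+ 2 by rewrite -exprM.
have := sqr_ge0 (u - b); have := sqr_ge0 u; have := sqr_ge0 b.
set A := (u - b) ^+ 2 in h *; set B := u ^+ 2 in h *; set C := b ^+ 2 in h * => *.
have : A ^+ 2 <= (2 * B + 2 * C) ^+ 2 by rewrite lerXn2r ?nnegrE//; lra.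
by have := sqr_ge0 (B - C); lra.
Qed.

Lemma centered_fourth_rint b : rint m (fun u => (u - b) ^+ 4).
Proof.
have mb : measurable_fun setT (fun u : R => (u - b) ^+ 4).
  by apply: measurable_funX; apply: measurable_funB.
apply: (rint_dominated mb (rintD (rintZ 8 m4) (rint_cst m (8 * b ^+ 4)))) => u.
rewrite ger0_norm; first exact: fourth_le_centered.
by rewrite (_ : 4 = 2 * 2)%N// exprM sqr_ge0.
Qed.

Lemma centered_fourth_le : \int[m]_u ((u - mean) ^+ 4) <= 16 * M4.
Proof.
have H := Exp_le (centered_fourth_rint mean)
  (rintD (rintZ 8 m4) (rint_cst m (8 * mean ^+ 4))) (fun u => fourth_le_centered u mean).
apply: le_trans H _; rewrite ExpD; [|exact: rintZ|exact: rint_cst].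
by rewrite ExpZ// Exp_cst; have := mean_fourth_le; lra.
Qed.

Lemma Exp_centered : \int[m]_u (u - mean) = 0.
Proof.
by rewrite ExpB//; [rewrite Exp_cst subrr|exact: fourth_moment_rint1|exact: rint_cst].
Qed.

End fourth_moment.

Section conditional_integral.
Context d d1 d2 (T : measurableType d) (U : measurableType d1) (V : measurableType d2)
  (R : realType) (P : probability T R) (X : T -> U) (Y : T -> V) (k : R.-pker U ~> V).
Hypotheses (mX : measurable_fun setT X) (mY : measurable_fun setT Y).

(** The disintegration formula is read as a composition of kernels: a constant kernel of value [P]
    on [unit], followed by [k] at [X]. The dummy factor [unit] gives the second kernel the source
    that [integral_kcomp] expects. *)
Definition pullback_kernel (z : unit * T) : {measure set V -> \bar R} := k (X z.2).

Let measurable_pullback B : measurable B ->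
  measurable_fun [set: unit * T] (pullback_kernel ^~ B).
Proof.
move=> mB; apply: (measurableT_comp (measurable_kernel k B mB)).
by apply: measurableT_comp => //; exact: measurable_snd.
Qed.

HB.instance Definition _ := isKernel.Build _ _ _ _ R pullback_kernel measurable_pullback.

Let pullback_prob z : pullback_kernel z setT = 1%E.
Proof. exact: prob_kernel. Qed.

HB.instance Definition _ := Kernel_isProbability.Build _ _ _ _ R pullback_kernel pullback_prob.

Definition constant_kernel (z : unit) : {measure set T -> \bar R} := P.

Let measurable_constant B : measurable B -> measurable_fun [set: unit] (constant_kernel ^~ B).
Proof. by move=> mB; exact: measurable_cst. Qed.

HB.instance Definition _ := isKernel.Build _ _ _ _ R constant_kernel measurable_constant.

Let constant_prob z : constant_kernel z setT = 1%E.
Proof. exact: probability_setT. Qed.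

HB.instance Definition _ := Kernel_isProbability.Build _ _ _ _ R constant_kernel constant_prob.

Lemma cond_distribution_integral (f : V -> \bar R) : cond_distribution P X Y k ->
  measurable_fun setT f -> (forall v, 0 <= f v)%E ->
  (\int[P]_w f (Y w) = \int[P]_w \int[k (X w)]_v f v)%E.
Proof.
move=> cd mf f0.
have <- := @integral_kcomp _ _ _ _ _ _ R constant_kernel pullback_kernel tt f f0 mf.
have H := @ge0_integral_pushforward _ _ _ _ _ Y mY P setT f measurableT mf (fun v _ => f0 v).
rewrite preimage_setT in H; rewrite -[LHS]H.
apply: eq_measure_integral => B mB _.
by have := cd setT B measurableT mB; rewrite preimage_setT setTI.
Qed.

Lemma measurable_cond_integral (f : U * V -> R) : measurable_fun setT f ->
  measurable_fun setT (fun u => \int[k u]_v f (u, v)).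
Proof.
move=> mf; have mF : measurable_fun setT (EFin \o f) by exact/measurable_EFinP.
rewrite /Rintegral; apply: (measurableT_comp (f := fine)) => //.
have -> : (fun u => \int[k u]_v (f (u, v))%:E)%E =
    (fun u => ((\int[k u]_v (EFin \o f)^\+ (u, v)) - (\int[k u]_v (EFin \o f)^\- (u, v))))%E.
  by apply: funext => u; rewrite integralE; congr (_ - _)%E; apply: eq_integral => v _;
    rewrite ?funeposE ?funenegE. 
have mp : measurable_fun setT (fun u => \int[k u]_v (EFin \o f)^\+ (u, v))%E.
  apply: (measurable_fun_integral_finite_kernel (EFin \o f)^\+%E k) => //.
  exact: measurable_funepos.
have mn : measurable_fun setT (fun u => \int[k u]_v (EFin \o f)^\- (u, v))%E.
  apply: (measurable_fun_integral_finite_kernel (EFin \o f)^\-%E k) => //.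
  exact: measurable_funeneg.
exact: emeasurable_funB mp mn.
Qed.

End conditional_integral.

Section conditional_moments.
Context d (T : measurableType d) (R : realType) (K : nat) (P : probability T R).
Variables (kappa : R.-pker (K.-tuple R) ~> R).

(** [cond_exp] is real-valued and reads an infinite integral as 0; [ae_rint4] excludes that case
    almost surely. *)
Definition moment4 (x : K.-tuple R) : R := cond_exp kappa x (fun u => u ^+ 4).

Lemma measurable_moment4 : measurable_fun setT moment4.
Proof.
apply: (@measurable_cond_integral _ _ _ _ _ kappa (fun z => z.2 ^+ 4)).
by apply: measurable_funX; exact: measurable_snd.
Qed.

Lemma measurable_cond_mean : measurable_fun setT (fun x => cond_exp kappa x id).
Proof.
by apply: (@measurable_cond_integral _ _ _ _ _ kappa (fun z => z.2)); exact: measurable_snd.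
Qed.

Lemma measurable_cond_var : measurable_fun setT (cond_var kappa).
Proof.
apply: (@measurable_cond_integral _ _ _ _ _ kappa (fun z => (z.2 - cond_exp kappa z.1 id) ^+ 2)).
apply: measurable_funX; apply: measurable_funB; first exact: measurable_snd.
by apply: measurableT_comp measurable_cond_mean _; exact: measurable_fst.
Qed.

Lemma moment4_ge0 x : 0 <= moment4 x.
Proof. by apply: Rintegral_ge0 => u _; rewrite (_ : 4 = 2 * 2)%N// exprM sqr_ge0. Qed.

Variables (x : {RV P >-> K.-tuple R}) (y : {RV P >-> R}).
Hypotheses (xy : cond_distribution P x y kappa)
  (y4 : ('E_P[(fun w => y w ^+ 4)%R] < +oo)%E).

Let u4 (u : R) : 0 <= u ^+ 4. Proof. by rewrite (_ : 4 = 2 * 2)%N// exprM sqr_ge0. Qed.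

Let E4 : (\int[P]_w \int[kappa (x w)]_u (u ^+ 4)%:E < +oo)%E.
Proof.
have := y4; rewrite unlock.
rewrite (@cond_distribution_integral _ _ _ _ _ _ R P x y kappa _ _ (fun u => (u ^+ 4)%:E) xy)//.
- by apply/measurable_EFinP; exact: measurable_funX.
Qed.

Let mE4 : measurable_fun setT (fun w => \int[kappa (x w)]_u (u ^+ 4)%:E)%E.
Proof.
apply: (measurableT_comp (f := fun v => \int[kappa v]_u (u ^+ 4)%:E)%E) => //.
apply: measurable_fun_integral_kernel => //.
- by move=> B mB; exact: measurable_kernel.
- by apply/measurable_EFinP; exact: measurable_funX.
Qed.

Let iE4 : P.-integrable setT (fun w => \int[kappa (x w)]_u (u ^+ 4)%:E)%E.
Proof.
have E0 w : (0 <= \int[kappa (x w)]_u (u ^+ 4)%:E)%E.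
  by apply: integral_ge0 => u _; rewrite lee_fin.
by apply/integrableP; split => //; under eq_integral do rewrite gee0_abs//.
Qed.

Lemma ae_rint4 : {ae P, forall w, rint (kprob kappa (x w)) (fun u => u ^+ 4)}.
Proof.
have := integrable_ae measurableT iE4; apply: filterS => w /(_ I) fw.
apply: rint_ge0; [exact: measurable_funX|exact: u4|].
by rewrite ltey_eq; apply/orP; left.
Qed.

Lemma rint_moment4 : rint P (fun w => moment4 (x w)).
Proof.
apply: rint_ge0; first by apply: measurableT_comp => //; exact: measurable_moment4.
  by move=> w; exact: moment4_ge0.
apply: le_lt_trans E4; apply: ge0_le_integral => //.
- by move=> w _; rewrite lee_fin moment4_ge0.
- by apply/measurable_EFinP/measurableT_comp => //; exact: measurable_moment4.
move=> w _; rewrite /moment4 /cond_exp /Rintegral.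
have : (0 <= \int[kappa (x w)]_u (u ^+ 4)%:E)%E by apply: integral_ge0 => u _; rewrite lee_fin.
by case: (\int[kappa (x w)]_u (u ^+ 4)%:E)%E => //= r _; rewrite ?leey.
Qed.

End conditional_moments.

(** * Gram matrices *)

Section gram_forms.
Context {R : realType} {K : nat}.

Lemma linE (x : K.-tuple R) (v : 'cV[R]_K) : lin x v = \sum_j tnth x j * v j 0.
Proof. by rewrite /lin mxE; apply: eq_bigr => j _; rewrite !mxE. Qed.

Lemma weighted_gramE n (xs : n.-tuple (K.-tuple R)) (a : 'I_n -> R) j l :
  weighted_gram xs a j l = n%:R^-1 * \sum_i a i * (tnth (tnth xs i) j * tnth (tnth xs i) l).
Proof.
rewrite /weighted_gram mxE summxE; congr (_ * _); apply: eq_bigr => i _.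
by rewrite !mxE big_ord1 !mxE.
Qed.

Lemma weighted_gram_sym n (xs : n.-tuple (K.-tuple R)) (a : 'I_n -> R) :
  (weighted_gram xs a)^T = weighted_gram xs a.
Proof.
apply/matrixP => j l; rewrite mxE !weighted_gramE; congr (_ * _).
by apply: eq_bigr => i _; rewrite [_ * tnth _ l]mulrC.
Qed.

Lemma sqr_linE (x : K.-tuple R) (v : 'cV[R]_K) :
  lin x v ^+ 2 = \sum_j \sum_l v j 0 * (tnth x j * tnth x l) * v l 0.
Proof.
rewrite expr2 linE big_distrl /=; apply: eq_bigr => j _.
by rewrite big_distrr /=; apply: eq_bigr => l _; ring.
Qed.

Lemma quadform_weighted_gram n (xs : n.-tuple (K.-tuple R)) (a : 'I_n -> R) v :
  quadform (weighted_gram xs a) v = n%:R^-1 * \sum_i a i * lin (tnth xs i) v ^+ 2.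
Proof.
rewrite quadformE mulr_sumr.
under [RHS]eq_bigr do rewrite sqr_linE !mulr_sumr.
rewrite [RHS]exchange_big /=; apply: eq_bigr => j _.
under [RHS]eq_bigr do rewrite !mulr_sumr.
rewrite [RHS]exchange_big /=; apply: eq_bigr => l _.
rewrite weighted_gramE !mulr_sumr mulr_suml; apply: eq_bigr => i _; ring.
Qed.

Lemma cauchy_schwarz (u v : 'I_K -> R) :
  (\sum_j u j * v j) ^+ 2 <= (\sum_j u j ^+ 2) * \sum_j v j ^+ 2.
Proof.
set B := \sum_j u j * v j; set A := \sum_j u j ^+ 2; set C := \sum_j v j ^+ 2.
have A0 : 0 <= A by apply: sumr_ge0 => j _; exact: sqr_ge0.
have H s t : 0 <= s ^+ 2 * A - 2 * s * t * B + t ^+ 2 * C.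
  have -> : s ^+ 2 * A - 2 * s * t * B + t ^+ 2 * C = \sum_j (s * u j - t * v j) ^+ 2.
    rewrite /A /B /C !mulr_sumr -sumrB -big_split /=; apply: eq_bigr => j _; ring.
  by apply: sumr_ge0 => j _; exact: sqr_ge0.
have [A1|A1] := eqVneq A 0.
  have C0 : 0 <= C by apply: sumr_ge0 => j _; exact: sqr_ge0.
  have [->|B0] := eqVneq B 0; first by rewrite A1 mul0r expr0n.
  (* When [A = 0] the form is linear in [s], and this choice makes it [- (C + 2)], a
     contradiction. *)
  have := H ((C + 1) / B) 1; have -> : 2 * ((C + 1) / B) * 1 * B = 2 * (C + 1) by field.
  by rewrite A1; lra.
by have := H B A; have : 0 < A by [rewrite lt_def A1]; nra.
Qed.

Lemma sqr_euclid_norm (x : K.-tuple R) : euclid_norm x ^+ 2 = \sum_j tnth x j ^+ 2.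
Proof. by rewrite /euclid_norm sqr_sqrtr// sumr_ge0// => j _; exact: sqr_ge0. Qed.

Lemma euclid_norm_ge0 (x : K.-tuple R) : 0 <= euclid_norm x.
Proof. exact: sqrtr_ge0. Qed.

Lemma coord_le_euclid_norm (x : K.-tuple R) j : `|tnth x j| <= euclid_norm x.
Proof.
rewrite -(@ler_pXn2r _ 2)// ?nnegrE ?euclid_norm_ge0// real_normK ?num_real//.
rewrite sqr_euclid_norm (bigD1 j)//= lerDl.
by apply: sumr_ge0 => l _; exact: sqr_ge0.
Qed.

Lemma sqr_lin_le (x : K.-tuple R) (v : 'cV[R]_K) :
  lin x v ^+ 2 <= euclid_norm x ^+ 2 * \sum_j v j 0 ^+ 2.
Proof. by rewrite linE sqr_euclid_norm cauchy_schwarz. Qed.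

Lemma measurable_euclid_norm : measurable_fun setT (@euclid_norm R K).
Proof.
rewrite /euclid_norm; apply: measurableT_comp => //.
  exact: continuous_measurable_fun (@sqrt_continuous R).
apply: measurable_sum => j; apply: measurable_funX; exact: measurable_tnth.
Qed.

End gram_forms.

(** * Eigenvalues of weighted Gram matrices stay away from 0 *)

Section coercivity.
Context d (T : measurableType d) (R : realType) (K : nat) (P : probability T R).
Variables (x : nat -> {RV P >-> K.-tuple R}) (s : K.-tuple R -> R).
Hypotheses (indx : mutually_independent P (fun i w => x i w))
  (idx : identically_distributed P (fun i w => x i w))
  (ms : measurable_fun setT s) (s0 : forall u, 0 <= s u).

(** The first quotient bounds the weight by 1 and by [s]; the second compensates the growth of
    [x x^T]. Positivity is kept wherever [s] is positive, so no direction is lost by truncating. *)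
Let omega (u : K.-tuple R) : R := s u / (1 + s u) / (1 + euclid_norm u ^+ 2).

Let d1 u : 0 < 1 + s u. Proof. by have := s0 u; lra. Qed.
Let d2 (u : K.-tuple R) : 0 < 1 + euclid_norm u ^+ 2.
Proof. by have := sqr_ge0 (euclid_norm u); lra. Qed.

Let omega0 u : 0 <= omega u.
Proof. by rewrite /omega !divr_ge0// ltW. Qed.

Let omega_le u : omega u <= s u.
Proof.
rewrite /omega ler_pdivrMr// ler_pdivrMr//.
by have := s0 u; have := sqr_ge0 (euclid_norm u); nra.
Qed.

Let omega_gt0 u : 0 < s u -> 0 < omega u.
Proof. by move=> su; rewrite /omega !divr_gt0. Qed.

Let f j l u := omega u * (tnth u j * tnth u l).

Let f_le1 j l u : `|f j l u| <= 1.
Proof.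
have h1 : omega u * (1 + euclid_norm u ^+ 2) <= 1.
  rewrite /omega divfK ?gt_eqF// ler_pdivrMr// mul1r; have := s0 u; lra.
have h2 : `|tnth u j * tnth u l| <= 1 + euclid_norm u ^+ 2.
  rewrite normrM; have := coord_le_euclid_norm u j; have := coord_le_euclid_norm u l.
  by have := normr_ge0 (tnth u j); have := normr_ge0 (tnth u l); nra.
rewrite /f normrM (ger0_norm (omega0 u)); apply: le_trans h1.
by rewrite ler_wpM2l.
Qed.

Let measurable_inv_gt0 (h : K.-tuple R -> R) : measurable_fun setT h -> (forall u, 0 < h u) ->
  measurable_fun setT (fun u => (h u)^-1).
Proof.
move=> mh h0; rewrite (_ : (fun u => (h u)^-1) = (@powR R ^~ (-1)) \o h).
  by apply: measurableT_comp => //; exact: measurable_powR.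
by apply: funext => u /=; rewrite powR_inv1// ltW.
Qed.

Let momega : measurable_fun setT omega.
Proof.
apply: measurable_funM.
  apply: measurable_funM => //; apply: measurable_inv_gt0 => //.
  by apply: measurable_funD.
apply: measurable_inv_gt0 => //; apply: measurable_funD => //.
by apply: measurable_funX; exact: measurable_euclid_norm.
Qed.

Let mf j l : measurable_fun setT (f j l).
Proof. by apply: measurable_funM => //; apply: measurable_funM; exact: measurable_tnth. Qed.

Let rint_f j l i : rint P (fun w => f j l (x i w)).
Proof.
apply: (@rint_bounded _ _ _ _ _ 1); last by move=> w; exact: f_le1.
by apply: measurableT_comp => //; exact: measurable_funPT.
Qed.

Let M : 'M[R]_K := \matrix_(j, l) \int[P]_w f j l (x 0%N w).

Let quadform_M v : rint P (fun w => omega (x 0%N w) * lin (x 0%N w) v ^+ 2) /\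
  quadform M v = \int[P]_w (omega (x 0%N w) * lin (x 0%N w) v ^+ 2).
Proof.
have E : (fun w => omega (x 0%N w) * lin (x 0%N w) v ^+ 2) =
    fun w => \sum_j \sum_l (v j 0 * v l 0) * f j l (x 0%N w).
  apply: funext => w; rewrite sqr_linE mulr_sumr; apply: eq_bigr => j _.
  by rewrite mulr_sumr; apply: eq_bigr => l _; rewrite /f; ring.
have r j l : rint P (fun w => (v j 0 * v l 0) * f j l (x 0%N w)) by exact: rintZ.
have r' j : rint P (fun w => \sum_l (v j 0 * v l 0) * f j l (x 0%N w)) by exact: rint_sum.
rewrite E; split; first exact: rint_sum.
rewrite Exp_sum// quadformE; apply: eq_bigr => j _.
rewrite Exp_sum//; apply: eq_bigr => l _.
by rewrite ExpZ// mxE; ring.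
Qed.

Hypothesis nondeg : {ae P, forall w, forall v : 'cV[R]_K, v != 0 ->
  exists i, 0 < s (x i w) * lin (x i w) v ^+ 2}.

Let mlin v : measurable_fun setT (fun u : K.-tuple R => omega u * lin u v ^+ 2).
Proof.
apply: measurable_funM => //; apply: measurable_funX.
rewrite (_ : lin^~ v = fun u => \sum_j tnth u j * v j 0); last by apply: funext => u; exact: linE.
by apply: measurable_sum => j; apply: measurable_funM => //; exact: measurable_tnth.
Qed.

(** If the form vanished at [v], then by identical distribution all [omega (x_i) (x_i^T v)^2] would
    vanish almost surely, against [nondeg]. *)
Let posdef_M : posdef M.
Proof.
split.
  apply/matrixP => j l; rewrite !mxE; apply: eq_Rintegral => w _.
  by rewrite /f [tnth _ l * _]mulrC.
move=> v v0; have [r ->] := quadform_M v.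
pose F u := omega u * lin u v ^+ 2.
have F0 u : 0 <= F u by rewrite mulr_ge0// sqr_ge0.
rewrite lt_def; apply/andP; split; last by apply: Exp_ge0 => w; exact: F0.
apply/negP => /eqP E0.
have mF0 : measurable [set u | F u = 0].
  rewrite -[X in measurable X]setTI; exact: (mlin v) measurableT _ (measurable_set1 0).
have P0 : P (x 0%N @^-1` ~` [set u | F u = 0]) = 0%E.
  have i0 : (\int[P]_w `|(F (x 0%N w))%:E| = 0)%E.
    under eq_integral do rewrite gee0_abs ?lee_fin//.
    by rewrite -ExpE// E0.
  have /integrableP[mr _] := r.
  have [N [mN N0 sN]] := (ae_eq_integral_abs P measurableT mr).1 i0.
  apply/eqP; rewrite eq_le measure_ge0 andbT -N0; apply: le_measure; rewrite ?inE//.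
    by apply: measurable_funPTI; exact: measurableC.
  move=> w /= Fw; apply: sN => /= h; apply: Fw.
  by have := h I; case.
have Pi i : {ae P, forall w, F (x i w) = 0}.
  exists (x i @^-1` ~` [set u | F u = 0]); split.
  - by apply: measurable_funPTI; exact: measurableC.
  - by rewrite -P0; apply: idx; exact: measurableC.
  - by move=> w.
have := ae_forall_countable Pi; have := nondeg.
move=> h1 h2; have [N [mN N0 sN]] : {ae P, forall w, False}.
  apply: filterS2 h1 h2 => w /(_ v v0)[i hi] /(_ i) Fi.
  have si : 0 < s (x i w).
    by rewrite lt_def s0 andbT; apply/eqP => z; move: hi; rewrite z mul0r ltxx.
  move: hi; rewrite pmulr_rgt0// => hl.
  by have : 0 < F (x i w) by [rewrite mulr_gt0// omega_gt0]; rewrite Fi ltxx.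
have : (P setT <= P N)%E by apply: le_measure; rewrite ?inE// => w _; apply: sN.
by rewrite N0 probability_setT leNgt lte01.
Qed.

(* The weights [omega <= s] make the entries of [omega x x^T] bounded, so their dyadic averages
   converge to a positive definite matrix. *)
Lemma ae_weighted_gram_coercive :
  {ae P, forall w, exists2 l : R, 0 < l & exists N, forall n, (N <= n)%N -> forall v : 'cV[R]_K,
    l * (\sum_j v j 0 ^+ 2) <=
    quadform (weighted_gram (sample x n w) (fun i => s (tnth (sample x n w) i))) v}.
Proof.
have [l l0 hl] := posdef_coercive posdef_M.
have mx i : measurable_fun setT (x i) by exact: measurable_funPT.
have L jl := bounded_average_dyadic mx indx idx (mf jl.1 jl.2) (f_le1 jl.1 jl.2).
have := ae_forall_countable (I := ('I_K * 'I_K)%type) L.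
apply: filterS => w hw.
pose c : R := K%:R * K%:R.
have c0 : 0 <= c by rewrite mulr_ge0.
(* An error [e] in each entry changes the form by at most [K^2 e |v|^2 <= (l / 2) |v|^2]; the added
   1 covers [K = 0]. *)
pose e := l / (2 * (c + 1)).
have e0 : 0 < e by rewrite divr_gt0//; lra.
have ce : c * e <= l / 2.
  rewrite /e mulrA ler_pdivrMr; last lra.
  by rewrite mulrA divfK//; nra.
have hN (jl : 'I_K * 'I_K) := hw jl e e0.
have [N {}hN] : exists N, forall n, (N <= n)%N -> forall jl : 'I_K * 'I_K,
    `|(\sum_(i < 2 ^ n) f jl.1 jl.2 (x i w)) / (2 ^ n)%:R - M jl.1 jl.2| <= e.
  have [g hg] := choice hN; exists (\max_jl g jl) => n ng jl.
  by rewrite mxE; apply: hg; apply: leq_trans ng; exact: (leq_bigmax jl).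
(* The terms are nonnegative and [2^k <= n < 2^(k+1)], so passing from the dyadic average to the one
   over [n] costs a factor 2, and [l / 2] becomes [l / 4]. *)
exists (l / 4); first by rewrite divr_gt0.
exists (maxn 1 (2 ^ N)) => n; rewrite geq_max => /andP[n1 Nn] v.
pose k := trunc_log 2 n.
have kn : (2 ^ k <= n)%N by exact: trunc_logP.
have nk : (n < 2 ^ k.+1)%N by exact: trunc_log_ltn.
have Nk : (N <= k)%N by apply: trunc_log_max.
have kR : 0 < ((2 ^ k)%:R : R) by rewrite ltr0n expn_gt0.
have nR : 0 < (n%:R : R) by rewrite ltr0n.
have n2k : (n%:R : R) <= 2 * (2 ^ k)%:R by rewrite -natrM ler_nat -expnS ltnW.
set S2 := \sum_j v j 0 ^+ 2.
have S20 : 0 <= S2 by apply: sumr_ge0 => j _; exact: sqr_ge0.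
pose F u := omega u * lin u v ^+ 2.
have F0 u : 0 <= F u by rewrite mulr_ge0// sqr_ge0.
have h1 : l / 2 * S2 <= (\sum_(i < 2 ^ k) F (x i w)) / (2 ^ k)%:R.
  pose B := \matrix_(j, l) ((\sum_(i < 2 ^ k) f j l (x i w)) / (2 ^ k)%:R) : 'M[R]_K.
  have -> : (\sum_(i < 2 ^ k) F (x i w)) / (2 ^ k)%:R = quadform B v.
    rewrite quadformE mulr_suml.
    under eq_bigr do rewrite /F sqr_linE mulr_sumr mulr_suml.
    rewrite exchange_big /=; apply: eq_bigr => j _.
    under eq_bigr do rewrite mulr_sumr mulr_suml.
    rewrite exchange_big /=; apply: eq_bigr => m _.
    rewrite mxE mulr_suml mulr_sumr mulr_suml; apply: eq_bigr => i _; rewrite /f.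
    by ring.
  have : quadform (M - B) v <= c * e * S2.
    apply: le_trans (quadform_le _ _) _; apply: ler_wpM2r => //.
    apply: (@le_trans _ _ (\sum_(i < K) \sum_(j < K) e)).
      apply: ler_sum => i _; apply: ler_sum => j _.
      by rewrite !mxE distrC; have := hN k Nk (i, j); rewrite mxE.
    by rewrite !sumr_const card_ord /c -mulrnA -[leLHS]mulr_natl natrM.
  have -> : quadform (M - B) v = quadform M v - quadform B v.
    by rewrite /quadform mulmxBr mulmxBl !mxE.
  have := hl v; rewrite -/S2; have := ler_wpM2r S20 ce.
  by set qM := quadform M v; set qB := quadform B v; lra.
rewrite quadform_weighted_gram.
have h2 : \sum_(i < 2 ^ k) F (x i w) <= \sum_(i < n)
    s (tnth (sample x n w) i) * lin (tnth (sample x n w) i) v ^+ 2.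
  apply: le_trans (sum_nonneg_le (fun i => F0 (x i w)) kn) _.
  by apply: ler_sum => i _; rewrite tnth_mktuple ler_wpM2r// sqr_ge0.
move: h1; rewrite ler_pdivlMr// => h1.
rewrite [leRHS]mulrC ler_pdivlMr//; apply: le_trans h2; apply: le_trans h1.
have : 0 <= l / 4 * S2 by rewrite mulr_ge0// divr_ge0// ltW.
by nra.
Qed.

End coercivity.

(** * Least squares *)

Section least_squares_algebra.
Context {R : realType} {K n : nat}.
Variable xs : n.-tuple (K.-tuple R).
Implicit Types z : 'I_n -> R.

Definition cross z : 'cV[R]_K := n%:R^-1 *: \sum_i z i *: vec (tnth xs i).

Lemma crossB z z' : cross (fun i => z i - z' i) = cross z - cross z'.
Proof.
rewrite /cross -scalerBr -sumrB; congr (_ *: _).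
by apply: eq_bigr => i _; rewrite scalerBl.
Qed.

Lemma cross_lin b : cross (fun i => lin (tnth xs i) b) = gram xs *m b.
Proof.
rewrite /cross /gram /weighted_gram -scalemxAl mulmx_suml; congr (_ *: _).
apply: eq_bigr => i _; rewrite scale1r -mulmxA; set X := vec (tnth xs i).
by rewrite /lin -/X; apply/matrixP => j l; rewrite (ord1 l) mxE [RHS]mxE big_ord1 mulrC.
Qed.

Lemma gram_sym : (gram xs)^T = gram xs.
Proof. exact: weighted_gram_sym. Qed.

Hypothesis xsU : gram xs \in unitmx.

Lemma normal_equation_sol z b : cross z - gram xs *m b = 0 <-> b = invmx (gram xs) *m cross z.
Proof.
split=> [/eqP|->]; last by rewrite mulKVmx// subrr.
by rewrite subr_eq0 => /eqP ->; rewrite mulKmx.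
Qed.

Lemma olsE (ys : n.-tuple R) : ols xs ys = invmx (gram xs) *m cross (tnth ys).
Proof.
have eqE b : ols_equation xs ys b <-> b = invmx (gram xs) *m cross (tnth ys).
  rewrite -normal_equation_sol -cross_lin -crossB; exact: iff_refl.
rewrite /ols; case: xgetP => [b _ /eqE //|] /(_ (invmx (gram xs) *m cross (tnth ys))) h.
by exfalso; apply: h; apply/eqE.
Qed.

Variable kappa : R.-pker (K.-tuple R) ~> R.
Hypothesis k1 : forall i, rint (kprob kappa (tnth xs i)) (fun u => u).

Lemma cond_exp_residual i b : cond_exp kappa (tnth xs i) (fun u => u - lin (tnth xs i) b) =
  cond_exp kappa (tnth xs i) id - lin (tnth xs i) b.
Proof.
transitivity (\int[kprob kappa (tnth xs i)]_u (u - lin (tnth xs i) b)) => //.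
by rewrite (ExpB (k1 i) (rint_cst _ _)) Exp_cst.
Qed.

Lemma beta_fE :
  beta_f kappa xs = invmx (gram xs) *m cross (fun i => cond_exp kappa (tnth xs i) id).
Proof.
set mu := fun i => cond_exp kappa (tnth xs i) id.
have eqE b : beta_f_equation kappa xs b <-> b = invmx (gram xs) *m cross mu.
  rewrite -normal_equation_sol -cross_lin -crossB /beta_f_equation /cross.
  rewrite (_ : \sum_i (\col_j _) = \sum_i (mu i - lin (tnth xs i) b) *: vec (tnth xs i))//.
  apply: eq_bigr => i _; apply/matrixP => j l; rewrite !mxE /mu -cond_exp_residual.
  transitivity (\int[kprob kappa (tnth xs i)]_u
    (tnth (tnth xs i) j * (u - lin (tnth xs i) b))) => //.
  by rewrite (ExpZ _ (rintB (k1 i) (rint_cst _ _))) mulrC.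
rewrite /beta_f; case: xgetP => [b _ /eqE //|] /(_ (invmx (gram xs) *m cross mu)) h.
by exfalso; apply: h; apply/eqE.
Qed.

(** Both coefficients solve normal equations with the same Gram matrix, so misspecification cancels:
    the difference is linear in the outcomes centered at their conditional means, not at the linear
    predictor. *)
Lemma ols_sub_beta_f ys : ols xs ys - beta_f kappa xs =
  invmx (gram xs) *m cross (fun i => tnth ys i - cond_exp kappa (tnth xs i) id).
Proof. by rewrite olsE beta_fE crossB mulmxBr. Qed.

Local Notation s2 := (fun i => cond_var kappa (tnth xs i)).

Definition whitener : 'M[R]_K := inv_sqrt (V_f kappa xs) *m invmx (gram xs).

Lemma whitenerP : posdef (V_f kappa xs) ->
  whitener *m weighted_gram xs s2 *m whitener^T = 1%:M.
Proof.
move=> /inv_sqrt_sandwich; rewrite /V_f /sandwich /whitener trmx_mul.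
rewrite [(invmx (gram xs))^T]trmx_inv gram_sym.
by rewrite !mulmxA.
Qed.

(** The vector coefficient of the [i]-th centered outcome in the studentized estimator. *)
Definition influence i : 'cV[R]_K := (Num.sqrt n%:R / n%:R) *: (whitener *m vec (tnth xs i)).

Lemma studentized_ols ys : inv_sqrt (V_f kappa xs) *m
    (Num.sqrt n%:R *: (ols xs ys - beta_f kappa xs)) =
  \sum_i (tnth ys i - cond_exp kappa (tnth xs i) id) *: influence i.
Proof.
rewrite ols_sub_beta_f -scalemxAr mulmxA -/whitener /cross -scalemxAr scalerA mulmx_sumr.
rewrite scaler_sumr; apply: eq_bigr => i _.
by rewrite -scalemxAr !scalerA mulrC.
Qed.

Hypothesis n0 : (0 < n)%N.

Lemma sqr_influence_scale : (Num.sqrt n%:R / n%:R) ^+ 2 = n%:R^-1 :> R.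
Proof.
have nR : (n%:R : R) != 0 by rewrite pnatr_eq0 -lt0n.
by rewrite expr_div_n sqr_sqrtr//; field.
Qed.

Lemma influence_isotropic : posdef (V_f kappa xs) ->
  \sum_i s2 i *: (influence i *m (influence i)^T) = 1%:M.
Proof.
move=> /whitenerP <-; rewrite /weighted_gram -scalemxAr -scalemxAl mulmx_sumr mulmx_suml.
rewrite scaler_sumr; apply: eq_bigr => i _.
rewrite /influence linearZ /= -scalemxAl -scalemxAr !scalerA trmx_mul !mulmxA.
rewrite -!scalemxAr -!scalemxAl !scalerA -mulrA -expr2 sqr_influence_scale mulrC.
by rewrite !mulmxA.
Qed.

Variable l : R.
Hypotheses (l0 : 0 < l) (hl : forall v : 'cV[R]_K,
  l * (\sum_j v j 0 ^+ 2) <= quadform (weighted_gram xs s2) v).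

(** Cauchy-Schwarz on a row of [whitener], whose [K] entries have squares at most [1 / l] by
    [whitening_bound]. *)
Definition influence_bound i : R := Num.sqrt (K%:R / (l * n%:R)) * euclid_norm (tnth xs i).

Lemma influence_bound_ge0 i : 0 <= influence_bound i.
Proof. by rewrite mulr_ge0// ?sqrtr_ge0// euclid_norm_ge0. Qed.

Let kln : 0 <= K%:R / (l * n%:R) :> R.
Proof. by rewrite divr_ge0// mulr_ge0// ltW. Qed.

Lemma influence_le i j : posdef (V_f kappa xs) -> `|influence i j 0| <= influence_bound i.
Proof.
move=> pV; rewrite -(@ler_pXn2r _ 2)// ?nnegrE ?influence_bound_ge0// real_normK ?num_real//.
rewrite /influence_bound exprMn sqr_sqrtr// /influence mxE exprMn sqr_influence_scale.
have nR : 0 < (n%:R : R) by rewrite ltr0n.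
have -> : K%:R / (l * n%:R) * euclid_norm (tnth xs i) ^+ 2 =
    n%:R^-1 * (K%:R / l * euclid_norm (tnth xs i) ^+ 2).
  by field; rewrite !gt_eqF.
rewrite ler_wpM2l ?invr_ge0 ?(ltW nR)// mxE sqr_euclid_norm.
under eq_bigr do rewrite [vec _ _ _]mxE.
apply: le_trans (cauchy_schwarz (fun m => whitener j m) (fun m => tnth (tnth xs i) m)) _.
apply: ler_wpM2r.
  by apply: sumr_ge0 => m _; exact: sqr_ge0.
apply: (@le_trans _ _ (\sum_(m < K) l^-1)).
  by apply: ler_sum => m _; exact: whitening_bound l0 hl (whitenerP pV) j m.
by rewrite sumr_const card_ord -[leLHS]mulr_natl.
Qed.

End least_squares_algebra.

(** * Normal approximation for one fixed design *)

Section conditional_central_limit.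
Context {R : realType} {K n : nat}.
Variables (xs : n.-tuple (K.-tuple R)) (kappa : R.-pker (K.-tuple R) ~> R).
Variable q : probability (n.-tuple R) R.
Hypothesis qE : forall B : 'I_n -> set R, (forall i, measurable (B i)) ->
  fine (q (rect B)) = \prod_i fine (kprob kappa (tnth xs i) (B i)).
Hypothesis k4 : forall i, rint (kprob kappa (tnth xs i)) (fun u => u ^+ 4).
Hypotheses (n0 : (0 < n)%N) (xsU : gram xs \in unitmx) (pV : posdef (V_f kappa xs)).
Variable l : R.
Hypotheses (l0 : 0 < l) (hl : forall v : 'cV[R]_K,
  l * (\sum_j v j 0 ^+ 2) <=
    quadform (weighted_gram xs (fun i => cond_var kappa (tnth xs i))) v).

Definition envelope (x : K.-tuple R) : R := 1 + moment4 kappa x + euclid_norm x ^+ 4.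

Lemma norm4_ge0 (x : K.-tuple R) : 0 <= euclid_norm x ^+ 4.
Proof. by rewrite exprn_ge0// euclid_norm_ge0. Qed.

Lemma envelope_ge1 x : 1 <= envelope x.
Proof.
by rewrite /envelope; have := moment4_ge0 kappa x; have := norm4_ge0 x; lra.
Qed.

Local Notation m i := (kprob kappa (tnth xs i) : probability R R).
Local Notation mu i := (cond_exp kappa (tnth xs i) id).
Local Notation D i := (envelope (tnth xs i)).

Lemma norm2_var_le i : euclid_norm (tnth xs i) ^+ 2 * cond_var kappa (tnth xs i) <= D i.
Proof.
have h1 := sqr_variance_le (k4 i).
have h2 := sqr_ge0 (euclid_norm (tnth xs i) ^+ 2 - cond_var kappa (tnth xs i)).
have h3 := norm4_ge0 (tnth xs i); have h4 := moment4_ge0 kappa (tnth xs i).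
have E : euclid_norm (tnth xs i) ^+ 4 = (euclid_norm (tnth xs i) ^+ 2) ^+ 2 by rewrite -exprM.
have h1' : cond_var kappa (tnth xs i) ^+ 2 <= moment4 kappa (tnth xs i) by exact: h1.
by rewrite /envelope E in h3 *; set a := euclid_norm _ ^+ 2 in h2 h3 *; nra.
Qed.

Lemma norm4_centered_fourth_le i :
  euclid_norm (tnth xs i) ^+ 4 * \int[m i]_u ((u - mu i) ^+ 4) <= 16 * D i ^+ 2.
Proof.
have h1 : \int[m i]_u ((u - mu i) ^+ 4) <= 16 * moment4 kappa (tnth xs i).
  exact: centered_fourth_le (k4 i).
have h3 := norm4_ge0 (tnth xs i); have h4 := moment4_ge0 kappa (tnth xs i).
apply: le_trans (ler_wpM2l h3 h1) _; rewrite /envelope.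
by set a := euclid_norm _ ^+ 4 in h3 *; set b := moment4 _ _ in h4 *; nra.
Qed.

(** The right-hand side is free of [t]. The AM-GM parameter [e] and the smoothing width [dlt] stay
    free here, to be tuned once the two averages of the envelope are under control; 16 comes from
    the centered fourth moment. *)
Lemma clt_bound (e dlt : R) (t : 'cV[R]_K) : 0 < e -> 0 < dlt ->
  `|fine (q [set ys | forall j, (inv_sqrt (V_f kappa xs) *m
       (Num.sqrt n%:R *: (ols xs ys - beta_f kappa xs))) j 0 <= t j 0]) -
    \prod_j ncdf (t j 0)| <=
  2 * (1 + @gauss4 R) * @orthant_taylor R K dlt *
    (e * (K%:R / l * ((\sum_i D i) / n%:R)) +
     16 * (K%:R / l) ^+ 2 * ((\sum_i D i ^+ 2) / n%:R ^+ 2) / e) + K%:R * (3 * dlt).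
Proof.
move=> e0 dlt0.
have k1 i := fourth_moment_rint1 (k4 i).
pose a i := influence xs kappa i.
pose Z i (ys : n.-tuple R) := tnth ys i.
have mZ i : measurable_fun setT (Z i) by exact: measurable_tnth.
have indZ : mutually_independent q Z by exact: coordinates_mutually_independent qE.
have lawZ i B : measurable B -> q (Z i @^-1` B) = m i B by exact: coordinate_law qE i B.
pose S := wsum Z a (fun i => mu i) (index_enum 'I_n).
have SE ys j : tnth (S ys) j = (inv_sqrt (V_f kappa xs) *m
       (Num.sqrt n%:R *: (ols xs ys - beta_f kappa xs))) j 0.
  rewrite /S wsumE (studentized_ols xsU k1) summxE; apply: eq_bigr => i _.
  by rewrite [RHS]mxE.
have mS : measurable_fun setT S by exact: measurable_wsum.
rewrite (_ : [set ys | _] = [set ys | forall j, tnth (S ys) j <= t j 0]); last first.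
  by apply/seteqP; split => ys /= h j; [rewrite SE|rewrite -SE].
apply: orthant_sandwich => // tau.
have uF := @orthant_fun_unit R K dlt tau.
have -> : \int[q]_ys orthant_fun dlt tau (S ys) =
    avg_iter [seq (m i, a i, mu i) | i <- index_enum 'I_n] (orthant_fun dlt tau) (@origin R K).
  by apply: Exp_wsum => //; exact: index_enum_uniq.
have H := @lindeberg_orthant R K dlt dlt0 'I_n (index_enum 'I_n) (fun i => kprob kappa (tnth xs i))
  (fun i => mu i) (influence_bound xs l) (fun i => cond_var kappa (tnth xs i))
  (fun i => \int[m i]_u ((u - mu i) ^+ 4)) a e tau (@origin R K) e0
  (influence_bound_ge0 xs l) (fun i j => influence_le n0 l0 hl i j pV)
  (fun i => centered_fourth_rint (k4 i) (mu i)) (fun i => Exp_centered (k4 i))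
  (fun i => erefl) (fun i => erefl) (influence_isotropic n0 pV).
rewrite (eq_bigr (fun j => \int[std_normal R]_z step_fun dlt (tau j) (0 + z))) in H; last first.
  by move=> j _; rewrite tnth_mktuple.
apply: le_trans H _; apply: ler_wpM2l.
  by rewrite !mulr_ge0 ?addr_ge0 ?gauss4_ge0 ?orthant_taylor_ge0.
have nR : 0 < (n%:R : R) by rewrite ltr0n.
have ib2 i : influence_bound xs l i ^+ 2 =
    K%:R / (l * n%:R) * euclid_norm (tnth xs i) ^+ 2.
  by rewrite /influence_bound exprMn sqr_sqrtr// divr_ge0// mulr_ge0// ltW.
have ib4 i : influence_bound xs l i ^+ 4 =
    (K%:R / (l * n%:R)) ^+ 2 * euclid_norm (tnth xs i) ^+ 4.
  by rewrite (_ : 4 = 2 * 2)%N// !exprM ib2 exprMn.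
have c1 : 0 <= K%:R / (l * n%:R) :> R by rewrite divr_ge0// mulr_ge0// ltW.
rewrite big_split /=; apply: lerD.
  rewrite -mulr_sumr ler_pM2l// [leRHS]mulrA -[leRHS]mulrAC.
  have -> : K%:R / l / n%:R * (\sum_i D i) = \sum_i (K%:R / (l * n%:R)) * D i.
    by rewrite -mulr_sumr invfM mulrA.
  apply: ler_sum => i _; rewrite ib2 -[leLHS]mulrA.
  by apply: ler_wpM2l; [exact: c1|exact: norm2_var_le].
rewrite -mulr_suml ler_wpM2r ?invr_ge0 ?(ltW e0)//.
have -> : 16 * (K%:R / l) ^+ 2 * ((\sum_i D i ^+ 2) / n%:R ^+ 2) =
    \sum_i (K%:R / (l * n%:R)) ^+ 2 * (16 * D i ^+ 2).
  rewrite -mulr_sumr -mulr_sumr; set X := \sum_i _; field.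
  by rewrite !gt_eqF.
apply: ler_sum => i _; rewrite ib4 -[leLHS]mulrA.
apply: ler_wpM2l; [exact: sqr_ge0|exact: norm4_centered_fourth_le].
Qed.

End conditional_central_limit.

Lemma measurable_gt_set d (T : measurableType d) (R : realType) (f : T -> R) e :
  measurable_fun setT f -> measurable [set t | e < f t].
Proof.
move=> mf; rewrite (_ : [set t | e < f t] = [set: T] `&` f @^-1` `]e, +oo[%classic).
  by apply: mf => //; exact: measurable_itv.
by apply/seteqP; split => t /=; rewrite in_itv/= andbT//; case.
Qed.

Section matrix_bounds.
Context {R : realType} {K : nat}.

(** Positivity of [e] excludes the default value 0 of the maximum, which is all there is when
    [K = 0]. *)
Lemma mx_norm_gtP (A : 'M[R]_K) (e : R) : 0 < e ->
  (e < `|A|) <-> exists p, e < `|A p.1 p.2|.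
Proof.
move=> e0; rewrite {1}/Num.norm /= mx_normrE; split=> [/bigmax_gtP[|[p _ h]]|[p h]].
- by rewrite ltNge ltW.
- by exists p.
- by apply/bigmax_gtP; right; exists p.
Qed.

Variables (G : 'M[R]_K) (l : R).
Hypotheses (l0 : 0 < l) (GU : G \in unitmx)
  (hl : forall v : 'cV[R]_K, l * (\sum_j v j 0 ^+ 2) <= quadform G v).

Let Gi i j : `|invmx G i j| <= l^-1.
Proof. exact: coercive_invmx. Qed.

Lemma invmx_sandwich_entry (B : 'M[R]_K) i j :
  `|(invmx G *m B *m invmx G) i j| <= l^-1 ^+ 2 * \sum_p \sum_r `|B p r|.
Proof.
rewrite exchange_big mulr_sumr mxE; apply: le_trans (ler_norm_sum _ _ _) _.
apply: ler_sum => r _; rewrite mxE mulr_suml mulr_sumr.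
apply: le_trans (ler_norm_sum _ _ _) _; apply: ler_sum => p _.
rewrite !normrM mulrAC expr2; apply: ler_wpM2r => //.
by apply: ler_pM => //; rewrite ?invr_ge0 ?ltW.
Qed.

Lemma invmx_sqnorm_le (c : 'cV[R]_K) :
  \sum_p (invmx G *m c) p 0 ^+ 2 <= (K%:R / l) ^+ 2 * \sum_j c j 0 ^+ 2.
Proof.
set S := \sum_j c j 0 ^+ 2.
have S0 : 0 <= S by apply: sumr_ge0 => j _; exact: sqr_ge0.
have row p : (invmx G *m c) p 0 ^+ 2 <= K%:R * l^-1 ^+ 2 * S.
  rewrite mxE; apply: le_trans (cauchy_schwarz (fun j => invmx G p j) (fun j => c j 0)) _.
  apply: ler_wpM2r => //; apply: (@le_trans _ _ (\sum_(j < K) l^-1 ^+ 2)).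
    apply: ler_sum => j _; rewrite -[_ ^+ 2]real_normK ?num_real//.
    by rewrite lerXn2r ?nnegrE// invr_ge0 ltW.
  by rewrite sumr_const card_ord -[leLHS]mulr_natl.
apply: (@le_trans _ _ (\sum_(p < K) K%:R * l^-1 ^+ 2 * S)).
  by apply: ler_sum => p _; exact: row.
by rewrite sumr_const card_ord -[leLHS]mulr_natl exprMn mulrA mulrA -expr2.
Qed.

End matrix_bounds.

Section sandwich_algebra.
Context {R : realType} {K n : nat} (xs : n.-tuple (K.-tuple R)).

Lemma weighted_gramB (a b : 'I_n -> R) :
  weighted_gram xs a - weighted_gram xs b = weighted_gram xs (fun i => a i - b i).
Proof.
rewrite /weighted_gram -scalerBr -sumrB; congr (_ *: _).
by apply: eq_bigr => i _; rewrite scalerBl.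
Qed.

Lemma sandwichB (a b : 'I_n -> R) :
  sandwich xs a - sandwich xs b = sandwich xs (fun i => a i - b i).
Proof. by rewrite /sandwich -weighted_gramB mulmxBr mulmxBl. Qed.

Lemma linB (x : K.-tuple R) b c : lin x (b - c) = lin x b - lin x c.
Proof. by rewrite /lin mulmxBr !mxE. Qed.

End sandwich_algebra.

(** * Error of the variance estimator for one fixed design *)

Section conditional_variance_consistency.
Context {R : realType} {K n : nat}.
Variables (xs : n.-tuple (K.-tuple R)) (kappa : R.-pker (K.-tuple R) ~> R).
Variable q : probability (n.-tuple R) R.
Hypothesis qE : forall B : 'I_n -> set R, (forall i, measurable (B i)) ->
  fine (q (rect B)) = \prod_i fine (kprob kappa (tnth xs i) (B i)).
Hypothesis k4 : forall i, rint (kprob kappa (tnth xs i)) (fun u => u ^+ 4).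
Hypotheses (n0 : (0 < n)%N) (xsU : gram xs \in unitmx).
Variable l : R.
Hypotheses (l0 : 0 < l)
  (hl : forall v : 'cV[R]_K, l * (\sum_j v j 0 ^+ 2) <= quadform (gram xs) v).

Local Notation m i := (kprob kappa (tnth xs i) : probability R R).
Local Notation mu i := (cond_exp kappa (tnth xs i) id).
Local Notation D i := (envelope kappa (tnth xs i)).
Local Notation nrm i := (euclid_norm (tnth xs i)).
Local Notation x i j := (tnth (tnth xs i) j).
Local Notation s2 i := (cond_var kappa (tnth xs i)).
Local Notation N := (n%:R : R).

Let nR : 0 < N. Proof. by rewrite ltr0n. Qed.
Let D1 i : 1 <= D i. Proof. exact: envelope_ge1. Qed.
Let k1 i := fourth_moment_rint1 (k4 i).

Let proj_meas i : measurable_fun setT ((@tnth n R) ^~ i).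
Proof. exact: measurable_tnth. Qed.

Let q_rint i f : measurable_fun setT f -> rint (m i) f -> rint q (fun ys => f (tnth ys i)).
Proof. exact: (rint_prescribed_law (proj_meas i) (coordinate_law qE i)). Qed.

Let q_Exp i f : measurable_fun setT f -> rint (m i) f ->
  \int[q]_ys f (tnth ys i) = \int[m i]_u f u.
Proof. exact: (Exp_prescribed_law (proj_meas i) (coordinate_law qE i)). Qed.

Let q_sqr_sum (g : 'I_n -> R -> R) : (forall i, measurable_fun setT (g i)) ->
  (forall i, rint (m i) (fun u => g i u ^+ 2)) -> (forall i, \int[m i]_u g i u = 0) ->
  rint q (fun ys => (\sum_i g i (tnth ys i)) ^+ 2) /\
  \int[q]_ys ((\sum_i g i (tnth ys i)) ^+ 2) = \sum_i \int[m i]_u (g i u ^+ 2).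
Proof.
move=> mg g2 g0.
have g1 i : rint (m i) (g i).
  apply: (rint_dominated (mg i) (rintD (rint_cst _ 1) (g2 i))) => u.
  by rewrite -[g i u ^+ 2]real_normK ?num_real//; nra.
have mX i : measurable_fun setT (fun ys : n.-tuple R => g i (tnth ys i)).
  exact: (measurableT_comp (mg i) (proj_meas i)).
have mg2 i : measurable_fun setT (fun u => g i u ^+ 2) by exact: measurable_funX.
have X2 i : rint q (fun ys => g i (tnth ys i) ^+ 2) by exact: (q_rint (mg2 i) (g2 i)).
have orth (i j : 'I_n) : i != j -> \int[q]_ys (g i (tnth ys i) * g j (tnth ys j)) = 0.
  move=> ij; have ind := mutually_independent_indep2
    (coordinates_mutually_independent qE) ij.
  have := indep2_ExpM (q_rint (mg i) (g1 i)) (q_rint (mg j) (g1 j))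
    (indep2_comp (mg i) (mg j) ind).
  by case=> _ ->; rewrite (q_Exp (mg i) (g1 i)) g0 mul0r.
have [h1 h2] := Exp_sqr_sum (index_enum_uniq _) mX X2 orth.
split; first exact: h1.
by rewrite h2; apply: eq_bigr => i _; exact: (q_Exp (mg2 i) (g2 i)).
Qed.

Local Notation eps i ys := (tnth ys i - mu i).
Local Notation beta := (beta_f kappa xs).

Definition bias i : R := mu i - lin (tnth xs i) beta.
(** A bound for [|beta^f|^2]: [beta^f] is the inverse Gram matrix applied to the average of
    [mu_i x_i], whose entries are at most the average envelope because [|mu_i| |x_i| <= D_i]. *)
Definition sqnorm_beta : R := (K%:R / l) ^+ 2 * (K%:R * ((\sum_i D i) / N) ^+ 2).

Let sumD : 0 <= \sum_i D i.
Proof. by apply: sumr_ge0 => i _; apply: le_trans (D1 i). Qed.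

Let mean4 i : mu i ^+ 4 <= moment4 kappa (tnth xs i).
Proof. exact: mean_fourth_le (k4 i). Qed.

Let x_le i j : `|x i j| <= nrm i. Proof. exact: coord_le_euclid_norm. Qed.

Let sq4 (t : R) : t ^+ 4 = (t ^+ 2) ^+ 2. Proof. by rewrite -exprM. Qed.

Lemma mean_norm_le i : `|mu i| * nrm i <= D i.
Proof.
have := mean4 i; have := normr_ge0 (mu i); have := euclid_norm_ge0 (tnth xs i).
rewrite /envelope !sq4 -[mu i ^+ 2]real_normK ?num_real//.
set a := `|mu i|; set b := nrm i => a0 b0 h.
have h1 : 2 * (a * b) <= a ^+ 2 + b ^+ 2 by have := sqr_ge0 (a - b); lra.
have h2 : 2 * a ^+ 2 <= 1 + (a ^+ 2) ^+ 2 by have := sqr_ge0 (a ^+ 2 - 1); lra.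
have h3 : 2 * b ^+ 2 <= 1 + (b ^+ 2) ^+ 2 by have := sqr_ge0 (b ^+ 2 - 1); lra.
by have := sqr_ge0 (a ^+ 2); have := sqr_ge0 (b ^+ 2); lra.
Qed.

Lemma sqnorm_beta_f_le : \sum_p beta p 0 ^+ 2 <= sqnorm_beta.
Proof.
rewrite (beta_fE xsU k1); apply: le_trans (invmx_sqnorm_le l0 xsU hl _) _.
apply: ler_wpM2l; first exact: sqr_ge0.
have -> : K%:R * ((\sum_i D i) / N) ^+ 2 = \sum_(j < K) ((\sum_i D i) / N) ^+ 2.
  by rewrite sumr_const card_ord mulr_natl.
apply: ler_sum => j _.
rewrite -[leLHS]real_normK ?num_real// lerXn2r ?nnegrE ?divr_ge0//.
rewrite /cross mxE summxE normrM ger0_norm ?invr_ge0// mulrC ler_wpM2r ?invr_ge0//.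
apply: le_trans (ler_norm_sum _ _ _) _; apply: ler_sum => i _; rewrite !mxE normrM.
by apply: le_trans (mean_norm_le i); rewrite ler_wpM2l.
Qed.

Lemma sqr_bias_le i : bias i ^+ 2 <= 2 * mu i ^+ 2 + 2 * (nrm i ^+ 2 * sqnorm_beta).
Proof.
have h : lin (tnth xs i) beta ^+ 2 <= nrm i ^+ 2 * sqnorm_beta.
  apply: le_trans (sqr_lin_le _ _) _; apply: ler_wpM2l; [exact: sqr_ge0|exact: sqnorm_beta_f_le].
by rewrite /bias; have := sqr_ge0 (mu i + lin (tnth xs i) beta); lra.
Qed.

Let sb0 : 0 <= sqnorm_beta.
Proof. by rewrite mulr_ge0 ?sqr_ge0// mulr_ge0 ?sqr_ge0. Qed.

Lemma second_moment_bias_le i : nrm i ^+ 2 * (s2 i + bias i ^+ 2) <= (3 + 2 * sqnorm_beta) * D i.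
Proof.
have h1 := norm2_var_le k4 i; have h2 := sqr_bias_le i; have h3 := mean4 i.
have r0 := sqr_ge0 (nrm i); have h4 := moment4_ge0 kappa (tnth xs i).
have h5 : nrm i ^+ 2 * mu i ^+ 2 <= D i.
  move: h3; rewrite /envelope !sq4; set a := nrm i ^+ 2; set b := mu i ^+ 2 => h3.
  by have := sqr_ge0 (a - b); have := sqr_ge0 a; have := sqr_ge0 b; lra.
have h6 : nrm i ^+ 4 <= D i by rewrite /envelope; lra.
have h7 := ler_wpM2l r0 h2; have h8 := ler_wpM2r sb0 h6.
move: h7 h8; rewrite sq4 mulrDr; lra.
Qed.

(** Controls the second moment of a summand of [noise_bias]. The bias is split into the conditional
    mean and the linear predictor, and each resulting product is at most the square of the
    envelope. *)
Lemma cross_noise_le i j k : (x i j * x i k) ^+ 2 * (4 * bias i ^+ 2 * s2 i) <=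
  (8 + 8 * sqnorm_beta) * D i ^+ 2.
Proof.
have v0 : 0 <= s2 i by apply: Rintegral_ge0 => u _; exact: sqr_ge0.
have v2 : s2 i ^+ 2 <= moment4 kappa (tnth xs i) by exact: sqr_variance_le (k4 i).
have h2 := sqr_bias_le i; have h3 := mean4 i; have h1 := norm2_var_le k4 i.
have r0 := sqr_ge0 (nrm i); have h4 := moment4_ge0 kappa (tnth xs i).
have xx : (x i j * x i k) ^+ 2 <= nrm i ^+ 4.
  rewrite -[leLHS]real_normK ?num_real// sq4 lerXn2r ?nnegrE//.
  rewrite normrM expr2; apply: ler_pM => //.
have r4 := norm4_ge0 (tnth xs i).
apply: (@le_trans _ _ (nrm i ^+ 4 * (4 * bias i ^+ 2 * s2 i))).
  by apply: ler_wpM2r => //; apply: mulr_ge0 => //; apply: mulr_ge0 => //; exact: sqr_ge0.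
have rD : nrm i ^+ 4 <= D i by rewrite /envelope; lra.
have mD : moment4 kappa (tnth xs i) <= D i by rewrite /envelope; lra.
have msD : mu i ^+ 2 * s2 i <= D i.
  move: h3 v2; rewrite sq4; set a := mu i ^+ 2 => h3 v2.
  by have := sqr_ge0 (a - s2 i); lra.
have a1 : nrm i ^+ 4 * (mu i ^+ 2 * s2 i) <= D i ^+ 2.
  rewrite [D i ^+ 2]expr2; apply: ler_pM => //; by rewrite mulr_ge0 ?sqr_ge0.
have a2 : nrm i ^+ 4 * (nrm i ^+ 2 * s2 i) <= D i ^+ 2.
  rewrite [D i ^+ 2]expr2; apply: ler_pM => //; by rewrite mulr_ge0 ?sqr_ge0.
have a3 := ler_wpM2r sb0 a2.
have a4 : nrm i ^+ 4 * (4 * bias i ^+ 2 * s2 i) <=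
    nrm i ^+ 4 * (4 * (2 * mu i ^+ 2 + 2 * (nrm i ^+ 2 * sqnorm_beta)) * s2 i).
  by apply: ler_wpM2l => //; apply: ler_wpM2r => //; apply: ler_wpM2l.
move: a4 a3 a1; set A := nrm i ^+ 4; set B := mu i ^+ 2; set C := nrm i ^+ 2.
set E := s2 i; set F := sqnorm_beta; set H := bias i ^+ 2.
by lra.
Qed.

Definition noise_cross j (ys : n.-tuple R) : R := \sum_i N^-1 * x i j * eps i ys.
Definition noise_sqr j k (ys : n.-tuple R) : R :=
  \sum_i N^-1 * (x i j * x i k) * (eps i ys ^+ 2 - s2 i).
Definition noise_bias j k (ys : n.-tuple R) : R :=
  \sum_i N^-1 * (x i j * x i k) * (2 * bias i * eps i ys).
Definition residual_scale (ys : n.-tuple R) : R :=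
  \sum_i N^-1 * nrm i ^+ 2 * (eps i ys + bias i) ^+ 2.
Definition norm4_mean : R := \sum_i N^-1 * nrm i ^+ 4.
(** Dominates [|beta-hat - beta^f|^2], by [sqnorm_Delta_le], with a sum of squares of the noise
    whose mean is easily bounded. *)
Definition estimation_error (ys : n.-tuple R) : R :=
  (K%:R / l) ^+ 2 * \sum_j noise_cross j ys ^+ 2.

Local Notation a := ((\sum_i D i) / N).
Local Notation b := ((\sum_i D i ^+ 2) / N ^+ 2).

Let meps i k : measurable_fun setT (fun u : R => (u - mu i) ^+ k).
Proof. by apply: measurable_funX; apply: measurable_funB. Qed.

Let eps4 i : rint (m i) (fun u => (u - mu i) ^+ 4). Proof. exact: centered_fourth_rint. Qed.
Let eps2 i : rint (m i) (fun u => (u - mu i) ^+ 2). Proof. exact: rint_sq_of_fourth. Qed.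
Let eps1 i : rint (m i) (fun u => u - mu i). Proof. exact: rint_of_fourth. Qed.
Let Eeps i : \int[m i]_u (u - mu i) = 0. Proof. exact: Exp_centered (k4 i). Qed.
Let Eeps2 i : \int[m i]_u ((u - mu i) ^+ 2) = s2 i. Proof. by []. Qed.

Lemma Exp_noise_cross j : rint q (fun ys => noise_cross j ys ^+ 2) /\
  \int[q]_ys (noise_cross j ys ^+ 2) <= a / N.
Proof.
pose g i u := N^-1 * x i j * (u - mu i).
have gE i : (fun u => g i u ^+ 2) = fun u => (N^-1 * x i j) ^+ 2 * (u - mu i) ^+ 2.
  by apply: funext => u; rewrite /g exprMn.
have [] := @q_sqr_sum g.
- move=> i; apply: measurable_funM => //; exact: meps i 1%N.
- by move=> i; rewrite gE; exact: rintZ.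
- by move=> i; rewrite ExpZ// Eeps mulr0.
move=> r1 ->; split; first exact: r1.
rewrite -mulrA -invfM -expr2 mulrC mulr_sumr; apply: ler_sum => i _.
rewrite gE ExpZ// Eeps2 exprMn exprVn -mulrA ler_wpM2l ?invr_ge0 ?sqr_ge0//.
apply: le_trans (norm2_var_le k4 i); apply: ler_wpM2r.
  by apply: Rintegral_ge0 => u _; exact: sqr_ge0.
by rewrite -[leLHS]real_normK ?num_real// lerXn2r ?nnegrE ?euclid_norm_ge0.
Qed.

Let xx_le i j k : (x i j * x i k) ^+ 2 <= nrm i ^+ 4.
Proof.
rewrite -[leLHS]real_normK ?num_real// sq4 lerXn2r ?nnegrE ?sqr_ge0//.
by rewrite normrM expr2; apply: ler_pM.
Qed.

Lemma Exp_noise_sqr j k : rint q (fun ys => noise_sqr j k ys ^+ 2) /\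
  \int[q]_ys (noise_sqr j k ys ^+ 2) <= 16 * b.
Proof.
pose h i u : R := (u - mu i) ^+ 2 - s2 i.
pose g i u := N^-1 * (x i j * x i k) * h i u.
have hE i : (fun u => h i u ^+ 2) =
    fun u => (u - mu i) ^+ 4 - 2 * s2 i * (u - mu i) ^+ 2 + s2 i ^+ 2.
  by apply: funext => u; rewrite /h; ring.
have h4 i : rint (m i) (fun u => (u - mu i) ^+ 4 - 2 * s2 i * (u - mu i) ^+ 2).
  by apply: rintB (eps4 i) (rintZ _ (eps2 i)).
have h2 i : rint (m i) (fun u => h i u ^+ 2).
  by rewrite hE; apply: rintD (h4 i) (rint_cst _ _).
have Eh i : \int[m i]_u (h i u ^+ 2) <= \int[m i]_u ((u - mu i) ^+ 4).
  rewrite hE (ExpD (h4 i) (rint_cst _ _)) (ExpB (eps4 i) (rintZ _ (eps2 i))).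
  rewrite (ExpZ _ (eps2 i)) Eeps2 Exp_cst; have := sqr_ge0 (s2 i); lra.
have gE i : (fun u => g i u ^+ 2) = fun u => (N^-1 * (x i j * x i k)) ^+ 2 * h i u ^+ 2.
  by apply: funext => u; rewrite /g exprMn.
have h1 i : rint (m i) (h i) by apply: rintB (eps2 i) (rint_cst _ _).
have [] := @q_sqr_sum g.
- by move=> i; apply: measurable_funM => //; apply: measurable_funB.
- by move=> i; rewrite gE; exact: rintZ.
- move=> i; rewrite (ExpZ _ (h1 i)) (ExpB (eps2 i) (rint_cst _ _)) Eeps2 Exp_cst.
  by rewrite subrr mulr0.
move=> r1 ->; split; first exact: r1.
rewrite mulrA mulr_sumr mulr_suml; apply: ler_sum => i _.
rewrite gE (ExpZ _ (h2 i)).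
have -> : (N^-1 * (x i j * x i k)) ^+ 2 * \int[m i]_u (h i u ^+ 2) =
    (x i j * x i k) ^+ 2 * \int[m i]_u (h i u ^+ 2) / N ^+ 2.
  by set I := \int[m i]_u _; field; rewrite gt_eqF.
apply: ler_wpM2r.
  by rewrite invr_ge0 sqr_ge0.
apply: le_trans (norm4_centered_fourth_le k4 i); apply: ler_pM => //; first exact: sqr_ge0.
by apply: Exp_ge0 => u; exact: sqr_ge0.
Qed.

Lemma Exp_noise_bias j k : rint q (fun ys => noise_bias j k ys ^+ 2) /\
  \int[q]_ys (noise_bias j k ys ^+ 2) <= (8 + 8 * sqnorm_beta) * b.
Proof.
pose c i := N^-1 * (x i j * x i k) * (2 * bias i).
pose g i u := N^-1 * (x i j * x i k) * (2 * bias i * (u - mu i)).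
have gE i : g i = fun u => c i * (u - mu i) by apply: funext => u; rewrite /g mulrA.
have gE2 i : (fun u => g i u ^+ 2) = fun u => c i ^+ 2 * (u - mu i) ^+ 2.
  by apply: funext => u; rewrite gE exprMn.
have [] := @q_sqr_sum g.
- by move=> i; rewrite gE; apply: measurable_funM => //; exact: meps i 1%N.
- by move=> i; rewrite gE2; exact: rintZ.
- by move=> i; rewrite gE (ExpZ _ (eps1 i)) Eeps mulr0.
move=> r1 ->; split; first exact: r1.
rewrite mulrA mulr_sumr mulr_suml; apply: ler_sum => i _.
rewrite gE2 (ExpZ _ (eps2 i)) Eeps2.
have -> : c i ^+ 2 * s2 i = (x i j * x i k) ^+ 2 * (4 * bias i ^+ 2 * s2 i) / N ^+ 2.
  by rewrite /c; field; rewrite gt_eqF.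
apply: ler_wpM2r; [by rewrite invr_ge0 sqr_ge0|exact: cross_noise_le].
Qed.

Lemma Exp_residual_scale : rint q residual_scale /\
  \int[q]_ys residual_scale ys <= (3 + 2 * sqnorm_beta) * a.
Proof.
pose h i u := (u - mu i + bias i) ^+ 2.
have hE i : h i = fun u => (u - mu i) ^+ 2 + 2 * bias i * (u - mu i) + bias i ^+ 2.
  by apply: funext => u; rewrite /h; ring.
have h0 i : rint (m i) (fun u => (u - mu i) ^+ 2 + 2 * bias i * (u - mu i)).
  exact: rintD (eps2 i) (rintZ _ (eps1 i)).
have h1 i : rint (m i) (h i) by rewrite hE; exact: rintD (h0 i) (rint_cst _ _).
have mh i : measurable_fun setT (h i) by exact: rint_measurable (h1 i).
have Eh i : \int[m i]_u h i u = s2 i + bias i ^+ 2.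
  rewrite hE (ExpD (h0 i) (rint_cst _ _)) (ExpD (eps2 i) (rintZ _ (eps1 i))).
  by rewrite (ExpZ _ (eps1 i)) Eeps Eeps2 Exp_cst mulr0 addr0.
have r i : rint q (fun ys => N^-1 * nrm i ^+ 2 * h i (tnth ys i)).
  by apply: rintZ; exact: q_rint.
split; first exact: (rint_sum _ r).
rewrite /residual_scale (@Exp_sum _ _ _ _ _ _ (fun i ys => N^-1 * nrm i ^+ 2 * h i (tnth ys i)))//.
rewrite mulrA mulr_sumr mulr_suml; apply: ler_sum => i _.
rewrite (ExpZ _ (q_rint (mh i) (h1 i))) (q_Exp (mh i) (h1 i)) Eh.
have -> : N^-1 * nrm i ^+ 2 * (s2 i + bias i ^+ 2) = nrm i ^+ 2 * (s2 i + bias i ^+ 2) / N by ring.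
by apply: ler_wpM2r; [rewrite invr_ge0 ltW|exact: second_moment_bias_le].
Qed.

Lemma norm4_mean_le : 0 <= norm4_mean <= a.
Proof.
have r4 i := norm4_ge0 (tnth xs i).
rewrite /norm4_mean -mulr_sumr mulr_ge0 ?invr_ge0 ?(ltW nR) ?sumr_ge0//=.
rewrite mulrC; apply: ler_wpM2r; first by rewrite invr_ge0 ltW.
by apply: ler_sum => i _; rewrite /envelope; have := moment4_ge0 kappa (tnth xs i); lra.
Qed.

Lemma Exp_estimation_error : rint q estimation_error /\
  \int[q]_ys estimation_error ys <= (K%:R / l) ^+ 2 * (K%:R * (a / N)).
Proof.
have r : rint q (fun ys => \sum_j noise_cross j ys ^+ 2).
  by apply: rint_sum => j; exact: (Exp_noise_cross j).1.
split; first exact: rintZ.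
rewrite (ExpZ _ r) ler_wpM2l ?sqr_ge0// Exp_sum; last by move=> j; exact: (Exp_noise_cross j).1.
have -> : K%:R * (a / N) = \sum_(j < K) (a / N) by rewrite sumr_const card_ord mulr_natl.
by apply: ler_sum => j _; exact: (Exp_noise_cross j).2.
Qed.

Local Notation Delta ys := (ols xs ys - beta).
Local Notation error ys := (n%:R *: V_EHW xs ys - (V_f kappa xs + B_f kappa xs)).

Definition residual_excess (ys : n.-tuple R) i : R :=
  residual xs ys i ^+ 2 - s2 i - bias i ^+ 2.

Lemma ehw_errorE ys : error ys = sandwich xs (residual_excess ys).
Proof.
rewrite /V_EHW scalerA mulfV ?gt_eqF// scale1r opprD addrA /V_f /B_f !sandwichB.
congr (sandwich xs _); apply: funext => i.
by rewrite (cond_exp_residual k1).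
Qed.

(** The residual is [eps + bias - lin x Delta]; the first two groups are centered, and the last one
    is small with [Delta]. *)
Lemma residual_excessE ys i : residual_excess ys i = (eps i ys ^+ 2 - s2 i) + 2 * bias i * eps i ys
  + (lin (tnth xs i) (Delta ys) ^+ 2 - 2 * (eps i ys + bias i) * lin (tnth xs i) (Delta ys)).
Proof. by rewrite /residual_excess /residual linB /bias; ring. Qed.

Lemma sqnorm_Delta_le ys : \sum_p Delta ys p 0 ^+ 2 <= estimation_error ys.
Proof.
rewrite (ols_sub_beta_f xsU k1); apply: le_trans (invmx_sqnorm_le l0 xsU hl _) _.
rewrite /estimation_error; apply: ler_wpM2l; first exact: sqr_ge0.
apply: ler_sum => j _; rewrite /cross mxE summxE mulr_sumr /noise_cross.
rewrite (eq_bigr (fun i => N^-1 * x i j * eps i ys))// => i _; rewrite !mxE; ring.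
Qed.

Variable s : R.
Hypothesis s0 : 0 < s.

(** Absolute values are traded for squares, [|t| <= s + t^2 / s] for the centered parts and
    [|2 e g| <= s e^2 + g^2 / s] for the cross term with the estimation error, so that second
    moments suffice. The free [s] is chosen small before [n] is chosen large. *)
Definition entry_bound j k ys : R :=
  s + noise_sqr j k ys ^+ 2 / s + (s + noise_bias j k ys ^+ 2 / s) +
  (s * residual_scale ys + (s^-1 + 1) * norm4_mean * estimation_error ys).

Let norm_le_sqr (t : R) : `|t| <= s + t ^+ 2 / s.
Proof.
rewrite -[t ^+ 2]real_normK ?num_real//; have := normr_ge0 t; set u := `|t| => u0.
rewrite -(ler_pM2l s0) mulrDr mulrCA mulfV ?gt_eqF// mulr1.
by have := sqr_ge0 (s - u); have := sqr_ge0 s; have := sqr_ge0 u; nra.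
Qed.

Lemma weighted_gram_excess_le ys j k :
  `|weighted_gram xs (residual_excess ys) j k| <= entry_bound j k ys.
Proof.
pose rest i := lin (tnth xs i) (Delta ys) ^+ 2
  - 2 * (eps i ys + bias i) * lin (tnth xs i) (Delta ys).
have -> : weighted_gram xs (residual_excess ys) j k =
    noise_sqr j k ys + noise_bias j k ys + \sum_i N^-1 * (x i j * x i k) * rest i.
  rewrite weighted_gramE mulr_sumr -!big_split /=; apply: eq_bigr => i _.
  by rewrite residual_excessE /rest; ring.
rewrite /entry_bound; apply: le_trans (ler_normD _ _) _; apply: lerD.
  by apply: le_trans (ler_normD _ _) _; apply: lerD; exact: norm_le_sqr.
apply: le_trans (ler_norm_sum _ _ _) _.
rewrite [s * residual_scale ys]mulr_sumr /norm4_mean mulr_sumr mulr_suml -big_split /=.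
apply: ler_sum => i _.
have N0 : 0 <= N^-1 by rewrite invr_ge0 ltW.
have U0 := sqnorm_Delta_le ys; set U := estimation_error ys in U0 *.
have g2 := sqr_lin_le (tnth xs i) (Delta ys); rewrite /rest.
set g := lin (tnth xs i) (Delta ys) in g2 *; set e := eps i ys + bias i.
have xx : `|x i j * x i k| <= nrm i ^+ 2 by rewrite normrM expr2; apply: ler_pM.
have g3 : g ^+ 2 <= nrm i ^+ 2 * U.
  by apply: le_trans g2 _; apply: ler_wpM2l => //; exact: sqr_ge0.
have h : `|g ^+ 2 - 2 * e * g| <= s * e ^+ 2 + (s^-1 + 1) * (nrm i ^+ 2 * U).
  apply: le_trans (ler_normB _ _) _; rewrite (ger0_norm (sqr_ge0 g)).
  have : `|2 * e * g| <= s * e ^+ 2 + s^-1 * g ^+ 2.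
    have si : s * s^-1 = 1 by rewrite mulfV ?gt_eqF.
    have si0 : 0 < s^-1 by rewrite invr_gt0.
    rewrite ler_norml; apply/andP; split.
      have : 0 <= s * (e + s^-1 * g) ^+ 2 by rewrite mulr_ge0 ?sqr_ge0// ltW.
      have -> : s * (e + s^-1 * g) ^+ 2 =
          s * e ^+ 2 + 2 * e * g * (s * s^-1) + (s * s^-1) * s^-1 * g ^+ 2
        by ring.
      by rewrite si; lra.
    have : 0 <= s * (e - s^-1 * g) ^+ 2 by rewrite mulr_ge0 ?sqr_ge0// ltW.
    have -> : s * (e - s^-1 * g) ^+ 2 =
        s * e ^+ 2 - 2 * e * g * (s * s^-1) + (s * s^-1) * s^-1 * g ^+ 2
      by ring.
    by rewrite si; lra.
  have s1 : 0 <= s^-1 + 1 by rewrite addr_ge0 ?invr_ge0 ?ltW.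
  by have := ler_wpM2l s1 g3; lra.
rewrite !normrM (ger0_norm N0).
have -> : s * (N^-1 * nrm i ^+ 2 * e ^+ 2) + (s^-1 + 1) * (N^-1 * nrm i ^+ 4) * U =
    N^-1 * (nrm i ^+ 2 * (s * e ^+ 2 + (s^-1 + 1) * (nrm i ^+ 2 * U))).
  by rewrite sq4; ring.
rewrite -mulrA ler_wpM2l//; apply: ler_pM => //.
by rewrite -normrM.
Qed.

Lemma Exp_entry_bound j k : rint q (entry_bound j k) /\ \int[q]_ys entry_bound j k ys <=
  s + 16 * b / s + (s + (8 + 8 * sqnorm_beta) * b / s) +
  (s * ((3 + 2 * sqnorm_beta) * a) + (s^-1 + 1) * a * ((K%:R / l) ^+ 2 * (K%:R * (a / N)))).
Proof.
have [r1 e1] := Exp_noise_sqr j k; have [r2 e2] := Exp_noise_bias j k.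
have [r3 e3] := Exp_residual_scale; have [r4 e4] := Exp_estimation_error.
have E : entry_bound j k = fun ys => s + s^-1 * noise_sqr j k ys ^+ 2 +
    (s + s^-1 * noise_bias j k ys ^+ 2) +
    (s * residual_scale ys + (s^-1 + 1) * norm4_mean * estimation_error ys).
  by apply: funext => ys; rewrite /entry_bound ![_ / s]mulrC.
have q1 := rintD (rint_cst q s) (rintZ s^-1 r1).
have q2 := rintD (rint_cst q s) (rintZ s^-1 r2).
have q3 := rintZ s r3; have q4 := rintZ ((s^-1 + 1) * norm4_mean) r4.
have q12 := rintD q1 q2; have q34 := rintD q3 q4.
rewrite E; split; first exact: rintD.
rewrite (ExpD q12 q34) (ExpD q1 q2) (ExpD q3 q4) (ExpD (rint_cst q s) (rintZ s^-1 r1)).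
rewrite (ExpD (rint_cst q s) (rintZ s^-1 r2)) (ExpZ _ r1) (ExpZ _ r2) (ExpZ _ r3) (ExpZ _ r4).
have si0 : 0 < s^-1 by rewrite invr_gt0.
have /andP[n40 n4a] := norm4_mean_le.
rewrite !Exp_cst ![_ / s]mulrC; apply: lerD; [apply: lerD|apply: lerD].
- by rewrite lerD2l ler_pM2l.
- by rewrite lerD2l ler_pM2l.
- by rewrite ler_pM2l.
apply: ler_pM => //.
- by rewrite mulr_ge0// addr_ge0// ltW.
- apply: Exp_ge0 => ys; apply: mulr_ge0; first exact: sqr_ge0.
  by apply: sumr_ge0 => i _; exact: sqr_ge0.
by apply: ler_wpM2l => //; rewrite addr_ge0// ltW.
Qed.

(** [ols] is defined by choice; the closed form [olsE] makes it linear in the outcomes. *)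
Lemma measurable_residual i : measurable_fun setT (residual xs ^~ i).
Proof.
rewrite /residual; apply: measurable_funB; first exact: measurable_tnth.
rewrite (_ : (fun ys => _) = fun ys => \sum_j x i j *
    \sum_k invmx (gram xs) j k * \sum_r (N^-1 * tnth (tnth xs r) k) * tnth ys r).
  apply: measurable_sum => j; apply: measurable_funM => //.
  apply: measurable_sum => k; apply: measurable_funM => //.
  apply: measurable_sum => r; apply: measurable_funM => //.
apply: funext => ys; rewrite linE; apply: eq_bigr => j _; congr (_ * _).
rewrite (olsE xsU) mxE; apply: eq_bigr => k _; congr (_ * _).
rewrite /cross mxE summxE mulr_sumr; apply: eq_bigr => r _; rewrite !mxE; ring.
Qed.

Lemma measurable_ehw_error p : measurable_fun setT (fun ys => error ys p.1 p.2).
Proof.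
rewrite (_ : (fun ys => _) = fun ys => \sum_k (\sum_j invmx (gram xs) p.1 j *
    (N^-1 * \sum_i residual_excess ys i * (x i j * x i k))) * invmx (gram xs) k p.2).
  apply: measurable_sum => k; apply: measurable_funM => //.
  apply: measurable_sum => j; apply: measurable_funM => //.
  apply: measurable_funM => //.
  apply: measurable_sum => i; apply: measurable_funM => //.
  apply: measurable_funB => //; apply: measurable_funB => //; apply: measurable_funX.
  exact: measurable_residual.
apply: funext => ys; rewrite ehw_errorE /sandwich mxE; apply: eq_bigr => k _.
by rewrite mxE; congr (_ * _); apply: eq_bigr => j _; rewrite weighted_gramE.
Qed.

Lemma ehw_bound e : 0 < e ->
  (q [set ys | (e < `|error ys|)%R] <= (e^-1 * (l^-1 ^+ 2 * (K%:R ^+ 2 *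
   (s + 16 * b / s + (s + (8 + 8 * sqnorm_beta) * b / s) +
   (s * ((3 + 2 * sqnorm_beta) * a) +
    (s^-1 + 1) * a * ((K%:R / l) ^+ 2 * (K%:R * (a / N))))))))%:E)%E.
Proof.
move=> e0; set C := s + _ / s + _ + _.
(* [F] dominates all entries of the error at once, so one use of Markov's inequality controls the
   norm. *)
pose F ys := l^-1 ^+ 2 * \sum_j \sum_k entry_bound j k ys.
have r j k := (Exp_entry_bound j k).1.
have rj j : rint q (fun ys => \sum_k entry_bound j k ys) by exact: rint_sum.
have rF : rint q F by apply: rintZ; exact: rint_sum.
have FE ys p : `|error ys p.1 p.2| <= F ys.
  rewrite ehw_errorE; apply: le_trans (invmx_sandwich_entry l0 xsU hl _ _ _) _.
  apply: ler_wpM2l; first by rewrite sqr_ge0.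
  by apply: ler_sum => j _; apply: ler_sum => k _; exact: weighted_gram_excess_le.
have EF : \int[q]_ys F ys <= l^-1 ^+ 2 * (K%:R ^+ 2 * C).
  rewrite ExpZ; last exact: rint_sum.
  apply: ler_wpM2l; first exact: sqr_ge0.
  have -> : K%:R ^+ 2 * C = \sum_(j < K) \sum_(k < K) C.
    by rewrite !sumr_const !card_ord -mulrnA -[RHS]mulr_natl natrM expr2.
  rewrite Exp_sum//; apply: ler_sum => j _; rewrite Exp_sum//.
  by apply: ler_sum => k _; exact: (Exp_entry_bound j k).2.
have F0 ys : 0 <= F ys.
  apply: mulr_ge0; first exact: sqr_ge0.
  by do 2!(apply: sumr_ge0 => ? _); apply: le_trans (weighted_gram_excess_le ys _ _).
apply: (@le_trans _ _ (q [set ys | (e < F ys)%R])).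
  apply: le_measure; rewrite ?inE.
  - rewrite (_ : [set ys | _] = \bigcup_(p in [set: 'I_K * 'I_K])
        [set ys | e < `|error ys p.1 p.2|]).
      apply: fin_bigcup_measurable => // p _.
      apply: measurable_gt_set.
      by apply: measurableT_comp => //; exact: measurable_ehw_error.
    apply/seteqP; split => ys /=; rewrite (mx_norm_gtP _ e0); first by case=> p; exists p.
    by case=> p _; exists p.
  - by apply: measurable_gt_set; exact: rint_measurable rF.
  - by move=> ys /= /(mx_norm_gtP _ e0)[p h]; apply: lt_le_trans h (FE ys p).
apply: le_trans (markov_ineq (rint_measurable rF) rF F0 e0) _.
by rewrite lee_fin ler_wpM2l// invr_ge0 ltW.
Qed.

End conditional_variance_consistency.

(** * Tools for the passage to the limit *)

Section convergence_to_zero.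
Context {R : realType}.

Lemma cvge_to0 (u : nat -> \bar R) : (forall n, 0 <= u n)%E ->
  (forall e : R, 0 < e -> exists N, forall n, (N <= n)%N -> (u n <= e%:E)%E) ->
  u @ \oo --> 0%E.
Proof.
move=> u0 ue; apply/fine_cvgP; split.
  have [N hN] := ue 1 ltr01; exists N => // n /= /hN un.
  by rewrite ge0_fin_numE// (le_lt_trans un)// ltry.
apply/cvgrPdist_le => e e0; have [N hN] := ue e e0.
exists N => // n /= /hN un; rewrite sub0r normrN ger0_norm ?fine_ge0//.
by rewrite -lee_fin fineK// ge0_fin_numE// (le_lt_trans un)// ltry.
Qed.

(** Dividing by [c + 1] also covers [c = 0]. *)
Lemma small_factor (c e : R) : 0 <= c -> 0 < e -> exists2 s, 0 < s & c * s <= e.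
Proof.
move=> c0 e0; exists (e / (c + 1)); first by rewrite divr_gt0//; lra.
by rewrite mulrA ler_pdivrMr; [nra|lra].
Qed.

Lemma sum_gt0_exists n (c : R) (F : 'I_n -> R) : 0 <= c -> 0 < c * \sum_i F i ->
  exists i, 0 < F i.
Proof.
move=> c0 h; apply: contrapT => /forallNP hF.
have : c * \sum_i F i <= 0.
  apply: mulr_ge0_le0 => //; apply: sumr_le0 => i _; rewrite leNgt; exact/negP.
by rewrite leNgt h.
Qed.

End convergence_to_zero.

Section studentized_events.
Context {R : realType} {K n : nat}.
Variables (xs : n.-tuple (K.-tuple R)) (kappa : R.-pker (K.-tuple R) ~> R).
Hypothesis xsU : gram xs \in unitmx.
Hypothesis k1 : forall i, rint (kprob kappa (tnth xs i)) (fun u => u).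

Lemma measurable_studentized_event (t : 'cV[R]_K) :
  measurable [set ys | forall j, (inv_sqrt (V_f kappa xs) *m
       (Num.sqrt n%:R *: (ols xs ys - beta_f kappa xs))) j 0 <= t j 0].
Proof.
rewrite (_ : [set ys | _] = \bigcap_(j in [set: 'I_K]) ~` [set ys | t j 0 <
    \sum_i (tnth ys i - cond_exp kappa (tnth xs i) id) * influence xs kappa i j 0]).
  apply: fin_bigcap_measurable => // j _; apply: measurableC; apply: measurable_gt_set.
  apply: measurable_sum => i; apply: measurable_funM => //; apply: measurable_funB => //.
  exact: measurable_tnth.
have E ys j : (inv_sqrt (V_f kappa xs) *m
       (Num.sqrt n%:R *: (ols xs ys - beta_f kappa xs))) j 0 =
    \sum_i (tnth ys i - cond_exp kappa (tnth xs i) id) * influence xs kappa i j 0.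
  by rewrite (studentized_ols xsU k1) summxE; apply: eq_bigr => i _; rewrite mxE.
apply/seteqP; split => ys /= h j.
  by move=> _; rewrite /= -E; apply/negP; rewrite -leNgt.
by rewrite E leNgt; apply/negP; exact: h.
Qed.

End studentized_events.

Lemma std_normal_vector_orthant (R : realType) (d : measure_display) (T : measurableType d)
    (P : probability T R) (K : nat) (W : 'I_K -> {RV P >-> R}) (t : 'cV[R]_K) :
  std_normal_vector P W ->
  P [set v | forall j, W j v <= t j 0] = (\prod_j ncdf (t j 0))%:E.
Proof.
move=> [ind lawW].
have := ind (index_enum 'I_K) (fun j => [set z | z <= t j 0]) (index_enum_uniq _)
  (fun j => measurable_le_set _).
rewrite (_ : [set w | forall i, i \in index_enum _ -> _] = [set v | forall j, W j v <= t j 0]).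
  move=> ->; rewrite -prodEFin; apply: eq_bigr => j _.
  by rewrite ncdfE lawW//; exact: measurable_le_set.
apply/seteqP; split => v /= h j; last by move=> _; exact: h.
by apply: h; exact: mem_index_enum.
Qed.

(** * Almost sure regularity of the design *)

Section almost_sure_regularity.
Context (R : realType) (K : nat) (d : measure_display) (T : measurableType d)
  (P : probability T R) (y : nat -> {RV P >-> R}) (x : nat -> {RV P >-> K.-tuple R})
  (kappa : R.-pker (K.-tuple R) ~> R)
  (Q : forall n : nat, R.-pker (n.-tuple (K.-tuple R)) ~> (n.-tuple R)).
Hypotheses
  (indxy : mutually_independent P (fun (i : nat) (w : T) => (y i w, x i w)))
  (idxy : identically_distributed P (fun (i : nat) (w : T) => (y i w, x i w)))
  (condk : forall i, cond_distribution P (x i) (y i) kappa)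
  (condQ : forall n, cond_distribution P (sample x n) (sample y n) (Q n))
  (y4 : (forall i, 'E_P[(fun w => y i w ^+ 4)%R] < +oo)%E)
  (x4 : (forall i, 'E_P[(fun w => euclid_norm (x i w) ^+ 4)%R] < +oo)%E)
  (pgram : {ae P, forall w, \forall n \near \oo, posdef (gram (sample x n w))})
  (pV : {ae P, forall w, \forall n \near \oo, posdef (V_f kappa (sample x n w))}).

Local Notation X w n := (sample x n w).
Local Notation D i w := (envelope kappa (x i w)).

Definition coercive_gram w (s : K.-tuple R -> R) := exists2 l : R, 0 < l &
  exists N, forall n, (N <= n)%N -> forall v : 'cV[R]_K, l * (\sum_j v j 0 ^+ 2) <=
    quadform (weighted_gram (X w n) (fun i => s (tnth (X w n) i))) v.

(** What the limits use about one outcome [w]. Constants and thresholds may depend on [w], but the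
    constants do not depend on [n]. *)
Definition regular_design w := [/\
  forall n (B : 'I_n -> set R), (forall i, measurable (B i)) ->
    fine (Q n (X w n) (rect B)) = \prod_(i < n) fine (kappa (x i w) (B i)),
  forall i, rint (kprob kappa (x i w)) (fun u => u ^+ 4),
  exists C, exists N, forall n, (N <= n)%N -> \sum_(i < n) D i w <= C * n%:R,
  tends0 (fun n => (\sum_(i < n) D i w ^+ 2) / n%:R ^+ 2) &
  [/\ coercive_gram w (fun=> 1), coercive_gram w (cond_var kappa),
    exists N, forall n, (N <= n)%N -> posdef (gram (X w n)) &
    exists N, forall n, (N <= n)%N -> posdef (V_f kappa (X w n))]].

Let mx i : measurable_fun setT (x i). Proof. exact: measurable_funPT. Qed.

Let indx : mutually_independent P (fun i w => x i w).
Proof.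
exact: (@mutually_independent_comp _ _ _ _ _ P _ _ nat _ (@snd R (K.-tuple R))
  measurable_snd indxy).
Qed.

Let idx : identically_distributed P (fun i w => x i w).
Proof.
move=> i j B mB; have E k : (fun w => (y k w, x k w)) @^-1` ([set: R] `*` B) = x k @^-1` B.
  by apply/seteqP; split => [w []|w h].
by rewrite -!E; apply: idxy; exact: measurableX.
Qed.

Let menv : measurable_fun setT (envelope kappa).
Proof.
apply: measurable_funD; first by apply: measurable_funD => //; exact: measurable_moment4.
by apply: measurable_funX; exact: measurable_euclid_norm.
Qed.

Let rint_env : rint P (envelope kappa \o x 0%N).
Proof.
apply: rintD; first by apply: rintD; [exact: rint_cst|exact: (rint_moment4 (condk 0) (y4 0))].
apply: rint_ge0.
- apply: measurable_funX; apply: measurableT_comp => //; exact: measurable_euclid_norm.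
- by move=> w; exact: norm4_ge0.
- by have := x4 0; rewrite unlock.
Qed.

(** For each outcome, positive definiteness at a single sample size is enough: a positive weighted
    sum of squares has a positive term, which is the nondegeneracy asked by
    [ae_weighted_gram_coercive]. *)
Let coercive_of_posdef (s : K.-tuple R -> R) : measurable_fun setT s -> (forall u, 0 <= s u) ->
  {ae P, forall w, exists n, posdef (weighted_gram (X w n) (fun i => s (tnth (X w n) i)))} ->
  {ae P, forall w, coercive_gram w s}.
Proof.
move=> ms s0 h; apply: (ae_weighted_gram_coercive indx idx ms s0).
apply: filterS h => w [n [_ pn]] v v0; have := pn v v0.
rewrite quadform_weighted_gram => /sum_gt0_exists[]; first by rewrite invr_ge0.
by move=> i hi; exists i; move: hi; rewrite tnth_mktuple.
Qed.

(* [v^T Omega v = u^T V u] for [u = G v], since [V = G^-1 Omega G^-1]. *)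
Let posdef_omega n (xs : n.-tuple (K.-tuple R)) : posdef (gram xs) -> posdef (V_f kappa xs) ->
  posdef (weighted_gram xs (fun i => cond_var kappa (tnth xs i))).
Proof.
move=> pG [_ pVx]; split; first exact: weighted_gram_sym.
have GU := posdef_unitmx pG => v v0.
have u0 : gram xs *m v != 0.
  by apply: contra v0 => /eqP h; rewrite -[v](mulKmx GU) h mulmx0.
have := pVx _ u0; rewrite /quadform /V_f /sandwich trmx_mul gram_sym.
by rewrite !mulmxA mulmxK// mulmxKV// -!mulmxA.
Qed.

Lemma ae_regular_design : {ae P, forall w, regular_design w}.
Proof.
have A1 := cond_product_ae indxy condk condQ.
have A2 := ae_forall_countable (fun i => ae_rint4 (condk i) (y4 i)).
have env0 v : 0 <= envelope kappa v by apply: le_trans (envelope_ge1 kappa v).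
have A3 := ae_sum_linear mx indx idx menv env0 rint_env.
have A4 := ae_sum_sqr_negligible mx idx menv env0 rint_env.
have A5 : {ae P, forall w, coercive_gram w (fun=> 1)}.
  apply: coercive_of_posdef => //.
  by apply: filterS pgram => w [N _ /(_ N (leqnn N))]; exists N.
have A6 : {ae P, forall w, coercive_gram w (cond_var kappa)}.
  apply: coercive_of_posdef; first exact: measurable_cond_var.
    by move=> u; apply: Rintegral_ge0 => z _; exact: sqr_ge0.
  apply: filterS2 pgram pV => w [N1 _ h1] [N2 _ h2]; exists (maxn N1 N2).
  by apply: posdef_omega; [apply: h1|apply: h2] => /=; rewrite ?leq_maxl ?leq_maxr.
have A7 : {ae P, forall w, exists N, forall n, (N <= n)%N -> posdef (gram (X w n))}.
  by apply: filterS pgram => w [N _ h]; exists N.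
have A8 : {ae P, forall w, exists N, forall n, (N <= n)%N -> posdef (V_f kappa (X w n))}.
  by apply: filterS pV => w [N _ h]; exists N.
apply: filterS2 (filterI (filterI A1 A2) (filterI A3 A4)) (filterI (filterI A5 A6) (filterI A7 A8)).
by move=> w [[a1 a2] [a3 a4]] [[a5 a6] [a7 a8]].
Qed.

End almost_sure_regularity.

(** * Limits along a regular design *)

Section regular_design_limits.
Context (R : realType) (K : nat) (d : measure_display) (T : measurableType d)
  (P : probability T R) (x : nat -> {RV P >-> K.-tuple R})
  (kappa : R.-pker (K.-tuple R) ~> R)
  (Q : forall n : nat, R.-pker (n.-tuple (K.-tuple R)) ~> (n.-tuple R)) (w : T).
Hypothesis reg : regular_design x kappa Q w.

Local Notation X n := (sample x n w).
Local Notation q n := (kprob (Q n) (X n) : probability _ _).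
Local Notation D i := (envelope kappa (x i w)).

Let qE n (B : 'I_n -> set R) : (forall i, measurable (B i)) ->
  fine (q n (rect B)) = \prod_i fine (kprob kappa (tnth (X n) i) (B i)).
Proof.
move=> mB; case: reg => h _ _ _ _; have := h n B mB.
by rewrite /kprob => ->; apply: eq_bigr => i _; rewrite tnth_mktuple.
Qed.

Let k4 n i : rint (kprob kappa (tnth (X n) i)) (fun u => u ^+ 4).
Proof. by case: reg => _ h _ _ _; rewrite tnth_mktuple; exact: h. Qed.

Let sumDE n : \sum_i envelope kappa (tnth (X n) i) = \sum_(i < n) D i.
Proof. by apply: eq_bigr => i _; rewrite tnth_mktuple. Qed.

Let sumD2E n : \sum_i envelope kappa (tnth (X n) i) ^+ 2 = \sum_(i < n) D i ^+ 2.
Proof. by apply: eq_bigr => i _; rewrite tnth_mktuple. Qed.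

Let mean_bounded : exists2 C : R, 0 <= C &
  exists N, forall n, (N <= n)%N -> (\sum_(i < n) D i) / n%:R <= C.
Proof.
case: reg => _ _ [C [N h]] _ _; exists `|C| => //; exists (maxn 1 N) => n.
rewrite geq_max => /andP[n0 /h hn]; rewrite ler_pdivrMr ?ltr0n//.
by apply: le_trans hn _; rewrite ler_wpM2r// ler_norm.
Qed.

Let D2_ge0 n : 0 <= (\sum_(i < n) D i ^+ 2) / n%:R ^+ 2.
Proof. by rewrite divr_ge0 ?sqr_ge0// sumr_ge0// => i _; exact: sqr_ge0. Qed.

Let D_ge0 n : 0 <= (\sum_(i < n) D i) / n%:R.
Proof.
rewrite divr_ge0// sumr_ge0// => i _.
by apply: le_trans (envelope_ge1 kappa (x i w)).
Qed.

Lemma studentized_ols_limit (d' : measure_display) (T' : measurableType d')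
    (P' : probability T' R) (W : 'I_K -> {RV P' >-> R}) (e : R) :
  std_normal_vector P' W -> 0 < e -> exists N, forall n, (N <= n)%N -> forall t : 'cV[R]_K,
  (`| Q n (X n) [set u | forall j, ((inv_sqrt (V_f kappa (X n)) *m
       (Num.sqrt n%:R *: (ols (X n) u - beta_f kappa (X n)))) j 0 <= t j 0)%R]
    - P' [set v | forall j, (W j v <= t j 0)%R] | <= e%:E)%E.
Proof.
move=> hW e0; have [C C0 [N1 h1]] := mean_bounded.
case: (reg) => _ _ _ h2 [_ [l l0 [N3 h3]] [N4 h4] [N5 h5]].
(* Order of choice: the width [dlt] fixes the constant [A], then [th] makes the second-moment term
   small, then [b] makes the fourth-moment term small in spite of the division by [th]. The budget
   is [e/2 + e/4 + e/4]. *)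
have [dlt dlt0 hdlt] : exists2 dlt, 0 < dlt & (3 * K%:R) * dlt <= e / 2.
  by apply: small_factor; [rewrite mulr_ge0|rewrite divr_gt0].
pose A : R := 2 * (1 + @gauss4 R) * @orthant_taylor R K dlt.
have A0 : 0 <= A by rewrite !mulr_ge0 ?addr_ge0 ?gauss4_ge0 ?orthant_taylor_ge0.
have c0 : 0 <= K%:R / l by rewrite divr_ge0// ltW.
have e4 : 0 < e / 4 by rewrite divr_gt0.
have [th th0 hth] : exists2 th, 0 < th & (A * (K%:R / l * C)) * th <= e / 4.
  by apply: small_factor => //; rewrite mulr_ge0// mulr_ge0.
have [b b0 hb] : exists2 b, 0 < b & (A * (16 * (K%:R / l) ^+ 2 / th)) * b <= e / 4.
  apply: small_factor => //; rewrite mulr_ge0// divr_ge0 ?(ltW th0)//.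
  by rewrite mulr_ge0// sqr_ge0.
have [N2 {}h2] := h2 b b0.
exists (maxn 1 (maxn N1 (maxn N2 (maxn N3 (maxn N4 N5))))) => n.
rewrite !geq_max => /andP[n0 /andP[/h1 an /andP[/h2 bn /andP[/h3 ln /andP[/h4 pG /h5 pV]]]]] t.
have GU := posdef_unitmx pG.
have := @clt_bound R K n (X n) kappa (q n) (@qE n) (@k4 n) n0 GU pV l l0 ln th dlt t th0 dlt0.
rewrite sumDE sumD2E -/A.
set S := [set u | _]; set a := _ / n%:R in an *; set b' := _ / n%:R ^+ 2 in bn *.
move=> H; rewrite (std_normal_vector_orthant t hW).
have mS : measurable S.
  by apply: measurable_studentized_event => // i; exact: fourth_moment_rint1 (k4 i).
have fS : q n S \is a fin_num by exact: fin_num_measure.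
rewrite -[Q n (X n) S]/(q n S) -(fineK fS) -EFinB abse_EFin lee_fin.
apply: le_trans H _.
have a0 : 0 <= a by exact: D_ge0.
have b'0 : 0 <= b' by exact: D2_ge0.
move: bn; rewrite ger0_norm// => bn.
have t1 : A * (th * (K%:R / l * a)) <= e / 4.
  apply: le_trans hth; rewrite -[leRHS]mulrA [_ * C * th]mulrC.
  by apply: ler_wpM2l => //; apply: ler_wpM2l; [exact: ltW|exact: ler_wpM2l].
have t2 : A * (16 * (K%:R / l) ^+ 2 * b' / th) <= e / 4.
  apply: le_trans hb; rewrite -[leRHS]mulrA [_ * b' / th]mulrAC.
  apply: ler_wpM2l => //; apply: ler_wpM2l => //.
  by rewrite divr_ge0 ?(ltW th0)// mulr_ge0// sqr_ge0.
have : K%:R * (3 * dlt) <= e / 2 by rewrite mulrA [K%:R * 3]mulrC.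
by rewrite mulrDr; lra.
Qed.

Lemma ehw_limit (e eta : R) : 0 < e -> 0 < eta -> exists N, forall n, (N <= n)%N ->
  (Q n (X n) [set u | (e < `|n%:R *: V_EHW (X n) u - (V_f kappa (X n) + B_f kappa (X n))|)%R]
     <= eta%:E)%E.
Proof.
move=> e0 eta0; have [C C0 [N1 h1]] := mean_bounded.
case: (reg) => _ _ _ h2 [[l l0 [N3 h3]] _ [N4 h4] _].
pose k2 := (K%:R / l) ^+ 2 : R.
have k20 : 0 <= k2 by exact: sqr_ge0.
pose Bt := k2 * (K%:R * C ^+ 2) : R.
have Bt0 : 0 <= Bt by rewrite mulr_ge0// mulr_ge0// sqr_ge0.
pose M := e^-1 * (l^-1 ^+ 2 * K%:R ^+ 2).
have M0 : 0 <= M by rewrite mulr_ge0 ?invr_ge0 ?(ltW e0)// mulr_ge0 ?sqr_ge0.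
have [dl dl0 hdl] := small_factor M0 eta0.
have dl3 : 0 < dl / 3 by rewrite divr_gt0.
(* The coefficient collects the terms linear in [s]: twice [s] itself and the residual scale. Then
   [b] absorbs the sum [16 + (8 + 8 Bt) = 24 + 8 Bt] divided by [s], and [N5] the term of order
   [1/n]. *)
have [s s0 hs] : exists2 s, 0 < s & (2 + (3 + 2 * Bt) * C) * s <= dl / 3.
  by apply: small_factor => //; rewrite addr_ge0// mulr_ge0// addr_ge0// mulr_ge0.
have [b b0 hb] : exists2 b, 0 < b & ((24 + 8 * Bt) / s) * b <= dl / 3.
  by apply: small_factor => //; rewrite divr_ge0 ?(ltW s0)// addr_ge0// mulr_ge0.
have s1 : 0 <= s^-1 + 1 by rewrite addr_ge0// invr_ge0 ltW.
have [N5 h5] := archi_large ((s^-1 + 1) * C * (k2 * (K%:R * C))) dl3.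
have [N2 {}h2] := h2 b b0.
exists (maxn 1 (maxn N1 (maxn N2 (maxn N3 (maxn N4 N5))))) => n.
rewrite !geq_max => /andP[n0 /andP[/h1 an /andP[/h2 bn /andP[/h3 ln /andP[/h4 pG /h5 hn]]]]].
have GU := posdef_unitmx pG.
have := @ehw_bound R K n (X n) kappa (q n) (@qE n) (@k4 n) n0 GU l l0 ln s s0 e e0.
rewrite /sqnorm_beta sumDE sumD2E -/k2.
have a0 := D_ge0 n; have b'0 := D2_ge0 n.
set a := (\sum_(i < n) D i) / n%:R in an a0 *.
set b' := (\sum_(i < n) D i ^+ 2) / n%:R ^+ 2 in bn b'0 *.
move: bn; rewrite ger0_norm// => bn H; apply: le_trans H _.
rewrite lee_fin; apply: le_trans hdl.
rewrite /M -[e^-1 * _ * dl]mulrA -[_ * K%:R ^+ 2 * dl]mulrA.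
apply: ler_wpM2l; first by rewrite invr_ge0 ltW.
apply: ler_wpM2l; first exact: sqr_ge0.
apply: ler_wpM2l; first exact: sqr_ge0.
set Ba := k2 * (K%:R * a ^+ 2).
have BaB : Ba <= Bt.
  by do 2!apply: ler_wpM2l => //; rewrite lerXn2r ?nnegrE.
have Ba0 : 0 <= Ba by rewrite mulr_ge0// mulr_ge0// sqr_ge0.
have si0 : 0 < s^-1 by rewrite invr_gt0.
have t1 : s * ((3 + 2 * Ba) * a) <= s * ((3 + 2 * Bt) * C).
  by apply: ler_wpM2l; [exact: ltW|apply: ler_pM => //; lra].
have t2 : (24 + 8 * Ba) * b' / s <= (24 + 8 * Bt) / s * b.
  rewrite mulrAC; apply: ler_pM => //; first by rewrite divr_ge0 ?(ltW s0)//; lra.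
  by rewrite ler_pM2r//; lra.
have t3 : (s^-1 + 1) * a * (k2 * (K%:R * (a / n%:R))) <= dl / 3.
  apply: le_trans (hn n0).
  have -> : (s^-1 + 1) * a * (k2 * (K%:R * (a / n%:R))) =
      ((s^-1 + 1) * a * (k2 * (K%:R * a))) / n%:R by rewrite !mulrA.
  rewrite ler_wpM2r ?invr_ge0//; apply: ler_pM.
  - exact: mulr_ge0.
  - by rewrite mulr_ge0// mulr_ge0.
  - exact: ler_wpM2l.
  - by do 2!apply: ler_wpM2l => //.
have E : 16 * b' / s + (8 + 8 * Ba) * b' / s = (24 + 8 * Ba) * b' / s by ring.
by lra.
Qed.

End regular_design_limits.

Theorem theorem3p2 (R : realType) (K : nat)
    (d : measure_display) (T : measurableType d) (P : probability T R)
    (y : nat -> {RV P >-> R}) (x : nat -> {RV P >-> K.-tuple R})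
    (kappa : R.-pker (K.-tuple R) ~> R)
    (Q : forall n : nat, R.-pker (n.-tuple (K.-tuple R)) ~> (n.-tuple R))
    (d' : measure_display) (T' : measurableType d') (P' : probability T' R)
    (W : 'I_K -> {RV P' >-> R}) :
  mutually_independent P (fun (i : nat) (w : T) => (y i w, x i w)) ->
  identically_distributed P (fun (i : nat) (w : T) => (y i w, x i w)) ->
  (forall i, cond_distribution P (x i) (y i) kappa) ->
  (forall n, cond_distribution P (sample x n) (sample y n) (Q n)) ->
  (forall i, 'E_P[(fun w => y i w ^+ 4)%R] < +oo)%E ->
  (forall i, 'E_P[(fun w => euclid_norm (x i w) ^+ 4)%R] < +oo)%E ->
  {ae P, forall w, \forall n \near \oo, posdef (gram (sample x n w))} ->
  {ae P, forall w, \forall n \near \oo, posdef (V_f kappa (sample x n w))} ->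
  std_normal_vector P' W ->
  cvg_in_distribution_given P (sample x) Q
    (fun n xs ys => inv_sqrt (V_f kappa xs) *m
       (Num.sqrt n%:R *: (ols xs ys - beta_f kappa xs)))
    P' W /\
  negligible_given P (sample x) Q
    (fun n xs ys => n%:R *: V_EHW xs ys - (V_f kappa xs + B_f kappa xs)).
Proof.
move=> indxy idxy condk condQ y4 x4 pgram pV hW.
have reg := ae_regular_design indxy idxy condk condQ y4 x4 pgram pV.
split; rewrite /cvg_in_distribution_given /negligible_given; apply: filterS reg => w reg.
  (* Convergence to 0 gives the upper limit; the value at [t = 0] shows that the supremum is
     nonnegative. *)
  apply: (cvg_limn_einf_sup _).2; apply: cvge_to0 => [n|e e0].
    apply: le_trans (ereal_sup_ubound _); last by exists 0.
    exact: abse_ge0.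
  have [N hN] := studentized_ols_limit reg hW e0.
  by exists N => n Nn; apply: ge_ereal_sup => _ [t _ <-]; exact: hN.
move=> e e0; apply: cvge_to0 => [n|eta eta0]; first exact: measure_ge0.
exact: ehw_limit.
Qed.
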